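(* Let $G$ be a homogeneous group and let $d$ be a homogeneous distance on $G$. The differentiation theorem holds on $(G,d)$ for all locally finite Borel measures if and only if $(G,d)$ satisfies the Besicovitch Covering Property (BCP).
   Context: All Lie algebras are real and finite-dimensional. A positive grading of a Lie algebra $\mathfrak g$ is a family $(V_t)_{t\in(0,+\infty)}$ of vector subspaces, all but finitely many equal to $\{0\}$, with $\mathfrak g=\bigoplus_{t>0}V_t$ and $[V_s,V_t]\subset V_{s+t}$ for all $s,t>0$. A graded group is a connected and simply connected Lie group $G$ whose Lie algebra $\mathfrak g$ is endowed with a given positive grading. A homogeneous group is a graded group whose grading satisfies $V_t=\{0\}$ for all $t\in(0,1)$. Dilations: for $\lambda>0$, $\delta_\lambda:\mathfrak g\to\mathfrak g$ is the linear map with $\delta_\lambda(X)=\lambda^tX$ for $X\in V_t$; it is a Lie algebra automorphism, and $\delta_\lambda:G\to G$ also denotes the unique Lie group automorphism whose induced Lie algebra map is $\delta_\lambda$. A distance $d$ on $G$ (satisfying the usual metric axioms) is homogeneous if it is left-invariant and $d(\delta_\lambda(p),\delta_\lambda(q))=\lambda d(p,q)$ for all $p,q\in G$ and $\lambda>0$. Balls are the sets $B_d(p,r):=\{q\in X: d(q,p)\le r\}$, $r>0$. BCP: a metric space $(X,d)$ satisfies BCP if there is a constant $N\ge1$ such that, for every bounded $A\subset X$ and every family $\mathcal B$ of balls such that each point of $A$ is the center of some ball of $\mathcal B$, there is a finite or countable subfamily $\mathcal F\subset\mathcal B$ whose balls cover $A$ and such that every point of $X$ belongs to at most $N$ balls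 of $\mathcal F$. For a locally finite Borel measure $\mu$ on a metric space $(X,d)$, the differentiation theorem holds on $(X,d)$ for $\mu$ if, for all $f\in L^1_{\rm loc}(\mu)$, $$\lim_{r\downarrow0}\frac{1}{\mu(B_d(p,r))}\int_{B_d(p,r)}f(q)\,d\mu(q)=f(p)$$ for $\mu$-almost every $p\in X$. *)

(* Defs.v *)
From HB Require Import structures.
From mathcomp Require Import all_boot all_order all_algebra.
From mathcomp Require Import all_classical all_reals all_analysis.

Set Implicit Arguments.
Unset Strict Implicit.
Unset Printing Implicit Defensive.

Import Order.TTheory GRing.Theory Num.Theory numFieldNormedType.Exports.

Local Open Scope classical_set_scope.
Local Open Scope ring_scope.

(* An abstract group that is also a topological space; the two structures are
   tied together by [lie_group] below. Pointedness is only there because the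
   measurable types of the library are pointed. *)
#[short(type="groupTopologicalType")]
HB.structure Definition GroupTopological :=
  {G of PointedTopological G & Group G}.

(** * Smooth maps and smooth manifolds *)

(* For open [U] in finite-dimensional spaces, [f] is C^(k+1) on [U] iff it is
   differentiable on [U] with all its directional derivatives C^k on [U]. *)
Fixpoint Ck_on (R : realType) (E F : normedModType R) (k : nat) (U : set E)
    (f : E -> F) : Prop :=
  if k is k'.+1 then
    (forall x, U x -> differentiable f x) /\
    (forall v, Ck_on k' U (fun x => 'D_v f x))
  else forall x, U x -> {for x, continuous f}.

Definition smooth_on (R : realType) (E F : normedModType R) (U : set E)
    (f : E -> F) : Prop :=
  forall k, Ck_on k U f.

(* [chart_fun] only matters on [chart_dom], and [chart_inv] on its image. *)
Record chart (M E : Type) := Chart {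
  chart_dom : set M;
  chart_fun :> M -> E;
  chart_inv : E -> M
}.

Definition chart_cod (M E : Type) (c : chart M E) : set E := c @` chart_dom c.

Definition is_chart (M E : topologicalType) (c : chart M E) : Prop :=
  [/\ open (chart_dom c),
      open (chart_cod c),
      forall p, chart_dom c p -> chart_inv c (c p) = p,
      forall p, chart_dom c p -> {for p, continuous c} &
      forall x, chart_cod c x -> {for x, continuous (chart_inv c)}].

Definition prod_chart (M E M' E' : Type) (c : chart M E) (c' : chart M' E') :
    chart (M * M') (E * E') :=
  Chart (chart_dom c `*` chart_dom c')
        (fun p => (c p.1, c' p.2))
        (fun x => (chart_inv c x.1, chart_inv c' x.2)).

Definition prod_atlas (M E M' E' : Type) (A : set (chart M E))
    (A' : set (chart M' E')) : set (chart (M * M') (E * E')) :=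
  [set prod_chart c c' | c in A & c' in A'].

(* [f] between charted spaces, read in the charts [c] and [c'] *)
Definition smooth_map (R : realType) (M M' : topologicalType)
    (E E' : normedModType R) (A : set (chart M E)) (A' : set (chart M' E'))
    (f : M -> M') : Prop :=
  continuous f /\
  forall c c', A c -> A' c' ->
    smooth_on (c @` (chart_dom c `&` f @^-1` chart_dom c'))
              (c' \o f \o chart_inv c).

Definition smooth_atlas (R : realType) (M : topologicalType)
    (E : normedModType R) (A : set (chart M E)) : Prop :=
  [/\ forall c, A c -> is_chart c,
      forall p, exists2 c, A c & chart_dom c p &
      forall c c', A c -> A c' ->
        smooth_on (c @` (chart_dom c `&` chart_dom c')) (c' \o chart_inv c)].

(** * Lie groups and their Lie algebras *)

Definition lie_group (R : realType) (n : nat) (G : groupTopologicalType)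
    (A : set (chart G 'rV[R]_n)) : Prop :=
  [/\ hausdorff_space G,
      @second_countable G,
      smooth_atlas A,
      smooth_map (prod_atlas A A) A (fun p : G * G => (p.1 * p.2)%g) &
      smooth_map A A (fun p : G => p^-1%g)].

(* Triviality of the fundamental group; connectedness is a separate
   hypothesis. *)
Definition simply_connected (R : realType) (T : topologicalType) : Prop :=
  forall f : R -> T, {within `[0, 1], continuous f} -> f 0 = f 1 ->
    exists2 H : R * R -> T,
      {within `[0, 1] `*` `[0, 1], continuous H} &
      forall s : R, `[0, 1]%classic s ->
        [/\ H (s, 0) = f s, H (s, 1) = f 0, H (0, s) = f 0 & H (1, s) = f 0].

(* Through a chart [e] whose domain contains the identity, the tangent space of
   G at the identity is 'rV[R]_n. [left_invariant_field e u] is the expression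
   in [e] of the left-invariant vector field g |-> d(L_g)_1(u), and the bracket
   is the value at the identity of the commutator of vector fields, whose
   coordinate expression is [X, Y](x) = DY(x)(X(x)) - DX(x)(Y(x)). *)
Definition left_invariant_field (R : realType) (n : nat)
    (G : groupTopologicalType) (e : chart G 'rV[R]_n) (u x : 'rV[R]_n) :
    'rV[R]_n :=
  'D_u (fun y => e (chart_inv e x * chart_inv e y)%g) (e 1%g).

Definition lie_bracket (R : realType) (n : nat) (G : groupTopologicalType)
    (e : chart G 'rV[R]_n) (u v : 'rV[R]_n) : 'rV[R]_n :=
  'D_u (left_invariant_field e v) (e 1%g)
  - 'D_v (left_invariant_field e u) (e 1%g).

(* Lie group automorphisms, and the Lie algebra map that they induce *)
Definition lie_automorphism (R : realType) (n : nat) (G : groupTopologicalType)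
    (A : set (chart G 'rV[R]_n)) (D : G -> G) : Prop :=
  [/\ forall p q, D (p * q)%g = (D p * D q)%g,
      smooth_map A A D &
      exists D' : G -> G, [/\ cancel D D', cancel D' D & smooth_map A A D']].

Definition lie_differential (R : realType) (n : nat) (G : groupTopologicalType)
    (e : chart G 'rV[R]_n) (D : G -> G) : 'rV[R]_n -> 'rV[R]_n :=
  'd (e \o D \o chart_inv e) (e 1%g).

(** * Graded and homogeneous groups *)

(* The family is indexed by (0, +oo): the values of [V] at nonpositive reals
   are irrelevant. [s] lists finitely many indices, outside of which [V]
   vanishes. *)
Definition positive_grading (R : realType) (n : nat)
    (br : 'rV[R]_n -> 'rV[R]_n -> 'rV[R]_n) (V : R -> {vspace 'rV[R]_n}) :
    Prop :=
  (exists s : seq R,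
    [/\ uniq s /\ (forall t, t \in s -> 0 < t),
        forall t : R, 0 < t -> t \notin s -> V t = 0%VS,
        (\sum_(t <- s) V t)%VS = fullv &
        directv (\sum_(t <- s) V t)]) /\
  (forall s t : R, 0 < s -> 0 < t -> forall X Y, X \in V s -> Y \in V t ->
    br X Y \in V (s + t)).

Definition graded_group (R : realType) (n : nat) (G : groupTopologicalType)
    (A : set (chart G 'rV[R]_n)) (e : chart G 'rV[R]_n)
    (V : R -> {vspace 'rV[R]_n}) : Prop :=
  [/\ lie_group A,
      connected [set: G],
      simply_connected R G,
      A e /\ chart_dom e 1%g &
      positive_grading (lie_bracket e) V].

Definition homogeneous_group (R : realType) (n : nat)
    (G : groupTopologicalType) (A : set (chart G 'rV[R]_n))
    (e : chart G 'rV[R]_n) (V : R -> {vspace 'rV[R]_n}) : Prop :=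
  graded_group A e V /\ (forall t : R, 0 < t -> t < 1 -> V t = 0%VS).

(* [delta l] is the Lie group automorphism inducing on the Lie algebra the
   linear map X |-> l^t X on each V_t. On a connected and simply connected G,
   it exists and is unique for each l > 0. *)
Definition dilations (R : realType) (n : nat) (G : groupTopologicalType)
    (A : set (chart G 'rV[R]_n)) (e : chart G 'rV[R]_n)
    (V : R -> {vspace 'rV[R]_n}) (delta : R -> G -> G) : Prop :=
  forall l : R, 0 < l ->
    lie_automorphism A (delta l) /\
    (forall (t : R) X, 0 < t -> X \in V t ->
      lie_differential e (delta l) X = (l `^ t) *: X).

(** * Distances *)

(* Distances are functions rather than instances of [metricType], because the
   topology of a homogeneous distance is not part of its definition. *)
Definition is_distance (R : realType) (X : Type) (d : X -> X -> R) : Prop :=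
  [/\ forall x y, 0 <= d x y,
      forall x y, d x y = 0 <-> x = y,
      forall x y, d x y = d y x &
      forall x y z, d x z <= d x y + d y z].

Definition homogeneous_distance (R : realType) (G : groupTopologicalType)
    (delta : R -> G -> G) (d : G -> G -> R) : Prop :=
  [/\ is_distance d,
      forall g p q : G, d (g * p)%g (g * q)%g = d p q &
      forall (l : R) p q, 0 < l -> d (delta l p) (delta l q) = l * d p q].

Definition cball (R : realType) (X : Type) (d : X -> X -> R) (p : X) (r : R) :
    set X :=
  [set q | d q p <= r].

Definition dist_bounded (R : realType) (X : Type) (d : X -> X -> R)
    (A : set X) : Prop :=
  exists M : R, forall x y, A x -> A y -> d x y <= M.

(* Balls are sets: the center and radius of an element of a family [B] need not
   be unique. *)
Definition BCP (R : realType) (X : Type) (d : X -> X -> R) : Prop :=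
  exists2 N : nat, (1 <= N)%N &
    forall (A : set X) (B : set (set X)),
      dist_bounded d A ->
      (forall b, B b -> exists p (r : R), 0 < r /\ b = cball d p r) ->
      (forall a, A a -> exists2 r : R, 0 < r & B (cball d a r)) ->
      exists F : set (set X),
        [/\ F `<=` B,
            countable F,
            A `<=` \bigcup_(b in F) b &
            forall x, ([set b | F b /\ b x] #<= `I_N)%card].

(** * Differentiation of measures *)

Definition dist_open (R : realType) (X : Type) (d : X -> X -> R) :
    set (set X) :=
  [set U | forall x, U x -> exists2 r : R, 0 < r & forall y, d y x < r -> U y].

Notation borel d := (g_sigma_algebraType (dist_open d)).

Definition locally_finite (R : realType) (X : pointedType) (d : X -> X -> R)
    (mu : {measure set (borel d) -> \bar R}) : Prop :=
  forall p, exists2 r : R, 0 < r & (mu (cball d p r) < +oo)%E.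

Definition locally_integrable (R : realType) (X : pointedType)
    (d : X -> X -> R) (mu : {measure set (borel d) -> \bar R})
    (f : borel d -> R) : Prop :=
  measurable_fun [set: borel d] f /\
  forall p, exists2 r : R, 0 < r & mu.-integrable (cball d p r) (EFin \o f).

(* For locally finite [mu] the measures of small balls are finite. Where they
   vanish, i.e. outside the support of [mu], the quotient is 0 by convention. *)
Definition differentiation_theorem (R : realType) (X : pointedType)
    (d : X -> X -> R) (mu : {measure set (borel d) -> \bar R}) : Prop :=
  forall f : borel d -> R, locally_integrable mu f ->
    \forall p \ae mu,
      (fine (mu (cball d p r)))^-1 * \int[mu]_(q in cball d p r) f q
        @[r --> 0^'+] --> f p.

(* Main.v *)
From HB Require Import structures.
Require Import Defs.
From mathcomp Require Import all_boot all_order all_algebra.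
From mathcomp Require Import all_classical all_reals all_analysis.
From mathcomp Require Import measurable_realfun.
From mathcomp Require Import ring lra zify.

(** The theorem compares two statements about a homogeneous distance through
    Besicovitch families: finite families of balls that have a common point and
    none of which contains the center of another one.

    The covering property implies differentiation in every metric space
    ([BCP_differentiation]). Let nu = g mu be finite, with g >= 0. From the
    balls B with lam mu(B) <= nu(B) that lie in an open set U and have their
    centers in a bounded set Q, the covering property extracts countably many
    that cover Q with overlap at most N; so the outer mu-measure of Q is at most
    N nu(U) / lam ([weak_type]). If g vanishes on Q, then U can be chosen with
    nu(U) small, because finite Borel measures are outer regular. Therefore nu
    has upper density 0 at mu-almost every zero of g ([upper_density_null]).
    Applied to the positive parts of f - a and a - f for all rational a, this
    says that the averages of f converge to f almost everywhere.

    Conversely, assume that the covering property fails. A greedy selection by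
    decreasing radii, together with a uniform bound on the number of e-separated
    points in a ball of radius 2e, shows that Besicovitch families of every
    cardinality exist ([BCP_of_bounded_besicovitch]). Translating and dilating
    one of them yields a star ([besicovitch_star]): the identity and N - 1
    further points such that, with a margin eta, the ball of radius rho i at
    the i-th point contains the identity but none of the other points. Replacing again
    and again each point by a small copy of a star with 2^(k+2) points produces
    a Cantor set, onto which the digits of the numbers of [0, 1) push Lebesgue
    measure. Call central the points that have the digit 0 at some level; their
    mass is at most 1/4 + 1/8 + ... = 1/2. Around a point that is not central,
    the ball of radius rho i at level k contains the whole central cell of the
    star of that level, but among the other cells only the one of the point
    itself, which has the same mass ([ball_mass]). So the averages of the
    indicator function of the non-central points are at most 1/2 along a
    sequence of radii tending to 0, at every non-central point, and these
    points do not form a null set ([stars_not_differentiable]).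

    The second half uses that closed balls are compact. As a homogeneous
    distance is defined without reference to the topology of G, this is a
    theorem about homogeneous groups. Continuity of the distance comes from its
    behaviour along exponentials of homogeneous vectors: for X in V_t, the point
    exp(c X) is the dilation by |c|^(1/t) of exp(X) or exp(- X), and every
    point close to the identity is a product of such exponentials with small
    coefficients ([hnorm_near1]). The exponential is constructed as the limit of
    the powers exp(Z) = lim (Z / k)^k in a chart, which only requires the
    group law to be twice continuously differentiable. Compactness of small
    balls comes from a dilation that contracts a neighbourhood of the identity:
    by connectedness its iterates send every point into that neighbourhood, so
    a point outside has an iterate in a compact shell on which the distance to
    the identity is bounded below ([small_hnorm_compact]). *)

Set Implicit Arguments.
Unset Strict Implicit.
Unset Printing Implicit Defensive.

Import Order.TTheory GRing.Theory Num.Theory numFieldNormedType.Exports.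

Local Open Scope classical_set_scope.
Local Open Scope ring_scope.

(** * Borel sets and regularity for a distance *)

Section DistTopology.
Variables (R : realType) (X : pointedType) (d : X -> X -> R).
Hypothesis dD : is_distance d.

Let d_xx x : d x x = 0. Proof. by have [_ h _ _] := dD; apply/h. Qed.
Let d_sym x y : d x y = d y x. Proof. by have [] := dD. Qed.
Let d_tri x y z : d x z <= d x y + d y z. Proof. by have [] := dD. Qed.

Lemma dist_openT : dist_open d setT.
Proof. by move=> x _; exists 1. Qed.

Lemma dist_open_bigcup (I : Type) (D : set I) (F : I -> set X) :
  (forall i, D i -> dist_open d (F i)) -> dist_open d (\bigcup_(i in D) F i).
Proof.
move=> FO x [i Di Fx]; have [r r0 rP] := FO i Di x Fx.
by exists r => // y yr; exists i => //; exact: rP.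
Qed.

Lemma dist_openI (A B : set X) : dist_open d A -> dist_open d B -> dist_open d (A `&` B).
Proof.
move=> oA oB x [Ax Bx]; have [r r0 rP] := oA x Ax; have [q q0 qP] := oB x Bx.
exists (Num.min r q); first by rewrite lt_min r0.
by move=> y; rewrite lt_min => /andP[yr yq]; split; [exact: rP|exact: qP].
Qed.

Lemma dist_open_ball p r : dist_open d [set x | d x p < r].
Proof.
move=> x /= xp; exists (r - d x p); first by rewrite subr_gt0.
by move=> y yx; have := d_tri y x p; lra.
Qed.

Lemma dist_open_cballC p r : dist_open d (~` cball d p r).
Proof.
move=> x /= /negP; rewrite -ltNge => px.
exists (d x p - r) => [|y yx /=]; first by rewrite subr_gt0.
have := d_tri x y p; rewrite [d x y]d_sym => h.
by rewrite /cball /=; apply/negP; rewrite -ltNge; lra.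
Qed.

Lemma dist_open_measurable (U : set (borel d)) : dist_open d U -> measurable U.
Proof. exact: sub_sigma_algebra. Qed.

Lemma dist_closed_measurable (K : set (borel d)) : dist_open d (~` K) -> measurable K.
Proof.
by move=> oK; rewrite -[K]setCK; apply: measurableC; exact: dist_open_measurable.
Qed.

Lemma cball_measurable p r : measurable (cball d p r : set (borel d)).
Proof. apply: dist_closed_measurable; exact: dist_open_cballC. Qed.

Variable nu : {measure set (borel d) -> \bar R}.
Hypothesis nu_fin : (nu setT < +oo)%E.

Lemma decreasing_small (F : nat -> set (borel d)) (eps : R) :
  (forall k, measurable (F k)) -> (forall k, F k.+1 `<=` F k) ->
  (nu (\bigcap_k F k) < eps%:E)%E -> exists k, (nu (F k) <= eps%:E)%E.
Proof.
move=> mF decF small.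
have nufin A : measurable A -> nu A \is a fin_num.
  move=> mA; rewrite ge0_fin_numE // (le_lt_trans _ nu_fin) // le_measure ?inE //.
have mI : measurable (\bigcap_k F k) by exact: bigcapT_measurable.
have noninc : nonincreasing_seq F.
  apply/nonincreasing_seqP => k; apply/subsetPset; exact: decF.
have cv : nu \o F @ \oo --> nu (\bigcap_k F k).
  apply: nonincreasing_cvg_mu => //.
  by rewrite -ge0_fin_numE //; exact: nufin.
apply: contrapT => nk.
have big k : (eps%:E <= nu (F k))%E.
  by rewrite leNgt; apply/negP => h; apply: nk; exists k; exact: ltW.
have : (eps%:E <= nu (\bigcap_k F k))%E.
  rewrite -(cvg_lim _ cv) //; apply: lime_ge; first by apply/cvg_ex; exists (nu (\bigcap_k F k)).
  exact: nearW.
by rewrite leNgt small.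
Qed.

(** Inner approximation is by closed sets rather than compact ones: this is
    the symmetric notion, stable under complements. *)
Definition regular (E : set (borel d)) : Prop := forall eps : R, 0 < eps ->
  exists K O : set (borel d), [/\ dist_open d (~` K), dist_open d O, K `<=` E, E `<=` O &
    (nu (O `\` K) <= eps%:E)%E].

(** An open set is the increasing union of the closed sets formed by the points
    whose open ball of radius 1/(k+1) lies in it. *)
Lemma regular_open U : dist_open d U -> regular U.
Proof.
move=> oU eps eps0.
pose K (k : nat) : set (borel d) := [set x | forall y, d y x < k.+1%:R^-1 -> U y].
have oK k : dist_open d (~` K k).
  move=> x /= nKx.
  have [y [yx nUy]] : exists y, d y x < k.+1%:R^-1 /\ ~ U y.
    apply: contrapT => ny; apply: nKx => y yx; apply: contrapT => nUy.
    by apply: ny; exists y.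
  exists (k.+1%:R^-1 - d y x); first by rewrite subr_gt0.
  move=> z zx Kz; apply: nUy; apply: Kz.
  by rewrite ltrBrDl in zx; apply: le_lt_trans zx; rewrite [d z x]d_sym; exact: d_tri.
have KU k : K k `<=` U by move=> x; apply; rewrite d_xx invr_gt0.
have mU := dist_open_measurable oU.
have mK k : measurable (K k) by exact: dist_closed_measurable.
have [|k x [Ux nKx]|| k kP] := @decreasing_small (fun k => U `\` K k) eps.
- by move=> k; exact: measurableD.
- split => // Kx; apply: nKx => y yx; apply: Kx; apply: lt_le_trans yx _.
  by rewrite lef_pV2 ?posrE // ler_nat.
- rewrite (_ : \bigcap_k _ = set0) ?measure0 ?lte_fin //.
  apply/seteqP; split => x // xI.
  have [Ux _] := xI 0%N Logic.I.
  have [r r0 rU] := oU x Ux.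
  have [k kr] : exists k : nat, k.+1%:R^-1 <= r.
    exists (Num.truncn r^-1); rewrite -[leRHS]invrK lef_pV2 ?posrE ?invr_gt0 //.
    have /andP[_ h] := truncn_itv (ltW (eq_ind_r _ r0 (invr_gt0 r))).
    exact: ltW h.
  have [_ nKx] := xI k Logic.I; apply: nKx => y yx; apply: rU.
  exact: lt_le_trans kr.
by exists (K k), U; split.
Qed.

Lemma regularC E : regular E -> regular (~` E).
Proof.
move=> rE eps eps0; have [K [U [oK oU KE EU small]]] := rE eps eps0.
exists (~` U), (~` K); split => //.
- by rewrite setCK.
- exact: subsetC.
- exact: subsetC.
- by rewrite setDE setCK setIC -setDE.
Qed.

(** The union of the inner approximations of all the [E k] need not be closed.
    As [nu] is finite, finitely many of them exhaust it up to small mass. *)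
Lemma regular_bigcup (E : nat -> set (borel d)) :
  (forall k, regular (E k)) -> regular (\bigcup_k E k).
Proof.
move=> rE eps eps0.
have e2 : 0 < eps / 2 by rewrite divr_gt0.
have /choice[KO KOP] k : exists KO : set (borel d) * set (borel d),
    [/\ dist_open d (~` KO.1), dist_open d KO.2, KO.1 `<=` E k, E k `<=` KO.2 &
    (nu (KO.2 `\` KO.1) <= (eps / 2 / (2 ^ k.+1)%:R)%:E)%E].
  have ek : 0 < eps / 2 / (2 ^ k.+1)%:R by rewrite divr_gt0 // ltr0n expn_gt0.
  by have [K [U h]] := rE k _ ek; exists (K, U).
pose K k := (KO k).1; pose O k := (KO k).2.
pose U := \bigcup_k O k.
have oU : dist_open d U by apply: dist_open_bigcup => k _; have [] := KOP k.
pose KN N := \bigcup_(k in `I_N) K k.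
have oKN N : dist_open d (~` KN N).
  elim: N => [|N IH].
    by rewrite /KN II0 bigcup_set0 setC0; exact: dist_openT.
  rewrite /KN IIS bigcup_setU bigcup_set1 setCU; apply: dist_openI => //.
  by have [] := KOP N.
have mU := dist_open_measurable oU.
have mKN N : measurable (KN N) by exact: dist_closed_measurable.
have mK k : measurable (K k) by apply: dist_closed_measurable; have [] := KOP k.
have mO k : measurable (O k) by apply: dist_open_measurable; have [] := KOP k.
have [|N x [Ux nKx]|| N NP] := @decreasing_small (fun N => U `\` KN N) eps.
- by move=> N; exact: measurableD.
- split => // -[k /= kN Kx]; apply: nKx; exists k => //=; exact: ltnW.
- apply: (@le_lt_trans _ _ (eps / 2)%:E); last by rewrite lte_fin ltr_pdivrMr // ltr_pMr // ltr1n.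
  apply: (@le_trans _ _ (\sum_(0 <= k <oo) nu (O k `\` K k))%E).
    apply: measure_sigma_subadditive.
    - by move=> k; exact: measurableD.
    - by apply: bigcapT_measurable => N; exact: measurableD.
    - move=> x xI; have [[k _ Okx] _] := xI 0%N Logic.I.
      exists k => //; split => // Kx.
      by have [_] := xI k.+1 Logic.I; apply; exists k => /=.
  apply: le_trans (@epsilon_trick0 R (eps / 2) xpredT _); last exact: ltW.
  by apply: lee_nneseries => // k _; have [] := KOP k.
exists (KN N), U; split => //.
- by move=> x [k _ Kx]; exists k => //; have [_ _ sub _ _] := KOP k; exact: sub.
- by move=> x [k _ Ex]; exists k => //; have [_ _ _ sub _] := KOP k; exact: sub.
Qed.

(** The regular sets form a sigma-algebra that contains the open sets. *)
Lemma measurable_regular E : measurable E -> regular E.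
Proof.
apply: smallest_sub; last exact: regular_open.
split; first by apply: regular_open => x [].
- by move=> A rA; rewrite setTD; exact: regularC.
- exact: regular_bigcup.
Qed.

Lemma null_outer_open (E : set (borel d)) (eps : R) : measurable E -> nu E = 0%E -> 0 < eps ->
  exists O : set (borel d), [/\ dist_open d O, E `<=` O & (nu O <= eps%:E)%E].
Proof.
move=> mE E0 eps0; have [K [U [oK oU KE EU small]]] := measurable_regular mE eps0.
exists U; split => //.
have mK := dist_closed_measurable oK; have mU := dist_open_measurable oU.
have K0 : nu K = 0%E.
  by apply/eqP; rewrite eq_le measure_ge0 andbT -E0 le_measure ?inE.
apply: (@le_trans _ _ (nu ((U `\` K) `|` K))).
  apply: le_measure; rewrite ?inE //; first by apply: measurableU => //; exact: measurableD.
  by move=> x Ux; have [Kx|nKx] := pselect (K x); [right|left].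
apply: (@le_trans _ _ (nu (U `\` K) + nu K)%E).
  by apply: measureU2 => //; exact: measurableD.
by rewrite K0 adde0.
Qed.

End DistTopology.

(** * The covering property and the weak type inequality *)

Section DensityMeasure.
Context {disp : measure_display} {T : measurableType disp} {R : realType}.
Variables (mu : {measure set T -> \bar R}) (g : T -> R).
Hypotheses (mg : measurable_fun [set: T] g) (g0 : forall x, 0 <= g x).
Local Open Scope ereal_scope.

Definition density (A : set T) : \bar R := \int[mu]_(x in A) (g x)%:E.

Let density0 : density set0 = 0. Proof. exact: integral_set0. Qed.

Let density_ge0 A : 0 <= density A.
Proof. by apply: integral_ge0 => x _; rewrite lee_fin. Qed.

Let density_sigma_additive : semi_sigma_additive density.
Proof.
move=> F mF tF mUF; rewrite /density ge0_integral_bigcup //.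
- by apply/cvg_ex; eexists; apply: is_cvg_nneseries => k _ _; exact: density_ge0.
- by apply/measurable_EFinP; exact: measurable_funS mg.
- by move=> x _; rewrite lee_fin.
Qed.

HB.instance Definition _ := isMeasure.Build _ _ _ density
  density0 density_ge0 density_sigma_additive.

Lemma density_measure : exists nu : {measure set T -> \bar R},
  forall A, nu A = \int[mu]_(x in A) (g x)%:E.
Proof. by exists density. Qed.

End DensityMeasure.

(** Injectivity of the enumeration on nonempty members lets the overlap of the
    sets be counted as an overlap of indices. *)
Lemma countable_enum (Y : Type) (F : set (set Y)) : countable F ->
  exists e : nat -> set Y, [/\ forall n, e n = set0 \/ F (e n),
    forall b, F b -> exists n, e n = b &
    forall m n x, e m x -> e m = e n -> m = n].
Proof.
move=> /countable_injP[f finj].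
pose e n := xget set0 [set b | F b /\ f b = n].
have eP n : e n = set0 \/ F (e n) /\ f (e n) = n.
  rewrite /e; case: xgetP => [b _ [Fb fb]|_]; [by right|by left].
exists e; split.
- by move=> n; have [->|[]] := eP n; [left|right].
- move=> b Fb; exists (f b); have [|[Fe fe]] := eP (f b).
    rewrite /e; case: xgetP => [c _ [Fc fc] _|/(_ b) /= nb]; last by case: nb.
    by apply: finj; rewrite ?inE.
  by apply: finj; rewrite ?inE.
- move=> m n x emx emn; have [em0|[_ fm]] := eP m; first by rewrite em0 in emx.
  have [en0|[_ fn]] := eP n; first by rewrite emn en0 in emx.
  by rewrite -fm -fn emn.
Qed.

Section Covering.
Variables (R : realType) (X : pointedType) (d : X -> X -> R).
Hypothesis dD : is_distance d.

Let d_sym x y : d x y = d y x. Proof. by have [] := dD. Qed.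
Let d_tri x y z : d x z <= d x y + d y z. Proof. by have [] := dD. Qed.

(** The covering property replaces separability: any choice of balls at the
    points of [S] has a countable subcover, since the space is a countable union
    of bounded sets. *)
Lemma BCP_countable_cover (S : set X) (rho : X -> R) : BCP d ->
  (forall x, S x -> 0 < rho x) ->
  exists F : nat -> set X,
    (forall n, F n = set0 \/ exists2 a, S a & F n = cball d a (rho a)) /\
    S `<=` \bigcup_n F n.
Proof.
move=> [N N1 bcp] rho0.
have bounded k : exists F : nat -> set X,
    (forall n, F n = set0 \/ exists2 a, S a & F n = cball d a (rho a)) /\
    (S `&` cball d point k%:R) `<=` \bigcup_n F n.
  have [||| F [FB cF Fcov _]] := bcp (S `&` cball d point k%:R)
      [set cball d a (rho a) | a in S].
  - exists (k%:R + k%:R) => x y [_ xk] [_ yk].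
    by apply: le_trans (d_tri x point y) _; rewrite lerD // d_sym.
  - by move=> _ [a Sa <-]; exists a, (rho a); split => //; exact: rho0.
  - by move=> a [Sa _]; exists (rho a); [exact: rho0|exists a].
  have [e [eF Fe _]] := countable_enum cF; exists e; split.
    move=> n; have [->|/FB[a Sa <-]] := eF n; first by left.
    by right; exists a.
  move=> x /Fcov[b Fb bx]; have [n en] := Fe b Fb.
  by exists n => //; rewrite en.
have [F FP] := choice bounded.
exists (fun n => if unpickle n is Some (k, i) then F k i else set0); split.
  move=> n; case: unpickle => [[k i]|]; last by left.
  by have [] := FP k.
move=> x Sx.
have [k xk] : exists k : nat, d x point <= k%:R.
  exists (Num.truncn (d x point)).+1; apply: ltW.
  by have [h _ _ _] := dD; have /andP[] := truncn_itv (h x point).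
have [_ /(_ x (conj Sx xk)) [i _ Fx]] := FP k.
by exists (pickle (k, i)) => //; rewrite pickleK.
Qed.

Lemma overlap_sum (N : nat) (F : set (set X)) (e : nat -> set X) (x : X) (n : nat) :
  (forall n, e n = set0 \/ F (e n)) -> (forall m n x, e m x -> e m = e n -> m = n) ->
  ([set b | F b /\ b x] #<= `I_N)%card ->
  (\sum_(0 <= i < n) (\1_(e i) x : R) <= N%:R).
Proof.
move=> eF einj card.
pose s := [seq i <- iota 0 n | x \in e i].
have -> : \sum_(0 <= i < n) (\1_(e i) x : R) = (size s)%:R.
  rewrite /index_iota subn0 /s; elim: (iota 0 n) => [|i t IH]; first by rewrite big_nil.
  rewrite big_cons /= IH indicE; case: ifP => _ /=; last by rewrite add0r.
  by rewrite -[X in _ = X%:R]add1n natrD.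
rewrite ler_nat -card_le_II; apply: card_le_trans card.
pose f i := e (nth 0%N s i).
have sP i : (i < size s)%N -> x \in e (nth 0%N s i).
  by move=> /(mem_nth 0%N); rewrite mem_filter => /andP[].
have finj : {in `I_(size s) &, injective f}.
  move=> i j; rewrite !inE /= => iS jS fij.
  have ex : e (nth 0%N s i) x by have := sP _ iS; rewrite inE.
  have /eqP := einj _ _ x ex fij; rewrite nth_uniq //; first by move/eqP.
  by rewrite filter_uniq // iota_uniq.
apply: (@card_le_trans _ _ _ (f @` `I_(size s))).
  by have := inj_card_eq finj; rewrite card_eq_le => /andP[].
apply: subset_card_le => _ [i /= iS <-].
have := sP _ iS; rewrite inE => ex; split => //.
by have [e0|//] := eF (nth 0%N s i); rewrite /f e0 in ex *.
Qed.

(** The balls extracted by the covering property satisfy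
    lam mu(B) <= nu(B), and their indicator functions add up to at most [N] times
    that of [U]; it remains to integrate this with respect to [nu]. Since [Q]
    need not be measurable, the estimate is for a measurable set containing it. *)
Lemma weak_type (mu nu : {measure set (borel d) -> \bar R}) : BCP d ->
  exists N : nat, forall (Q U : set (borel d)) (lam : R),
    dist_bounded d Q -> dist_open d U -> 0 < lam ->
  (forall p, Q p -> exists r : R, [/\ 0 < r, cball d p r `<=` U &
     (lam%:E * mu (cball d p r) <= nu (cball d p r))%E]) ->
  exists M : set (borel d), [/\ measurable M, Q `<=` M & (lam%:E * mu M <= N%:R%:E * nu U)%E].
Proof.
move=> [N N1 bcp]; exists N => Q U lam bQ oU lam0 QP.
have mU := dist_open_measurable oU.
pose good p r := [/\ 0 < r, cball d p r `<=` U &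
     (lam%:E * mu (cball d p r) <= nu (cball d p r))%E].
pose B : set (set X) := [set b | exists p r, [/\ Q p, good p r & b = cball d p r]].
have [|| F [FB cF Fcov Fmult]] := bcp Q B bQ.
- by move=> _ [p [r [Qp [r0 _ _] ->]]]; exists p, r.
- move=> p Qp; have [r gr] := QP p Qp; exists r; first by case: gr.
  by exists p, r.
have [e [eF Fe einj]] := countable_enum cF.
have eP n : e n = set0 \/ exists p r, good p r /\ e n = cball d p r.
  by have [->|/FB[p [r [_ gpr ->]]]] := eF n; [left|right; exists p, r].
have me n : measurable (e n : set (borel d)).
  by have [->|[p [r [_ ->]]]] := eP n; [exact: measurable0|exact: cball_measurable].
have eU n : e n `<=` U by have [->|[p [r [[_ sub _] ->]]]] := eP n.
have emu n : (lam%:E * mu (e n) <= nu (e n))%E.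
  by have [->|[p [r [[_ _ h] ->]]]] := eP n; rewrite ?measure0 ?mule0.
exists (\bigcup_n e n); split.
- exact: bigcup_measurable.
- by move=> p /Fcov[b Fb bp]; have [n en] := Fe b Fb; exists n => //; rewrite en.
have lam0' : (0 <= lam%:E)%E by rewrite lee_fin ltW.
apply: (@le_trans _ _ (lam%:E * \sum_(0 <= n <oo) mu (e n))%E).
  rewrite lee_wpmul2l //; apply: measure_sigma_subadditive => //.
  exact: bigcup_measurable.
rewrite -nneseriesZl //.
apply: (@le_trans _ _ (\sum_(0 <= n <oo) nu (e n))%E).
  by apply: lee_nneseries => // n _; rewrite mule_ge0.
pose f n (x : borel d) : \bar R := (\1_(e n) x)%:E.
have mf n : measurable_fun [set: borel d] (f n).
  by apply/measurable_EFinP; exact: measurable_indic.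
have f0 n x : [set: borel d] x -> (0 <= f n x)%E by rewrite lee_fin.
rewrite (_ : (\sum_(0 <= n <oo) nu (e n))%E = (\sum_(0 <= n <oo) \int[nu]_x f n x)%E); last first.
  by apply: eq_eseriesr => n _; rewrite /f integral_indic // setIT.
rewrite -integral_nneseries //.
rewrite (_ : (N%:R%:E * nu U)%E = (\int[nu]_x (N%:R%:E * (\1_U x)%:E))%E); last first.
  rewrite ge0_integralZl //; last first.
  - by apply/measurable_EFinP; exact: measurable_indic.
  by rewrite integral_indic // setIT.
apply: ge0_le_integral => //.
- by move=> x _; apply: nneseries_ge0 => n _ _; exact: f0.
- by apply: (@ge0_emeasurable_sum _ _ _ _ f xpredT) => // k x Dx _; exact: f0.
- by apply: measurable_funeM; apply/measurable_EFinP; exact: measurable_indic.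
move=> x _; apply: lime_le.
  by apply: is_cvg_nneseries => n _ _; exact: f0.
apply: nearW => n; rewrite /f sumEFin -EFinM lee_fin.
have [Ux|nUx] := pselect (U x).
  by rewrite [\1_U x]indicE mem_set // mulr1; apply: overlap_sum eF einj (Fmult x).
rewrite big1 => [|i _]; first by rewrite mulr_ge0.
by rewrite indicE memNset // => /eU.
Qed.

End Covering.

(** * Differentiation of measures from the covering property *)

Section Differentiation.
Variables (R : realType) (X : pointedType) (d : X -> X -> R).
Hypotheses (dD : is_distance d) (bcp : BCP d).

Variable mu : {measure set (borel d) -> \bar R}.

Lemma cball_sub_open (U : set X) p : dist_open d U -> U p ->
  exists2 r : R, 0 < r & forall q, q < r -> cball d p q `<=` U.
Proof.
move=> oU /oU[r r0 rU]; exists r => // q qr y yp; apply: rU.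
exact: le_lt_trans qr.
Qed.

(** The set is contained in the zeros of [g] in [W], which are null for the
    measure with density [g] and hence have neighbourhoods of arbitrarily small
    mass; the weak type inequality turns these into small [mu]-measure. *)
Lemma upper_density_null (W : set (borel d)) (g : borel d -> R) (lam : R) :
  dist_open d W -> dist_bounded d W -> measurable_fun [set: borel d] g ->
  (forall x, 0 <= g x) -> (\int[mu]_(x in W) (g x)%:E < +oo)%E -> 0 < lam ->
  mu.-negligible [set p | [/\ W p, g p = 0 & forall e : R, 0 < e ->
    exists r : R, [/\ 0 < r, r < e &
      (lam%:E * mu (cball d p r) <= \int[mu]_(x in cball d p r) (g x)%:E)%E]]].
Proof.
move=> oW bW mg g0 gfin lam0; set Q := (X in mu.-negligible X).
have mW : measurable W by exact: dist_open_measurable.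
have mgW : measurable_fun [set: borel d] (g \_ W).
  by apply/(measurable_restrict _ mW measurableT); exact: measurable_funS mg.
have gW0 x : 0 <= (g \_ W) x by rewrite patchE; case: ifP.
(* [g] is cut off outside [W] to get a finite measure, with the same
   values on the subsets of [W]. *)
have [nu nuE] := density_measure mu mgW gW0.
have nuW B : nu B = (\int[mu]_(x in B `&` W) (g x)%:E)%E.
  rewrite nuE integral_mkcondr; apply: eq_integral => x _.
  by rewrite restrict_EFin.
have nu_fin : (nu setT < +oo)%E by rewrite nuW setTI.
pose E : set (borel d) := W `&` g @^-1` [set 0].
have mE : measurable E.
  apply: measurableI => //; rewrite -[_ @^-1` _]setTI; apply: mg => //.
have nuE0 : nu E = 0%E.
  by rewrite nuW; apply: integral0_eq => x [[_ ->]].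
have [N wt] := weak_type dD mu nu bcp.
have /choice[M MP] m : exists M : set (borel d), [/\ measurable M, Q `<=` M &
    (lam%:E * mu M <= (N%:R * m.+1%:R^-1)%:E)%E].
  have [|U [oU EU nuU]] := null_outer_open dD nu_fin mE nuE0 (eps := m.+1%:R^-1).
    by rewrite invr_gt0.
  have oUW : dist_open d (U `&` W) by exact: dist_openI.
  have [|p [Wp gp0 pP]|M [mM QM muM]] := wt Q (U `&` W) lam _ oUW lam0.
  - by have [K KP] := bW; exists K => x y [Wx _ _] [Wy _ _]; exact: KP.
  - have [e e0 eP] := cball_sub_open oUW (conj (EU p (conj Wp gp0)) Wp).
    have [r [r0 re h]] := pP e e0; exists r; split => //; first exact: eP.
    rewrite nuW (_ : _ `&` W = cball d p r) //.
    by apply/setIidPl => x /(eP r re)[].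
  exists M; split => //; apply: le_trans muM _; rewrite EFinM lee_wpmul2l ?lee_fin //.
  apply: le_trans nuU; apply: le_measure; rewrite ?inE //.
  - by apply: dist_open_measurable.
  - by apply: dist_open_measurable.
exists (\bigcap_m M m); split.
- by apply: bigcapT_measurable => m; have [] := MP m.
- have mI : measurable (\bigcap_m M m).
    by apply: bigcapT_measurable => m; have [] := MP m.
  suff : (lam%:E * mu (\bigcap_m M m) <= 0)%E.
    by rewrite pmule_rle0 ?lte_fin // measure_le0 => /eqP.
  apply/lee_addgt0Pr => eps eps0; rewrite add0e.
  pose m := Num.truncn (N%:R / eps).
  have [mM _ h] := MP m.
  apply: (@le_trans _ _ (lam%:E * mu (M m))%E).
    rewrite lee_wpmul2l ?lee_fin ?(ltW lam0) // le_measure ?inE //.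
    exact: bigcap_inf.
  apply: le_trans h _; rewrite lee_fin ler_pdivrMr // mulrC -ler_pdivrMr //.
  have /andP[_ h] := truncn_itv (divr_ge0 (ler0n R N) (ltW eps0)).
  exact: ltW h.
- by move=> p Qp m _; have [_ QM _] := MP m; exact: QM.
Qed.

(** At the points of this set the averages vanish by convention, whatever the
    function; the covering property shows that there are few of them. *)
Lemma null_balls_null :
  mu.-negligible [set p | exists2 r : R, 0 < r & mu (cball d p r) = 0%E].
Proof.
set Z := (X in mu.-negligible X).
have /choice[rho rhoP] p : exists r : R, Z p -> 0 < r /\ mu (cball d p r) = 0%E.
  by have [[r r0 h]|nZ] := pselect (Z p); [exists r|exists 0].
have [F [FP ZF]] := BCP_countable_cover dD bcp (fun p Zp => (rhoP p Zp).1).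
apply: (@negligibleS _ (borel d) _ mu _ _ ZF); apply: negligible_bigcup => k.
have [->|[a Za ->]] := FP k; first exact: negligible_set0.
by apply/negligibleP; [exact: cball_measurable|have [] := rhoP a Za].
Qed.

Definition average (f : borel d -> R) (p : borel d) (r : R) : R :=
  (fine (mu (cball d p r)))^-1 * \int[mu]_(q in cball d p r) f q.

Lemma integrable_const (W : set (borel d)) (a : R) : measurable W ->
  (mu W < +oo)%E -> mu.-integrable W (EFin \o cst a).
Proof.
move=> mW Wfin; apply/integrableP; split; first by apply/measurable_EFinP; exact: measurable_cst.
rewrite (_ : (fun _ => _) = cst (`|a|%:E)) //.
by rewrite integral_cst // lte_mul_pinfty.
Qed.

Lemma average_le (f g : borel d -> R) (a lam : R) p r :
  let B : set (borel d) := cball d p r in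
  (mu B < +oo)%E -> mu B != 0%E ->
  mu.-integrable B (EFin \o f) -> mu.-integrable B (EFin \o g) ->
  (forall x, 0 <= g x) -> (forall x, f x <= a + g x) ->
  (\int[mu]_(x in B) (g x)%:E <= lam%:E * mu B)%E ->
  average f p r <= a + lam.
Proof.
move=> B Bfin B0 intf intg g0 fg intgle.
have mB : measurable B by exact: cball_measurable.
have inta := integrable_const a mB Bfin.
have muB : mu B \is a fin_num by rewrite ge0_fin_numE.
have B0' : 0 < fine (mu B).
  by rewrite fine_gt0 // Bfin andbT lt0e B0 measure_ge0.
rewrite /average -/B mulrC ler_pdivrMr //.
have intag : mu.-integrable B (EFin \o (cst a \+ g)).
  exact: (integrableD mB inta intg).
apply: le_trans (le_Rintegral mB intf intag _) _ => //.
rewrite (RintegralD mB inta intg) Rintegral_cst // mulrDl lerD2l.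
rewrite -lee_fin EFinM (fineK muB) /Rintegral fineK //.
exact: integrable_fin_num.
Qed.

(** If the averages exceed f(p) + eps for arbitrarily small radii, then for a
    rational a slightly above f(p), the function max(f - a, 0) vanishes at p but
    has positive upper density there. *)
Lemma upper_average_null (W : set (borel d)) (f : borel d -> R) :
  dist_open d W -> dist_bounded d W -> (mu W < +oo)%E ->
  measurable_fun [set: borel d] f -> mu.-integrable W (EFin \o f) ->
  mu.-negligible [set p | W p /\ ~ forall eps : R, 0 < eps ->
    exists2 e : R, 0 < e & forall r, 0 < r -> r < e -> average f p r <= f p + eps].
Proof.
move=> oW bW Wfin mf intf.
have mW := dist_open_measurable oW.
pose g a x := Num.max (f x - a) 0.
have g0 a x : 0 <= g a x by rewrite le_max lexx orbT.
have mg a : measurable_fun [set: borel d] (g a).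
  apply: measurable_maxr; last exact: measurable_cst.
  by apply: measurable_funB => //; exact: measurable_cst.
have intg a : mu.-integrable W (EFin \o g a).
  have intfa := integrableB mW intf (integrable_const a mW Wfin).
  apply: le_integrable intfa => //.
    by apply/measurable_EFinP; exact: measurable_funS (mg a).
  move=> x _ /=; rewrite lee_fin (ger0_norm (g0 a x)) /g ge_max.
  by rewrite ler_norm normr_ge0.
pose Q (a : R) (m : nat) : set (borel d) :=
  [set p | [/\ W p, g a p = 0 & forall e : R, 0 < e ->
    exists r : R, [/\ 0 < r, r < e &
      (m.+1%:R^-1%:E * mu (cball d p r) <= \int[mu]_(x in cball d p r) (g a x)%:E)%E]]].
have Qnull a m : mu.-negligible (Q a m).
  by apply: upper_density_null => //; exact: (integrable_lty mW (intg a)).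
pose QQ k := if unpickle k is Some (a, m) then Q (ratr a) m else set0.
have QQnull : mu.-negligible (\bigcup_k QQ k).
  apply: negligible_bigcup => k; rewrite /QQ.
  by case: unpickle => [[a m]|]; [exact: Qnull|exact: negligible_set0].
apply: negligibleS (negligibleU null_balls_null QQnull) => p [Wp nlim].
have [|nZ] := pselect (exists2 r : R, 0 < r & mu (cball d p r) = 0%E); first by left.
right; apply: contrapT => nQQ; apply: nlim => eps eps0.
have e2 : 0 < eps / 2 by rewrite divr_gt0.
have [a] := rat_in_itvoo (ltr_pwDr e2 (lexx (f p))).
rewrite in_itv /= => /andP[fa afe].
pose m := Num.truncn (eps / 2)^-1.
have mlt : m.+1%:R^-1 <= eps / 2.
  rewrite -[leRHS]invrK lef_pV2 ?posrE ?invr_gt0 //.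
  have e2V : 0 <= (eps / 2)^-1 by rewrite invr_ge0 ltW.
  by have /andP[_ h] := truncn_itv e2V; exact: ltW h.
have [e e0 eW] := cball_sub_open oW Wp.
have [e' e'0 e'P] : exists2 e' : R, 0 < e' & forall r, 0 < r -> r < e' ->
   (\int[mu]_(x in cball d p r) (g (ratr a) x)%:E <= m.+1%:R^-1%:E * mu (cball d p r))%E.
  apply: contrapT => ne; apply: nQQ; exists (pickle (a, m)); first exact: Logic.I.
  rewrite /QQ pickleK; split => //.
    by rewrite /g; apply/max_idPr; rewrite subr_le0 ltW.
  move=> e' e'0; apply: contrapT => nr; apply: ne; exists e' => // r r0 re'.
  rewrite leNgt; apply/negP => h; apply: nr; exists r; split => //; exact: ltW.
exists (Num.min e e'); first by rewrite lt_min e0.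
move=> r r0; rewrite lt_min => /andP[re re'].
have BW := eW r re; have mB : measurable (cball d p r : set (borel d)) by exact: cball_measurable.
apply: (@le_trans _ _ (ratr a + m.+1%:R^-1)); last first.
  by rewrite (splitr eps) addrA; apply: lerD => //; exact: ltW.
apply: (@average_le f (g (ratr a))) => //.
- by apply: le_lt_trans Wfin; apply: le_measure; rewrite ?inE.
- by apply/eqP => B0; apply: nZ; exists r.
- exact: integrableS intf.
- exact: integrableS (intg _).
- by move=> x; rewrite -lerBlDl /g le_max lexx.
- exact: e'P.
Qed.

(** The lower estimate for [f] is the upper estimate for [- f]. *)
Lemma average_cvg_null (W : set (borel d)) (f : borel d -> R) :
  dist_open d W -> dist_bounded d W -> (mu W < +oo)%E ->
  measurable_fun [set: borel d] f -> mu.-integrable W (EFin \o f) ->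
  mu.-negligible [set p | W p /\ ~ (average f p r @[r --> 0^'+] --> f p)].
Proof.
move=> oW bW Wfin mf intf.
have mW := dist_open_measurable oW.
have mNf : measurable_fun [set: borel d] (\- f) by exact: measurableT_comp.
have intNf : mu.-integrable W (EFin \o (\- f)) by exact: (integrableN intf).
have nullf := upper_average_null oW bW Wfin mf intf.
have nullNf := upper_average_null oW bW Wfin mNf intNf.
apply: negligibleS (negligibleU nullf nullNf) => p [Wp ncv].
apply: contrapT => /not_orP[gf gNf]; apply: ncv.
apply/cvgrPdist_le => eps eps0.
have [e e0 eP] : exists2 e : R, 0 < e & forall r, 0 < r -> r < e -> average f p r <= f p + eps.
  by apply: contrapT => h; apply: gf; split => // /(_ eps eps0).
have [e' e'0 e'P] : exists2 e : R, 0 < e & forall r, 0 < r -> r < e ->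
    average (\- f) p r <= - f p + eps.
  by apply: contrapT => h; apply: gNf; split => // /(_ eps eps0).
have [q q0 qW] := cball_sub_open oW Wp.
near=> r.
have r0 : 0 < r by near: r; exact: nbhs_right_gt.
have re : r < e by near: r; exact: nbhs_right_lt.
have re' : r < e' by near: r; exact: nbhs_right_lt.
have rq : r < q by near: r; exact: nbhs_right_lt.
have mB : measurable (cball d p r : set (borel d)) by exact: cball_measurable.
have avN : average (\- f) p r = - average f p r.
  rewrite /average -mulrN; congr (_ * _).
  rewrite -[RHS]mulN1r -RintegralZl //; last exact: (integrableS mW mB (qW r rq) intf).
  by apply: eq_Rintegral => x _; rewrite mulN1r.
have := eP r r0 re; have := e'P r r0 re'; rewrite avN => h1 h2.
by rewrite ler_norml; apply/andP; split; lra.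
Unshelve. all: by end_near.
Qed.

(** Every point has an open ball on which [mu] is finite and [f] integrable,
    and countably many of them cover the space. *)
Lemma BCP_differentiation : locally_finite mu -> differentiation_theorem mu.
Proof.
move=> lf f [mf lint].
have /choice[rho rhoP] p : exists r : R, [/\ 0 < r, (mu (cball d p r) < +oo)%E &
    mu.-integrable (cball d p r) (EFin \o f)].
  have [r r0 fin] := lf p; have [q q0 int] := lint p.
  have sub1 : cball d p (Num.min r q) `<=` cball d p r.
    by move=> x; rewrite /cball /= le_min => /andP[].
  have sub2 : cball d p (Num.min r q) `<=` cball d p q.
    by move=> x; rewrite /cball /= le_min => /andP[].
  exists (Num.min r q); split; first by rewrite lt_min r0.
  - by apply: le_lt_trans fin; apply: le_measure; rewrite ?inE //; exact: cball_measurable.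
  - by apply: integrableS int => //; exact: cball_measurable.
(* The closed balls of half the radius lie in the open balls [W], on which
   the local statement applies. *)
have rho2 p : [set: X] p -> 0 < rho p / 2 by have [r0 _ _] := rhoP p; rewrite divr_gt0.
have [F [FP Fcov]] := BCP_countable_cover dD bcp rho2.
set bad : set (borel d) := [set p | ~ (average f p r @[r --> 0^'+] --> f p)].
have : mu.-negligible (\bigcup_k (F k `&` bad)).
  apply: negligible_bigcup => k.
  have [->|[a _ ->]] := FP k; first by rewrite set0I; exact: negligible_set0.
  have [a0 afin aint] := rhoP a.
  pose W : set (borel d) := [set x | d x a < rho a].
  have oW : dist_open d W by exact: dist_open_ball.
  have mW := dist_open_measurable oW.
  have mB : measurable (cball d a (rho a) : set (borel d)) by exact: cball_measurable.
  have WB : W `<=` cball d a (rho a) by move=> x; exact: ltW.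
  have bW : dist_bounded d W.
    have [_ _ sym tri] := dD; exists (rho a + rho a) => x y xa ya.
    apply: le_trans (tri x a y) _; rewrite [d a y]sym; apply: lerD; exact: ltW.
  have Wfin : (mu W < +oo)%E.
    by apply: le_lt_trans afin; apply: le_measure; rewrite ?inE.
  have Wint : mu.-integrable W (EFin \o f) by exact: integrableS aint.
  apply: negligibleS (average_cvg_null oW bW Wfin mf Wint) => p [pa bp]; split => //.
  by apply: le_lt_trans pa _; rewrite ltr_pdivrMr // ltr_pMr // ltr1n.
apply: negligibleS => p bp; have [k _ Fk] := Fcov p Logic.I.
by exists k.
Qed.

End Differentiation.

(** * From bounded Besicovitch families to the covering property *)

(** A Besicovitch family of balls: they share the point [p], and no center lies
    in another ball. *)
Definition besicovitch_family (R : realType) (X : eqType) (d : X -> X -> R)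
    (t : seq X) (r : X -> R) (p : X) : Prop :=
  [/\ uniq t,
      forall a, a \in t -> 0 < r a /\ d p a <= r a &
      forall a b, a \in t -> b \in t -> a != b -> r a < d b a].

(** By Zorn's lemma; the last property expresses maximality. *)
Lemma maximal_separated (X : Type) (sep : X -> X -> Prop) (P : set X) :
  (forall a b, sep a b -> sep b a) ->
  exists S : set X, [/\ S `<=` P,
    forall a b, S a -> S b -> a <> b -> sep a b &
    forall y, P y -> exists2 x, S x & x = y \/ ~ sep x y].
Proof.
move=> symm.
pose good := [set S : set X | S `<=` P /\
  forall a b, S a -> S b -> a <> b -> sep a b].
have [|S [[SP Ssep] Smax]] := @Zorn_bigcup X good.
  move=> F Fgood Ftot; split=> [x [S FS Sx]|a b [S FS Sa] [S' FS' S'b] ab].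
    by have [+ _] := Fgood _ FS; apply.
  have [SS'|S'S] := Ftot _ _ FS FS'.
    by have [_ +] := Fgood _ FS'; apply => //; exact: SS'.
  by have [_ +] := Fgood _ FS; apply => //; exact: S'S.
exists S; split => // y Py; apply: contrapT => ny.
have nyx x : S x -> x <> y /\ sep x y.
  move=> Sx; split; first by move=> xy; apply: ny; exists x => //; left.
  by apply: contrapT => nsep; apply: ny; exists x => //; right.
apply: (Smax (S `|` [set y])); first split.
- by move=> x Sx; left.
- by move=> /(_ y (or_intror erefl)) /nyx[].
split=> [x [/SP//|-> //]|a b [Sa|->] [Sb|->] ab //].
- exact: Ssep.
- by have [] := nyx _ Sa.
- by apply: symm; have [] := nyx _ Sb.
Qed.

Lemma size_le_classes (X : eqType) (lay : X -> nat) (D : nat) (L : seq nat) (s : seq X) :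
  (forall a, a \in s -> lay a \in L) ->
  (forall k, (size [seq a <- s | lay a == k] <= D)%N) -> (size s <= size L * D)%N.
Proof.
elim: L s => [|k L IH] s sL sD.
  by case: s sL {sD} => // a s /(_ a (mem_head _ _)).
rewrite -(count_predC (fun a => lay a == k) s) -!size_filter /= mulSn leq_add //.
apply: IH => [a|j].
  rewrite mem_filter /= => /andP[ak /sL]; rewrite inE (negPf ak) //.
rewrite -filter_predI; apply: leq_trans (sD j).
rewrite !size_filter; apply: sub_count => a /=; by case/andP.
Qed.

(** Bounds on duplicate-free lists suffice, because an infinite set contains
    such lists of every length. *)
Lemma card_image_bounded (X : eqType) (Y : Type) (f : X -> Y) (W : set X) (N : nat) :
  (forall s : seq X, uniq s -> (forall a, a \in s -> W a) -> (size s <= N)%N) ->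
  ((f @` W) #<= `I_N)%card.
Proof.
move=> WN; apply: card_le_trans (card_image_le _ _) _.
have [s [us sW smax]] : exists s : seq X, [/\ uniq s, forall a, a \in s -> W a &
    forall a, W a -> a \in s].
  apply: contrapT => nex.
  have grow k : exists s : seq X, [/\ uniq s, forall a, a \in s -> W a & size s = k].
    elim: k => [|k [s [us sW sk]]]; first by exists [::].
    have [a Wa nas] : exists2 a, W a & a \notin s.
      apply: contrapT => na; apply: nex; exists s; split => // a Wa.
      by apply: contrapT => /negP nas; apply: na; exists a.
    exists (a :: s); split => /=; first by rewrite nas.
      by move=> b; rewrite inE => /orP[/eqP ->|/sW].
    by rewrite sk.
  have [s [us sW sk]] := grow N.+1.
  by have := WN s us sW; rewrite sk ltnn.
have -> : W = [set` s].
  by apply/seteqP; split => a; [exact: smax|exact: sW].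
have sN := WN s us sW; case: s us sW smax sN => [|a0 s] us sW smax sN.
  by rewrite set_nil; exact: card_ge0.
apply: (@card_le_trans _ _ _ `I_(size (a0 :: s))); last by rewrite card_le_II.
have -> : [set` a0 :: s] = nth a0 (a0 :: s) @` `I_(size (a0 :: s)).
  apply/seteqP; split => a /=.
    by move=> /(nthP a0)[i ia <-]; exists i.
  by move=> [i ia <-]; exact: mem_nth.
exact: card_image_le.
Qed.

Section WeakToStrong.
Variables (R : realType) (G : groupTopologicalType).
Variables (delta : R -> G -> G) (d : G -> G -> R).
Hypothesis hd : homogeneous_distance delta d.
Hypothesis delta1 : forall l, 0 < l -> delta l 1%g = 1%g.
Hypothesis net : forall r eps : R, 0 < eps ->
  exists s : seq G, forall q, d q 1%g <= r -> exists2 x, x \in s & d q x < eps.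

Let d_ge0 x y : 0 <= d x y. Proof. by have [[]] := hd. Qed.
Let d_xx x : d x x = 0. Proof. by have [[_ h _ _] _ _] := hd; apply/h. Qed.
Let d_eq0 x y : d x y = 0 -> x = y. Proof. by have [[_ h _ _] _ _] := hd; move/h. Qed.
Let d_sym x y : d x y = d y x. Proof. by have [[_ _ h _] _ _] := hd. Qed.
Let d_tri x y z : d x z <= d x y + d y z. Proof. by have [[]] := hd. Qed.
Let d_mul g x y : d (g * x)%g (g * y)%g = d x y. Proof. by have [] := hd. Qed.
Let d_dil l x y : 0 < l -> d (delta l x) (delta l y) = l * d x y.
Proof. by have [_ _ h] := hd; apply: h. Qed.

Lemma net_near (r eps : R) : 0 < eps -> exists (s : seq G) (f : G -> G),
  forall q, d q 1%g <= r -> f q \in s /\ d q (f q) < eps.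
Proof.
move=> /(net r)[s sP]; exists s.
have /choice[f fP] (q : G) : exists x, d q 1%g <= r -> x \in s /\ d q x < eps.
  have [qr|qr] := pselect (d q 1%g <= r); last by exists 1%g => /qr.
  by have [x xs qx] := sP q qr; exists x.
by exists f.
Qed.

Lemma separated_bound1 : exists D : nat, forall s : seq G, uniq s ->
  (forall a, a \in s -> d a 1%g <= 2) ->
  (forall a b, a \in s -> b \in s -> a != b -> 1 < d a b) -> (size s <= D)%N.
Proof.
have [S [f fP]] : exists (s : seq G) (f : G -> G),
  forall q, d q 1%g <= 2 -> f q \in s /\ d q (f q) < 2^-1.
  by apply: net_near; rewrite invr_gt0.
exists (size S) => s us s2 ssep; rewrite -(size_map f).
apply: uniq_leq_size.
  rewrite map_inj_in_uniq // => a b aS bS fab; apply/eqP/negPn/negP => ab.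
  have := ssep a b aS bS ab.
  have [_ h1] := fP _ (s2 _ aS); have [_ h2] := fP _ (s2 _ bS).
  rewrite d_sym -fab in h2.
  by have := d_tri a (f a) b; lra.
by move=> _ /mapP[a aS ->]; have [] := fP _ (s2 _ aS).
Qed.

(** Translations and dilations reduce any center and any scale to the ball of
    radius 2 at the identity, so that one bound serves for all. *)
Lemma separated_bound : exists D : nat, forall (s : seq G) (x : G) (e : R), 0 < e ->
  uniq s -> (forall a, a \in s -> d a x <= 2 * e) ->
  (forall a b, a \in s -> b \in s -> a != b -> e < d a b) -> (size s <= D)%N.
Proof.
have [D DP] := separated_bound1; exists D => s x e e0 us sx ssep.
have ei0 : 0 < e^-1 by rewrite invr_gt0.
pose g a := delta e^-1 (x^-1 * a)%g.
have gd a b : d (g a) (g b) = e^-1 * d a b by rewrite /g d_dil // d_mul.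
rewrite -(size_map g); apply: DP.
- rewrite map_inj_in_uniq // => a b _ _ gab; apply: d_eq0.
  by have := gd a b; rewrite gab d_xx => /esym/eqP; rewrite mulf_eq0 gt_eqF //= => /eqP.
- move=> _ /mapP[a aS ->].
  have -> : 1%g = g x by rewrite /g mulVg delta1.
  by rewrite gd ler_pdivrMl // mulrC sx.
- move=> _ _ /mapP[a aS ->] /mapP[b bS ->] gab.
  rewrite gd ltr_pdivlMl // mulr1 ssep //.
  by apply: contraNneq gab => ->.
Qed.

Lemma separated_countable (W : set G) (r eps : R) : 0 < eps ->
  (forall a, W a -> d a 1%g <= r) ->
  (forall a b, W a -> W b -> a <> b -> eps <= d a b) -> countable W.
Proof.
move=> eps0 Wr Wsep.
have [s [f fP]] : exists (s : seq G) (f : G -> G),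
  forall q, d q 1%g <= r -> f q \in s /\ d q (f q) < eps / 2.
  by apply: net_near; rewrite divr_gt0.
apply/countable_injP; exists (fun a => index (f a) s) => a b.
rewrite !inE => Wa Wb iab; apply: contrapT => ab.
have [fa ha] := fP _ (Wr _ Wa); have [fb hb] := fP _ (Wr _ Wb).
have fab : f a = f b by rewrite -(nth_index 1%g fa) iab nth_index.
have := Wsep a b Wa Wb ab; rewrite -fab d_sym in hb.
by have := d_tri a (f a) b; lra.
Qed.

(** The centers are sorted into layers, on each of which the radii agree up to a
    factor 2. Going through the layers by decreasing radii, one selects in each
    a maximal separated set of the centers that are still uncovered. Balls of
    different layers then never contain each other's centers: one ball
    because the other center was still uncovered when it was selected, the
    other because it is smaller. So a point lies in balls of boundedly many
    layers, as picking one ball for each such layer gives a Besicovitch family,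
    and it lies in boundedly many balls of a given layer by
    [separated_bound]. *)
Lemma BCP_of_bounded_besicovitch (Q : nat) :
  (forall (t : seq G) r p, besicovitch_family d t r p -> (size t <= Q)%N) -> BCP d.
Proof.
move=> wbcp; have [D DP] := separated_bound.
exists (Q * D).+1 => // A B [M0 AM0] Bball Acent.
pose M := Num.max M0 1.
have M_gt0 : 0 < M by rewrite lt_max ltr01 orbT.
have AM a b : A a -> A b -> d a b <= M.
  by move=> Aa Ab; rewrite le_max AM0.
have /choice[r rP] (a : G) : exists r : R, A a -> 0 < r /\ B (cball d a r).
  have [Aa|nAa] := pselect (A a); last by exists 0.
  by have [r r0 Br] := Acent a Aa; exists r.
(* A ball of radius at least the diameter of [A] covers [A] by itself. *)
have [[a1 Aa1 a1M]|small] := pselect (exists2 a, A a & M <= r a).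
  exists [set cball d a1 (r a1)]; split.
  - by move=> _ ->; have [] := rP a1 Aa1.
  - exact: countable1.
  - move=> x Ax; exists (cball d a1 (r a1)) => //.
    by apply: le_trans a1M; exact: AM.
  - move=> x; apply: (@card_le_trans _ _ _ `I_1); last by rewrite card_le_II.
    apply: (@card_le_trans _ _ _ [set cball d a1 (r a1)]).
      by apply: subset_card_le => b [].
    rewrite (_ : [set _] = (fun=> cball d a1 (r a1)) @` `I_1); first exact: card_image_le.
    by apply/seteqP; split=> [_ ->|_ [k _ <-]//]; exists 0%N.
have rM a : A a -> r a < M.
  by move=> Aa; rewrite ltNge; apply/negP => h; apply: small; exists a.
pose thr (k : nat) := M / 2 ^+ k.
have thr0 k : 0 < thr k by rewrite divr_gt0 // exprn_gt0.
pose layer k := [set a | A a /\ thr k.+1 <= r a < thr k].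
have thrS k : thr k = 2 * thr k.+1.
  by rewrite /thr exprS; field; rewrite expf_neq0 // pnatr_eq0.
have thr_le j k : (j <= k)%N -> thr k <= thr j.
  move=> jk; rewrite /thr ler_pM2l // lef_pV2 ?posrE ?exprn_gt0 //.
  by rewrite ler_eXn2l // ltr1n.
have layer_uniq j k a : layer j a -> layer k a -> j = k.
  suff aux i i' : layer i a -> layer i' a -> ~~ (i < i')%N.
    by move=> ja ka; apply/eqP; rewrite eqn_leq leqNgt aux //= leqNgt aux.
  move=> [_ /andP[h1 _]] [_ /andP[_ h2]]; apply/negP => ii'.
  by have := thr_le _ _ ii'; lra.
have layer_ex a : A a -> exists k, layer k a.
  move=> Aa; have [ra0 _] := rP _ Aa.
  have ex : exists k, thr k.+1 <= r a.
    exists (Num.truncn (M / r a)); rewrite /thr ler_pdivrMr ?exprn_gt0 //.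
    rewrite mulrC -ler_pdivrMr //.
    have /andP[_ h] := truncn_itv (ltW (divr_gt0 M_gt0 ra0)).
    apply: le_trans (ltW h) _; rewrite -natrX ler_nat.
    by apply: ltnW; exact: ltn_expl.
  have [[|k] kP kmin] := ex_minnP ex.
    by exists 0%N; split => //; rewrite kP /thr expr0 divr1 rM.
  exists k.+1; split => //; rewrite kP /= ltNge; apply/negP => /kmin.
  by rewrite ltnn.
pose sep a b := Num.min (r a) (r b) < d a b.
have sepC a b : sep a b -> sep b a by rewrite /sep minC d_sym.
have /choice[pick pickP] := fun P : set G => maximal_separated P sepC.
pose cover (W : set G) := [set x | exists2 b, W b & d x b <= r b].
(* [U k] holds the centers selected in the layers before [k], and [S k]
   those selected in layer [k]. *)
pose U := fix U k : set G :=
  if k is k'.+1 then U k' `|` pick (layer k' `\` cover (U k')) else set0.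
pose S k := pick (layer k `\` cover (U k)).
have SL k a : S k a -> layer k a /\ ~ cover (U k) a.
  by move=> Sa; have [sub _ _] := pickP (layer k `\` cover (U k)); exact: sub.
have Umono j k : (j <= k)%N -> U j `<=` U k.
  elim: k => [|k IH]; first by rewrite leqn0 => /eqP ->.
  rewrite leq_eqVlt => /orP[/eqP -> //|]; rewrite ltnS => jk x Ux.
  by left; exact: IH.
have US k a : U k a -> exists j, S j a.
  by elim: k => //= k IH [/IH //|Sa]; exists k.
pose T := [set a | exists k, S k a].
have TA a : T a -> A a by move=> [k /SL[[]]].
have SA k a : S k a -> A a by move=> Sa; apply: TA; exists k.
have Tcover a : A a -> exists2 b, T b & d a b <= r b.
  move=> Aa; have [k ka] := layer_ex a Aa.
  have [[b Ub ab]|nc] := pselect (cover (U k) a); first by exists b => //; exact: US Ub.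
  have [_ _ /(_ a (conj ka nc))[x Sx xa]] := pickP (layer k `\` cover (U k)).
  exists x; first by exists k.
  have [->|/negP] := xa; first by rewrite d_xx ltW //; have [] := rP _ Aa.
  by rewrite -leNgt d_sym le_min => /andP[].
have cross i j a b : (i < j)%N -> S i a -> S j b -> r a < d b a /\ r b < d a b.
  move=> ij Sa Sb.
  have Ua : U j a by apply: (Umono i.+1 j ij); right.
  have [[_ /andP[bj1 bj2]] ncov] := SL _ _ Sb.
  have [[_ /andP[ai1 _]] _] := SL _ _ Sa.
  have rab : r a < d b a.
    by rewrite ltNge; apply/negP => h; apply: ncov; exists a.
  split => //; rewrite d_sym; apply: lt_trans rab.
  by apply: lt_le_trans bj2 _; apply: le_trans ai1; exact: thr_le.
have within k a b : S k a -> S k b -> a <> b -> thr k.+1 < d a b.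
  move=> Sa Sb ab; have [_ /(_ a b Sa Sb ab) + _] := pickP (layer k `\` cover (U k)).
  apply: le_lt_trans; rewrite le_min.
  by have [[_ /andP[-> _]] _] := SL _ _ Sa; have [[_ /andP[-> _]] _] := SL _ _ Sb.
have [r0 Ar0] : exists r0, forall a, A a -> d a 1%g <= r0.
  have [[a0 Aa0]|A0] := pselect (A !=set0); last by exists 0 => a Aa; case: A0; exists a.
  exists (M + d a0 1%g) => a Aa; apply: le_trans (d_tri a a0 1%g) _.
  by rewrite lerD2r AM.
have cT : countable T.
  rewrite (_ : T = \bigcup_k S k); last first.
    by apply/seteqP; split => a; [move=> [k ?]; exists k|move=> [k _ ?]; exists k].
  apply: bigcup_countable => // k _.
  apply: (@separated_countable _ r0 (thr k.+1)) => // [a /SA /Ar0 //|a b Sa Sb ab].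
  by apply/ltW; exact: (within k).
exists ((fun a => cball d a (r a)) @` T); split.
- by move=> _ [a /TA Aa <-]; have [] := rP a Aa.
- exact: sub_countable (card_image_le _ _) cT.
- move=> a /Tcover[b Tb ab]; exists (cball d b (r b)) => //.
  by exists b.
- move=> x.
  apply: (@card_le_trans _ _ _ ((fun a => cball d a (r a)) @` [set a | T a /\ d x a <= r a])).
    by apply: subset_card_le => _ [[a Ta <-] xa]; exists a.
  apply: card_image_bounded => s us sW; apply: leqW.
  have /choice[lay layP] (a : G) : exists k, T a -> S k a.
    by have [[k Sk]|nT] := pselect (T a); [exists k|exists 0%N => /nT].
  have sS a : a \in s -> S (lay a) a by move=> /sW[Ta _]; exact: layP.
  pose L := undup (map lay s).
  apply: (@leq_trans (size L * D)).
    apply: (@size_le_classes _ lay) => [a aS|k].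
      by rewrite mem_undup map_f.
    apply: (DP _ x (thr k.+1)) => //; first exact: filter_uniq.
      move=> a; rewrite mem_filter => /andP[/eqP ak aS].
      have [_ xa] := sW _ aS; rewrite d_sym (le_trans xa) // -thrS.
      by have := SL _ _ (sS _ aS); rewrite ak => -[[_ /andP[_ /ltW]]].
    move=> a b; rewrite !mem_filter => /andP[/eqP ak aS] /andP[/eqP bk bS] /eqP ab.
    by apply: (within k) => //; [rewrite -ak|rewrite -bk]; exact: sS.
  rewrite leq_mul2r; apply/orP; right.
  (* One of the balls at [x] for each layer that occurs. *)
  pose rep k := nth 1%g s (index k (map lay s)).
  have repP k : k \in L -> rep k \in s /\ lay (rep k) = k.
    rewrite mem_undup => kL; split; first by rewrite mem_nth // -(size_map lay) index_mem.
    by rewrite -(nth_map _ 0%N) ?nth_index // -(size_map lay) index_mem.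
  rewrite -(size_map rep); apply: (wbcp _ r x); split.
  - rewrite map_inj_in_uniq ?undup_uniq // => j k jL kL jk.
    by have [_ <-] := repP _ jL; have [_ <-] := repP _ kL; rewrite jk.
  - move=> _ /mapP[k kL ->]; have [ks _] := repP _ kL.
    have [Ta xa] := sW _ ks; split => //.
    by have [] := rP _ (TA _ Ta).
  - move=> _ _ /mapP[j jL ->] /mapP[k kL ->] jk.
    have [js jE] := repP _ jL; have [ks kE] := repP _ kL.
    have Sj := sS _ js; have Sk := sS _ ks; rewrite jE in Sj; rewrite kE in Sk.
    have [jlk|klj|ejk] := ltngtP j k.
    + by have [] := cross _ _ _ _ jlk Sj Sk.
    + by have [] := cross _ _ _ _ klj Sk Sj.
    + by rewrite ejk eqxx in jk.
Qed.

End WeakToStrong.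

(** * Stars *)

Lemma seq_pos_bounds (R : realType) (s : seq R) : (forall u, u \in s -> 0 < u) ->
  exists lo hi : R, [/\ 0 < lo, lo <= hi & forall u, u \in s -> lo <= u <= hi].
Proof.
elim: s => [|v s IH] sp; first by exists 1, 1.
have [|lo [hi [lo0 lohi loP]]] := IH; first by move=> u us; apply: sp; rewrite inE us orbT.
have v0 : 0 < v by apply: sp; rewrite mem_head.
exists (Num.min v lo), (Num.max v hi); split.
- by rewrite lt_min v0.
- by rewrite ge_min le_max lexx.
- move=> u; rewrite inE => /orP[/eqP ->|us].
    by rewrite ge_min le_max lexx.
  have /andP[h1 h2] := loP u us.
  by rewrite ge_min le_max h1 h2 !orbT.
Qed.

Section Configurations.
Variables (R : realType) (G : groupTopologicalType).
Variables (delta : R -> G -> G) (d : G -> G -> R).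
Hypothesis hd : homogeneous_distance delta d.
Hypothesis delta1 : forall l, 0 < l -> delta l 1%g = 1%g.

Let d_ge0 x y : 0 <= d x y. Proof. by have [[]] := hd. Qed.
Let d_xx x : d x x = 0. Proof. by have [[_ h _ _] _ _] := hd; apply/h. Qed.
Let d_eq0 x y : d x y = 0 -> x = y. Proof. by have [[_ h _ _] _ _] := hd; move/h. Qed.
Let d_sym x y : d x y = d y x. Proof. by have [[_ _ h _] _ _] := hd. Qed.
Let d_tri x y z : d x z <= d x y + d y z. Proof. by have [[]] := hd. Qed.
Let d_mul g x y : d (g * x)%g (g * y)%g = d x y. Proof. by have [] := hd. Qed.
Let d_dil l x y : 0 < l -> d (delta l x) (delta l y) = l * d x y.
Proof. by have [_ _ h] := hd; apply: h. Qed.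

(** A rescaled Besicovitch family, with its common point as the point of index 0.
    The margin [eta] leaves room for replacing each point by a small cell. Its
    points are the [x i] with [i < N]. *)
Record star (N : nat) (x : nat -> G) (rho : nat -> R) (eta : R) : Prop := Star {
  star_gt0 : 0 < eta;
  star_le1 : eta <= 1;
  star_center : x 0%N = 1%g;
  star_half : forall i, (i < N)%N -> d (x i) 1%g <= 2^-1;
  star_in : forall i, (0 < i < N)%N -> d (x i) 1%g <= rho i - eta;
  star_out : forall i j, (0 < i < N)%N -> (0 < j < N)%N -> i <> j ->
    rho i + eta <= d (x j) (x i);
  star_center_sep : forall i, (0 < i < N)%N -> eta <= d (x i) 1%g
}.

Lemma star_sep N x rho eta : star N x rho eta ->
  forall i j, (i < N)%N -> (j < N)%N -> i <> j -> eta <= d (x i) (x j).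
Proof.
move=> s [|i] [|j] // iN jN ij.
- by rewrite (star_center s) d_sym (star_center_sep s).
- by rewrite (star_center s) (star_center_sep s).
- have := star_out s (i := i.+1) (j := j.+1) iN jN ij.
  have := star_in s (i := i.+1) iN; have := d_ge0 (x i.+1) 1%g.
  by rewrite [d (x j.+1) _]d_sym; have := star_gt0 s; lra.
Qed.

(** With a second point [x j] at hand, [star_out] bounds the radius by a distance
    of two points of the star, which is at most 1. *)
Lemma star_rho_le1 N x rho eta : (2 < N)%N -> star N x rho eta ->
  forall i, (0 < i < N)%N -> 0 < rho i <= 1.
Proof.
move=> N2 s i iN; have eta0 := star_gt0 s.
have [j [jN ij]] : exists j, (0 < j < N)%N /\ i <> j.
  by exists (if i == 1%N then 2%N else 1%N); case: (i =P 1%N); lia.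
have := star_out s iN jN ij; have := star_in s iN.
have := d_ge0 (x i) 1%g.
have := d_tri (x j) 1%g (x i); rewrite [d 1%g _]d_sym.
have := star_half s (i := i) ltac:(lia); have := star_half s (i := j) ltac:(lia).
by move=> *; apply/andP; split; lra.
Qed.

(** The common point is moved to the identity, and an upper bound [hi] of the
    radii is scaled to 1/2. The family is finite, so that no center comes closer
    than some [lo] to another ball. Adding half of [lo] to each radius puts the
    common point inside the balls and keeps the centers outside, with the margin
    [lo / 2] on both sides. *)
Lemma besicovitch_star (N : nat) (t : seq G) r p : besicovitch_family d t r p ->
  (N <= size t)%N -> (1 < N)%N ->
  exists (x : nat -> G) rho eta, star N x rho eta.
Proof.
move=> [ut tr tsep] Nt N1.
(* If a center were the common point, it would lie in every other ball. *)
have ap a : a \in t -> 0 < d a p.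
  move=> aT; rewrite lt_neqAle d_ge0 andbT; apply/eqP => /esym/d_eq0 apE.
  have [b bT ba] : exists2 b, b \in t & b != a.
    apply: contrapT => nb.
    have sub : {subset t <= [:: a]}.
      move=> b bT; rewrite inE; apply: contrapT => /negP ba; apply: nb.
      by exists b.
    by have := uniq_leq_size ut sub; rewrite /=; lia.
  have := tsep b a bT aT ba; have [_] := tr b bT.
  by rewrite -apE; lra.
pose gaps := [seq d b a - r a | a <- t, b <- [seq b <- t | b != a]] ++
  ([seq d a p | a <- t] ++ map r t).
have [|lo [hi [lo0 lohi loP]]] := @seq_pos_bounds R gaps.
  move=> u; rewrite !mem_cat => /orP[|/orP[|]].
  - move=> /allpairsPdep[a [b [aT]]]; rewrite mem_filter => /andP[ba bT] ->.
    by rewrite subr_gt0 tsep // eq_sym.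
  - by move=> /mapP[a aT ->]; exact: ap.
  - by move=> /mapP[a aT ->]; have [] := tr a aT.
have loab a b : a \in t -> b \in t -> b != a -> lo <= d b a - r a.
  move=> aT bT ba; have gm : d b a - r a \in gaps; last by have /andP[] := loP _ gm.
  rewrite mem_cat; apply/orP; left; apply/allpairsPdep; exists a, b.
  by rewrite mem_filter ba.
have loap a : a \in t -> lo <= d a p.
  move=> aT; have gm : d a p \in gaps; last by have /andP[] := loP _ gm.
  by rewrite !mem_cat map_f // orbT.
have rhi a : a \in t -> r a <= hi.
  move=> aT; have gm : r a \in gaps; last by have /andP[] := loP _ gm.
  by rewrite !mem_cat map_f // !orbT.
have hi0 : 0 < hi by apply: lt_le_trans lohi.
pose l := (2 * hi)^-1.
have l0 : 0 < l by rewrite invr_gt0 mulr_gt0.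
have lhi : l * hi = 2^-1 by rewrite /l invfM -mulrA mulVf ?gt_eqF // mulr1.
pose a_ i := nth p t i.
have aT i : (i < N)%N -> a_ i \in t by move=> iN; rewrite mem_nth // (leq_trans iN).
pose x i := if i is 0%N then 1%g else delta l (p^-1 * a_ i)%g.
pose y a := delta l (p^-1 * a)%g.
have yy a b : d (y a) (y b) = l * d a b by rewrite /y d_dil // d_mul.
have y1 a : d (y a) 1%g = l * d a p.
  by rewrite -yy; congr d; rewrite /y mulVg delta1.
have lle u v : u <= v -> l * u <= l * v by move=> uv; rewrite ler_pM2l.
exists x, (fun i => l * (r (a_ i) + lo / 2)), (l * (lo / 2)); split.
- by rewrite mulr_gt0 // divr_gt0.
- have := lle _ _ lohi; rewrite lhi; lra.
- by [].
- case=> [|i] iN; first by rewrite d_xx invr_ge0.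
  rewrite y1 -lhi; apply: lle; have [_ +] := tr _ (aT _ iN).
  by rewrite d_sym => /le_trans; apply; exact: rhi (aT _ iN).
- case=> // i /andP[_ iN]; rewrite y1.
  have [_] := tr _ (aT _ iN); rewrite d_sym => /lle; lra.
- case=> // i [//|j] /andP[_ iN] /andP[_ jN] ij; rewrite yy.
  have nij : a_ j.+1 != a_ i.+1.
    rewrite nth_uniq //; last 2 first.
    + exact: leq_trans jN Nt.
    + exact: leq_trans iN Nt.
    by apply/eqP => ji; apply: ij.
  have := lle _ _ (loab _ _ (aT _ iN) (aT _ jN) nij); lra.
- case=> // i /andP[_ iN]; rewrite y1.
  have := lle _ _ (loap _ (aT _ iN)); have := mulr_gt0 l0 lo0; lra.
Qed.

End Configurations.

(** * A measure on a Cantor set of nested stars *)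

Section Digits.
Variable R : realType.

(** The index of the cell of [x] when [0, 1) is cut into [M] equal cells. *)
Definition cell_index (M : nat) (x : R) : nat := Num.truncn (x * M%:R).

Lemma cell_index_div M b x : (0 < b)%N ->
  (cell_index (M * b) x %/ b)%N = cell_index M x.
Proof.
move=> b0; rewrite /cell_index; have [x0|x0] := leP 0 x; last first.
  have neg (k : nat) : Num.truncn (x * k%:R) = 0%N.
    by apply/truncn0Pn; rewrite -ltNge (le_lt_trans _ ltr01) // mulr_le0_ge0 // ltW.
  by rewrite !neg div0n.
apply/esym/truncn_def.
have /andP[] : (Num.truncn (x * (M * b)%:R))%:R <= x * (M * b)%:R
    < (Num.truncn (x * (M * b)%:R)).+1%:R.
  by apply: truncn_itv; rewrite mulr_ge0.
set u := Num.truncn _; move=> h1 h2.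
have b0' : 0 < b%:R :> R by rewrite ltr0n.
rewrite -(ler_pM2r b0') -(ltr_pM2r b0') -mulrA -!natrM; apply/andP; split.
  by apply: le_trans h1; rewrite ler_nat leq_divM.
apply: lt_le_trans h2 _; rewrite ler_nat.
by rewrite ltn_ceil.
Qed.

Lemma measurable_cell_index M j : measurable [set x | cell_index M x = j].
Proof.
apply: is_interval_measurable => x y /= xj yj z /andP[xz zy].
have mono u v : u <= v -> (cell_index M u <= cell_index M v)%N.
  move=> uv; rewrite /cell_index; apply: le_truncn.
  by rewrite ler_wpM2r.
by apply/eqP; rewrite eqn_leq -{1}yj -xj !mono.
Qed.

Lemma cell_itv M j : (j < M)%N ->
  [set x | 0 <= x < 1 /\ cell_index M x = j] =
  `[j%:R / M%:R, j.+1%:R / M%:R[%classic.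
Proof.
move=> jM; have M0 : 0 < M%:R :> R by rewrite ltr0n; lia.
apply/seteqP; split => x /=; rewrite in_itv /= ler_pdivrMr // ltr_pdivlMr //.
  move=> [/andP[x0 _] <-]; apply: truncn_itv.
  by rewrite mulr_ge0 // ltW.
move=> xj; have /andP[h1 h2] := xj.
have x0 : 0 <= x by rewrite -(pmulr_lge0 _ M0) (le_trans _ h1).
split; last exact: truncn_def.
rewrite x0 /= -(ltr_pM2r M0) mul1r (lt_le_trans h2) // ler_nat; lia.
Qed.

Lemma lebesgue_cell M j : (j < M)%N ->
  lebesgue_measure [set x | 0 <= x < 1 /\ cell_index M x = j] = (M%:R^-1)%:E.
Proof.
move=> jM; have M0 : 0 < M%:R :> R by rewrite ltr0n; lia.
rewrite cell_itv // lebesgue_measure_itv /= lte_fin ltr_pM2r ?invr_gt0 // ltr_nat ltnSn.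
by rewrite -EFinB -mulrBl -natr1 addrAC subrr add0r mul1r.
Qed.

Lemma cell_index_lt M x : 0 <= x < 1 -> (0 < M)%N -> (cell_index M x < M)%N.
Proof.
move=> /andP[x0 x1] M0; have M0' : 0 < M%:R :> R by rewrite ltr0n.
rewrite -(ltr_nat R) /cell_index.
have /andP[h _] : (Num.truncn (x * M%:R))%:R <= x * M%:R < (Num.truncn (x * M%:R)).+1%:R.
  by apply: truncn_itv; rewrite mulr_ge0 // ltW.
by apply: le_lt_trans h _; rewrite gtr_pMl.
Qed.

End Digits.

Lemma pushforward_measure d d' (T1 : measurableType d) (T2 : measurableType d')
    (R : realType) (m : {measure set T1 -> \bar R}) (f : T1 -> T2) :
  measurable_fun [set: T1] f ->
  exists mu : {measure set T2 -> \bar R}, forall S, mu S = m (f @^-1` S).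
Proof.
move=> mf.
by exists (@measure_function_pushforward__canonical__measure_function_Measure
  _ _ _ _ _ m f mf).
Qed.

Section Coding.
Variables (R : realType) (G : groupTopologicalType).
Variables (delta : R -> G -> G) (d : G -> G -> R).
Hypothesis hd : homogeneous_distance delta d.
Hypothesis delta1 : forall l, 0 < l -> delta l 1%g = 1%g.
Hypothesis nested : forall (p : nat -> G) (r : nat -> R),
  (forall k, cball d (p k.+1) (r k.+1) `<=` cball d (p k) (r k)) ->
  (forall k, 0 <= r k) -> exists x, forall k, cball d (p k) (r k) x.

Let dD : is_distance d. Proof. by have [] := hd. Qed.
Let d_sym x y : d x y = d y x. Proof. by have [[_ _ h _] _ _] := hd. Qed.
Let d_tri x y z : d x z <= d x y + d y z. Proof. by have [[]] := hd. Qed.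
Let d_mul g x y : d (g * x)%g (g * y)%g = d x y. Proof. by have [] := hd. Qed.
Let d_dil l x y : 0 < l -> d (delta l x) (delta l y) = l * d x y.
Proof. by have [_ _ h] := hd; apply: h. Qed.

(** The number of points of the stars of level [k]: the reciprocals of these
    numbers, which are the shares of the central cells, add up to 1/2. *)
Definition branching (k : nat) : nat := 2 ^ k.+2.
Variables (x_ : nat -> nat -> G) (rho_ : nat -> nat -> R) (eta_ : nat -> R).
Hypothesis stars : forall k, star d (branching k) (x_ k) (rho_ k) (eta_ k).

Let b0 k : (0 < branching k)%N. Proof. by rewrite expn_gt0. Qed.
Let b2 k : (2 < branching k)%N.
Proof. by rewrite /branching !expnS; have := expn_gt0 2 k; lia. Qed.

(** The factor [eta_ k' / 8] makes the cells of the next level small in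
    comparison with the margin of the star that carries them. *)
Fixpoint scale (k : nat) : R := if k is k'.+1 then scale k' * eta_ k' / 8 else 1.

Fixpoint ncells (k : nat) : nat := if k is k'.+1 then (ncells k' * branching k')%N else 1%N.

(** The vertices of level [k] are numbered by words of [k] digits in mixed
    radix: [w %% branching k'] is the last digit, and it selects a point of the
    star that is attached to the vertex with number [w %/ branching k']. *)
Fixpoint vertex (k w : nat) : G :=
  if k is k'.+1 then
    (vertex k' (w %/ branching k')
      * delta (scale k') (x_ k' (w %% branching k')))%g
  else 1%g.

Lemma scale_gt0 k : 0 < scale k.
Proof.
elim: k => [|k IH] /=; first exact: ltr01.
by rewrite divr_gt0 // mulr_gt0 // (star_gt0 (stars k)).
Qed.

Lemma scaleS k : 8 * scale k.+1 = scale k * eta_ k.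
Proof. by rewrite /= mulrC divfK. Qed.

Lemma scaleS_le k : 8 * scale k.+1 <= scale k.
Proof. by rewrite scaleS ler_piMr ?(star_le1 (stars k)) // ltW // scale_gt0. Qed.

Lemma ncells_gt0 k : (0 < ncells k)%N.
Proof. by elim: k => //= k IH; rewrite muln_gt0 IH b0. Qed.

(** The first [k] digits of [x] in mixed radix, read as one number. *)
Definition word (k : nat) (x : R) : nat := cell_index (ncells k) x.

Lemma word_div k x : (word k.+1 x %/ branching k)%N = word k x.
Proof. exact: cell_index_div. Qed.

Lemma word_lt k x : 0 <= x < 1 -> (word k x < ncells k)%N.
Proof. by move=> x01; apply: cell_index_lt => //; exact: ncells_gt0. Qed.

Lemma vertex_sibling k u v : (u %/ branching k = v %/ branching k)%N ->
  d (vertex k.+1 u) (vertex k.+1 v)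
  = scale k * d (x_ k (u %% branching k)) (x_ k (v %% branching k)).
Proof. by move=> uv /=; rewrite uv d_mul d_dil // scale_gt0. Qed.

Lemma vertex_child k u : d (vertex k.+1 u) (vertex k (u %/ branching k))
  <= scale k / 2.
Proof.
rewrite -[X in d _ X]mulg1 -(delta1 (scale_gt0 k)) /= d_mul d_dil ?scale_gt0 //.
rewrite ler_pM2l ?scale_gt0 //.
by rewrite (star_half (stars k)) // ltn_mod.
Qed.

(** The balls of the cells that contain [x] are nested, so that completeness in
    the form of [nested] applies. *)
Lemma coded_point x : exists p, forall k, d p (vertex k (word k x)) <= scale k.
Proof.
apply: (@nested (fun k => vertex k (word k x)) scale) => [k q qk|k]; last first.
  exact/ltW/scale_gt0.
suff : d q (vertex k (word k.+1 x %/ branching k)) <= scale k by rewrite word_div.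
have h0 : d q (vertex k.+1 (word k.+1 x)) <= scale k.+1 := qk.
have h1 := vertex_child k (word k.+1 x).
have h2 := d_tri q (vertex k.+1 (word k.+1 x)) (vertex k (word k.+1 x %/ branching k)).
have h3 := scaleS_le k; have h4 := scale_gt0 k.
by lra.
Qed.

Definition code (x : R) : G := projT1 (cid (coded_point x)).

Lemma codeP x k : d (code x) (vertex k (word k x)) <= scale k.
Proof. by rewrite /code; case: cid. Qed.

(** Both points are within [scale k.+1] of vertices that are images of two points
    of one star under the same translation and dilation. *)
Lemma code_sibling k x y : word k x = word k y ->
  scale k * d (x_ k (word k.+1 x %% branching k)) (x_ k (word k.+1 y %% branching k))
    - 2 * scale k.+1 <= d (code x) (code y)
  <= scale k * d (x_ k (word k.+1 x %% branching k)) (x_ k (word k.+1 y %% branching k))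
    + 2 * scale k.+1.
Proof.
move=> xy; rewrite -vertex_sibling; last by rewrite !word_div.
have h1 := codeP x k.+1; have h2 := codeP y k.+1.
set vx := vertex _ _ in h1 *; set vy := vertex _ _ in h2 *.
have := d_tri vx (code x) vy; have := d_tri (code x) (code y) vy.
have := d_tri (code x) vx (code y); have := d_tri vx vy (code y).
rewrite [d vx (code x)]d_sym [d vy (code y)]d_sym.
by move=> *; apply/andP; split; lra.
Qed.

Lemma code_sep k x y : 0 <= x < 1 -> 0 <= y < 1 -> word k x <> word k y ->
  6 * scale k <= d (code x) (code y).
Proof.
move=> x01 y01; elim: k => [|k IH] xy.
  by have := word_lt 0 x01; have := word_lt 0 y01; rewrite /=; lia.
have [exy|nxy] := eqVneq (word k x) (word k y).
  have /andP[h _] := code_sibling exy; apply: le_trans h.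
  have dig : (word k.+1 x %% branching k <> word k.+1 y %% branching k)%N.
    move=> h; apply: xy; rewrite (divn_eq (word k.+1 x) (branching k)) h.
    by rewrite word_div exy -word_div -divn_eq.
  have := star_sep hd (stars k) (ltn_pmod _ (b0 k)) (ltn_pmod _ (b0 k)) dig.
  move=> h; have := ler_wpM2l (ltW (scale_gt0 k)) h; rewrite -scaleS; lra.
move/eqP: nxy => /IH; have := scaleS_le k; have := scale_gt0 k.+1.
by move=> *; lra.
Qed.

Let borelG := borel d.

Lemma scale_small (r : R) : 0 < r -> exists k, 2 * scale k < r.
Proof.
move=> r0.
have scale8 k : 8 ^+ k * scale k <= 1.
  elim: k => [|k IH]; first by rewrite expr0 mulr1.
  rewrite exprS; have := scaleS_le k.
  have p0 : 0 <= 8 ^+ k :> R by rewrite exprn_ge0.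
  by move=> /(ler_wpM2l p0) h; lra.
have r2 : 0 < 2 / r by rewrite divr_gt0.
exists (Num.truncn (2 / r)).+1.
set K := (Num.truncn (2 / r)).+1.
have K8 : 2 / r < 8 ^+ K.
  have /andP[_ h] := truncn_itv (ltW r2); apply: lt_trans h _.
  by rewrite -natrX ltr_nat; exact: ltn_expl.
have h := scale8 K; have s0 := scale_gt0 K.
have r2' : 2 < 8 ^+ K * r by rewrite -ltr_pdivrMr.
have := ltr_pM2r s0 2 (8 ^+ K * r); rewrite r2' => h'.
by apply: (lt_le_trans h'); rewrite mulrAC ler_piMl // ltW.
Qed.

(** The preimage of an open set is a union of cells: with a point it
    contains all the points of a sufficiently small cell. *)
Lemma measurable_code : measurable_fun [set: R] (code : R -> borelG).
Proof.
apply: (@measurability _ _ R borelG _ _ (dist_open d)) => // _ [U oU <-].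
rewrite setTI.
have -> : code @^-1` U =
  \bigcup_k \bigcup_(j in [set j | cball d (vertex k j) (scale k) `<=` U])
    [set x | word k x = j].
  apply/seteqP; split => [x /= /oU[r r0 rU]|x [k _ [j jU /= xj]]]; last first.
    by apply: jU; rewrite -xj; exact: codeP.
  have [k kr] := scale_small r0.
  exists k => //; exists (word k x) => //= q qk; apply: rU.
  have := d_tri q (vertex k (word k x)) (code x).
  have := codeP x k; rewrite [d (vertex _ _) (code x)]d_sym.
  have qk' : d q (vertex k (word k x)) <= scale k := qk.
  by lra.
apply: bigcup_measurable => k _; apply: bigcup_measurable => j _.
exact: measurable_cell_index.
Qed.

Local Notation I01 := (`[0%R, 1%R[%classic : set R).

Let mI : measurable I01. Proof. exact: measurable_itv. Qed.

Lemma code_measure : exists mu : {measure set borelG -> \bar R},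
  forall S, mu S = lebesgue_measure (code @^-1` S `&` I01).
Proof.
exact: (pushforward_measure (mrestr lebesgue_measure mI) measurable_code).
Qed.

Lemma word_onto k j : (j < ncells k)%N -> exists2 x, 0 <= x < 1 & word k x = j.
Proof.
move=> jM; suff [x [x01 xj]] : [set x : R | 0 <= x < 1 /\ cell_index (ncells k) x = j] !=set0.
  by exists x.
rewrite cell_itv //; exists (j%:R / (ncells k)%:R); rewrite /= in_itv /= lexx /=.
by rewrite ltr_pM2r ?invr_gt0 ?ltr0n ?ncells_gt0 // ltr_nat.
Qed.

(** The points that have the digit 0 at some level. The union of balls is a Borel
    set, and on coded points it detects the digit 0 exactly, because cells are
    well separated. *)
Definition central : set G := \bigcup_k
  \bigcup_(j in [set j | (j < ncells k.+1)%N /\ (j %% branching k = 0)%N])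
    cball d (vertex k.+1 j) (scale k.+1).

Lemma measurable_central : measurable (central : set borelG).
Proof.
apply: bigcup_measurable => k _; apply: bigcup_measurable => j _.
exact: (cball_measurable dD).
Qed.

Lemma code_central x : 0 <= x < 1 ->
  central (code x) <-> exists k, (word k.+1 x %% branching k = 0)%N.
Proof.
move=> x01; split => [[k _ [j [jM j0] xj]]|[k k0]]; last first.
  exists k => //; exists (word k.+1 x); last exact: codeP.
  by split => //; exact: word_lt.
exists k; have [y y01 yj] := word_onto jM.
have [->//|/eqP nxy] := eqVneq (word k.+1 x) (word k.+1 y); first by rewrite yj.
have h1 := code_sep x01 y01 nxy; have h2 := codeP y k.+1; rewrite yj in h2.
have h3 : d (code x) (vertex k.+1 j) <= scale k.+1 := xj.
have h4 := d_tri (code x) (vertex k.+1 j) (code y).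
rewrite [d (vertex _ _) _]d_sym in h4; have h5 := scale_gt0 k.+1.
by exfalso; lra.
Qed.

(** At level [k] the digit 0 occupies the share 1 / [branching k] of [0, 1). *)
Lemma lebesgue_central :
  (lebesgue_measure (code @^-1` central `&` I01) <= (2^-1)%:E)%E.
Proof.
pose Z k : set R := \bigcup_(j in `I_(ncells k))
   [set x : R | 0 <= x < 1 /\ cell_index (ncells k.+1) x = (j * branching k)%N].
have mcell k j : measurable [set x : R | 0 <= x < 1 /\ cell_index (ncells k) x = j].
  rewrite (_ : mkset _ = I01 `&` [set x : R | cell_index (ncells k) x = j]).
    by apply: measurableI => //; exact: measurable_cell_index.
  by apply/seteqP; split => x /=; rewrite in_itv.
have mZ k : measurable (Z k) by apply: bigcup_measurable => j _; exact: mcell.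
have muZ k : (lebesgue_measure (Z k) <= (2^-1 / (2 ^ k.+1)%:R)%:E)%E.
  rewrite /Z bigcup_mkord.
  pose F j := [set x : R | 0 <= x < 1 /\ cell_index (ncells k.+1) x = (j * branching k)%N].
  have := @Boole_inequality _ _ _ (@lebesgue_measure R) F (ncells k) (fun j _ => mcell _ _).
  move=> /le_trans; apply.
  apply: (@le_trans _ _ (\sum_(j < ncells k) ((ncells k.+1)%:R^-1)%:E)%E).
    apply: lee_sum => j _; rewrite le_eqVlt; apply/orP; left; apply/eqP.
    apply: lebesgue_cell => /=.
    by rewrite ltn_pmul2r ?b0 // ltn_ord.
  rewrite sumEFin sumr_const card_ord lee_fin /= natrM invfM.
  rewrite -mulrnAl -[X in X * _]mulr_natr mulVf ?mul1r; last first.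
    by rewrite pnatr_eq0 -lt0n ncells_gt0.
  by rewrite -invfM -natrM /branching -expnS.
have sub : code @^-1` central `&` I01 `<=` \bigcup_k Z k.
  move=> x [/= xc]; rewrite in_itv /= => x01.
  have [k k0] := (code_central x01).1 xc.
  exists k => //; exists (word k x); first exact: word_lt.
  split => //=; rewrite -/(word k.+1 x) {1}(divn_eq (word k.+1 x) (branching k)) k0 addn0.
  by rewrite word_div.
apply: (@le_trans _ _ (\sum_(0 <= k <oo) lebesgue_measure (Z k))%E).
  apply: measure_sigma_subadditive => //.
  apply: measurableI => //; rewrite -[X in measurable X]setTI.
  exact: measurable_code measurable_central.
apply: le_trans (@epsilon_trick0 R 2^-1 xpredT _); last by rewrite invr_ge0.
by apply: lee_nneseries => // k _; exact: muZ.
Qed.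

(** The radius is that of the star of level [k] at the point with the digit of
    [x]. The ball contains the central cell of that star, which has the mass
    1 / [ncells k.+1]. Its non-central part lies in the cell of [x] itself,
    which has the same mass: the ball meets no other cell whose digit at level
    [k] is not 0. *)
Lemma ball_mass (mu : {measure set borelG -> \bar R}) :
  (forall S, mu S = lebesgue_measure (code @^-1` S `&` I01)) ->
  forall x k, 0 <= x < 1 -> (0 < word k.+1 x %% branching k)%N ->
  forall B, B = cball d (code x) (scale k * rho_ k (word k.+1 x %% branching k)) ->
  (mu (B `&` ~` central) <= ((ncells k.+1)%:R^-1)%:E <= mu (B `&` central))%E.
Proof.
move=> muE x k x01 + B0 ->; set i := (word k.+1 x %% branching k)%N => i0.
set B := cball _ _ _.
have iN : (0 < i < branching k)%N by rewrite i0 /i ltn_mod b0.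
have s0 := scale_gt0 k; have s1 := scale_gt0 k.+1; have sS := scaleS k.
have /andP[r0 r1] := star_rho_le1 hd (b2 k) (stars k) iN.
have msub S : measurable (S : set borelG) -> measurable (code @^-1` S `&` I01).
  move=> mS; apply: measurableI => //; rewrite -[X in measurable X]setTI.
  exact: measurable_code.
have mcell j : measurable [set x : R | 0 <= x < 1 /\ cell_index (ncells k.+1) x = j].
  rewrite (_ : mkset _ = I01 `&` [set x : R | cell_index (ncells k.+1) x = j]).
    by apply: measurableI => //; exact: measurable_cell_index.
  by apply/seteqP; split => y /=; rewrite in_itv.
have mB : measurable (B : set borelG) by exact: (cball_measurable dD).
have mC := measurable_central.
apply/andP; split; rewrite muE.
  rewrite -(lebesgue_cell R (word_lt k.+1 x01)).
  apply: le_measure; rewrite ?inE; [|exact: mcell|].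
    by apply: msub; apply: measurableI => //; exact: measurableC.
  move=> y [[/= yB yc]]; rewrite /= in_itv /= => y01; split => //.
  rewrite -/(word k.+1 y) -/(word k.+1 x).
  have yB' : d (code y) (code x) <= scale k * rho_ k i := yB.
  have [kxy|/eqP nxy] := eqVneq (word k y) (word k x); last first.
    have h := code_sep y01 x01 nxy.
    have : scale k * rho_ k i <= scale k by rewrite ler_piMr // ltW.
    by move=> ?; exfalso; lra.
  have /andP[h _] := code_sibling kxy; rewrite -/i in h.
  set j := (word k.+1 y %% branching k)%N in h *.
  have j0 : (0 < j)%N.
    rewrite lt0n; apply/eqP => j0; apply: yc; apply/(code_central y01).
    by exists k.
  have [ij|/eqP ij] := eqVneq i j; last first.
    have jN : (0 < j < branching k)%N by rewrite j0 /j ltn_mod b0.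
    have := star_out (stars k) iN jN ij.
    move=> /(ler_wpM2l (ltW s0)); rewrite mulrDr -sS.
    by move=> ?; exfalso; lra.
  rewrite (divn_eq (word k.+1 y) (branching k)) (divn_eq (word k.+1 x) (branching k)).
  by rewrite !word_div kxy -/i -/j ij.
have jM : (word k x * branching k < ncells k.+1)%N by rewrite ltn_pmul2r ?b0 ?word_lt.
rewrite -(lebesgue_cell R jM).
apply: le_measure; rewrite ?inE; [exact: mcell|by apply: msub; exact: measurableI|].
move=> y /= [y01 yj]; rewrite -/(word k.+1 y) in yj.
have yd : (word k.+1 y %% branching k = 0)%N by rewrite yj modnMl.
have kxy : word k y = word k x by rewrite -word_div yj mulnK ?b0.
split; last by rewrite in_itv.
split; last by apply/(code_central y01); exists k.
have /andP[_ h] := code_sibling kxy.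
rewrite yd (star_center (stars k)) -/i [d 1%g _]d_sym in h.
have := star_in (stars k) iN.
move=> /(ler_wpM2l (ltW s0)); rewrite mulrBr -sS => h2.
by rewrite /B /cball /=; lra.
Qed.

(** For the indicator function of the points that are not central, the averages
    at these points are infinitely often at most 1/2 and so do not converge to 1.
    Were the theorem to hold, almost all points would be central. *)
Lemma stars_not_differentiable : exists2 mu : {measure set borelG -> \bar R},
  locally_finite mu & ~ differentiation_theorem mu.
Proof.
have [mu muE] := code_measure.
have mC := measurable_central.
have mu1 S : measurable S -> (mu S <= 1)%E.
  move=> mS; rewrite muE; apply: (@le_trans _ _ (lebesgue_measure I01)).
    apply: le_measure; rewrite ?inE; [|exact: mI|by move=> x []].
    apply: measurableI => //; rewrite -[X in measurable X]setTI.
    exact: measurable_code.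
  by rewrite lebesgue_measure_itv /= lte01 sube0.
have mufin S : measurable S -> mu S \is a fin_num.
  by move=> mS; rewrite ge0_fin_numE // (le_lt_trans (mu1 _ mS)) // ltry.
exists mu.
  by move=> p; exists 1 => //; rewrite (le_lt_trans (mu1 _ (cball_measurable dD _ _))) // ltry.
pose f : borelG -> R := \1_(~` central).
have mf : measurable_fun [set: borelG] f by apply: measurable_indic; exact: measurableC.
have fint : Defs.locally_integrable mu f.
  split => // p; exists 1 => //; apply: measurable_bounded_integrable.
  - exact: (cball_measurable dD).
  - by rewrite (le_lt_trans (mu1 _ (cball_measurable dD _ _))) // ltry.
  - exact: measurable_funS mf.
  - exists 1; split => [|M M1 x _ /=]; first exact: num_real.
    by rewrite /f indicE; case: (_ \in _); rewrite ?normr1 ?normr0 ltW // (lt_trans _ M1).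
move=> /(_ f fint) [N [mN N0 NP]].
have bad x : 0 <= x < 1 -> ~ central (code x) -> N (code x).
  move=> x01 nc; apply: NP => /= cvg.
  have f1 : f (code x) = 1 by rewrite /f indicE mem_set.
  rewrite f1 in cvg.
  have half : 0 < 2^-1 :> R by rewrite invr_gt0.
  move/cvgrPdist_lt : cvg => /(_ _ half).
  move=> /nbhs_ballP[q /= q0 qP].
  have [k kq] := scale_small q0.
  have i0 : (0 < word k.+1 x %% branching k)%N.
    by rewrite lt0n; apply/eqP => i0; apply: nc; apply/(code_central x01); exists k.
  have s0 := scale_gt0 k.
  have iN : (0 < word k.+1 x %% branching k < branching k)%N by rewrite i0 ltn_mod b0.
  have /andP[r0 r1] := star_rho_le1 hd (b2 k) (stars k) iN.
  set rad := scale k * rho_ k (word k.+1 x %% branching k)%N.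
  have rad0 : 0 < rad by rewrite mulr_gt0.
  have radq : ball 0 q rad.
    rewrite -ball_normE /= sub0r normrN gtr0_norm //.
    have : rad <= scale k by rewrite ler_piMr // ltW.
    by move=> ?; lra.
  have := qP _ radq rad0; set B := cball d (code x) rad.
  have mB : measurable (B : set borelG) by exact: (cball_measurable dD).
  have /andP[h1 h2] := ball_mass muE x01 i0 (B := B) erefl.
  rewrite /Rintegral (_ : (\int[mu]_(z in B) (f z)%:E)%E = mu (~` central `&` B)); last first.
    by rewrite -integral_indic //; exact: measurableC.
  rewrite setIC.
  have mB1 : measurable (B `&` ~` central : set borelG).
    by apply: measurableI => //; exact: measurableC.
  have mB2 : measurable (B `&` central : set borelG) by exact: measurableI.
  have -> : mu B = (mu (B `&` ~` central) + mu (B `&` central))%E.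
    rewrite -measureU // ?setIUr1 //.
      by rewrite -setIUr setUC setUv setIT.
    by rewrite setIACA [~` _ `&` _]setIC setICr setI0.
  have f1' := mufin _ mB1; have f2' := mufin _ mB2.
  rewrite fineD //.
  have g1 : fine (mu (B `&` ~` central)) <= (ncells k.+1)%:R^-1.
    by rewrite -lee_fin fineK.
  have g2 : (ncells k.+1)%:R^-1 <= fine (mu (B `&` central)).
    by rewrite -lee_fin fineK.
  have M0 : 0 < (ncells k.+1)%:R^-1 :> R by rewrite invr_gt0 ltr0n ncells_gt0.
  have a0 : 0 <= fine (mu (B `&` ~` central)) by exact: fine_ge0.
  set a := fine _ in g1 a0 *; set b := fine _ in g2 *.
  have ab0 : 0 < a + b by apply: ltr_wpDl => //; exact: lt_le_trans g2.
  have abh : (a + b)^-1 * a <= 2^-1.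
    rewrite ler_pdivrMl //; have := le_trans g1 g2; lra.
  by rewrite ltNge => /negP; apply; rewrite ger0_norm; lra.
have cover : I01 `<=` (code @^-1` central `&` I01) `|` (code @^-1` N `&` I01).
  move=> x /= xI; move: (xI); rewrite in_itv /= => x01.
  have [xc|xc] := pselect (central (code x)); [by left|right; split => //].
  exact: bad.
have mpre S : measurable (S : set borelG) -> measurable (code @^-1` S `&` I01).
  move=> mS; apply: measurableI => //; rewrite -[X in measurable X]setTI.
  exact: measurable_code.
have : (lebesgue_measure I01 <= (2^-1)%:E :> \bar R)%E.
  apply: (@le_trans _ _ (lebesgue_measure (code @^-1` central `&` I01) +
      lebesgue_measure (code @^-1` N `&` I01))%E).
    apply: (@le_trans _ _ (lebesgue_measure ((code @^-1` central `&` I01) `|`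
        (code @^-1` N `&` I01)))).
      apply: le_measure; rewrite ?inE; [exact: mI| |exact: cover].
      by apply: measurableU; exact: mpre.
    by apply: measureU2; exact: mpre.
  by rewrite -(muE N) N0 adde0; exact: lebesgue_central.
rewrite lebesgue_measure_itv /= lte01 sube0 lee_fin leNgt invf_lt1 ?ltr1n //.
Qed.

End Coding.

(** * Mean value inequalities *)

Lemma derivable_line (R : realType) (V W : normedModType R) (f : V -> W)
    (x v : V) (t : R) :
  derivable f (x + t *: v) v ->
  is_derive t 1 (fun s : R => f (x + s *: v)) ('D_v f (x + t *: v)).
Proof.
move=> df; have E : (fun h : R => h^-1 *: (f (x + (h *: (1:R) + t) *: v) - f (x + t *: v)))
   = (fun h => h^-1 *: (f (h *: v + (x + t *: v)) - f (x + t *: v))).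
  apply/funext => h; congr (_ *: (f _ - _)).
  by rewrite [h *: 1]mulr1 scalerDl addrCA.
apply: DeriveDef; first by rewrite /derivable /= E.
by rewrite /derive /= E.
Qed.

Lemma row_norm_le (R : realType) (n : nat) (x : 'rV[R]_n) (C : R) :
  0 <= C -> (forall j, `|x 0 j| <= C) -> `|x| <= C.
Proof.
move=> C0 xC; rewrite /Num.Def.normr/= mx_normrE (bigmax_le _ C0)//= => -[i j] _.
by rewrite ord1; exact: xC.
Qed.

Lemma row_coord_le (R : realType) (n : nat) (x : 'rV[R]_n) j : `|x 0 j| <= `|x|.
Proof.
by rewrite [leRHS]/Num.Def.normr/= mx_normrE; exact: (le_bigmax _ _ (0, j)).
Qed.

(** The inequality for each coordinate follows from the mean value theorem on
    the segment; with the maximum norm this is enough. *)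
Lemma mean_value_le (R : realType) (n : nat) (V : normedModType R)
    (f : V -> 'rV[R]_n) (x v : V) (C : R) :
  (forall t : R, 0 <= t <= 1 -> derivable f (x + t *: v) v) ->
  (forall t : R, 0 <= t <= 1 -> `|'D_v f (x + t *: v)| <= C) ->
  `|f (x + v) - f x| <= C.
Proof.
move=> df dfC.
have C0 : 0 <= C by apply: le_trans (dfC 0 _) => //; rewrite lexx ler01.
apply: row_norm_le => // j; rewrite !mxE.
have dg (t : R) : 0 <= t <= 1 ->
    is_derive t 1 (fun s : R => f (x + s *: v) 0 j) ('D_v f (x + t *: v) 0 j).
  move=> t01; have [dft <-] := derivable_line (df _ t01).
  rewrite derive_mx // mxE; apply: DeriveDef => //.
  by move/derivable_mxP : dft; apply.
have [|||c c01 /=] := @MVT R (fun s : R => f (x + s *: v) 0 j)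
    (fun t => 'D_v f (x + t *: v) 0 j) 0 1.
- exact: ltr01.
- by move=> t; rewrite in_itv/= => /andP[? ?]; apply: dg; rewrite !ltW.
- apply: derivable_within_continuous => t; rewrite in_itv/= => t01.
  by have [] := dg _ t01.
rewrite scale1r scale0r addr0 subr0 mulr1 => ->.
apply: le_trans (row_coord_le _ _) (dfC _ _).
by move: c01; rewrite in_itv/= => /andP[? ?]; rewrite !ltW.
Qed.

Lemma segment_norm_lt (R : realType) (V : normedModType R) (z0 z z' : V)
    (r t : R) : `|z - z0| < r -> `|z' - z0| < r -> 0 <= t <= 1 ->
  `|z + t *: (z' - z) - z0| < r.
Proof.
move=> zr z'r /andP[t0 t1].
have -> : z + t *: (z' - z) - z0 = (1 - t) *: (z - z0) + t *: (z' - z0).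
  have {1}-> : z' - z = (z' - z0) - (z - z0) by rewrite opprB addrA subrK.
  by rewrite [in LHS]scalerBr scalerBl scale1r addrAC -[RHS]addrA [- _ + _]addrC.
have M0 : 0 <= 1 - t by rewrite subr_ge0.
apply: le_lt_trans (ler_normD _ _) _; rewrite !normrZ !ger0_norm //.
have [->|tn0] := eqVneq t 0; first by rewrite subr0 mul1r mul0r addr0.
have tp : 0 < t by rewrite lt_neqAle eq_sym tn0.
rewrite (_ : r = (1 - t) * r + t * r); last by ring.
by rewrite ler_ltD // ?ltr_pM2l // ler_wpM2l // ltW.
Qed.

Lemma is_derive_translate (R : realType) (V W : normedModType R) (f : V -> W)
    (a x v : V) :
  derivable f (x - a) v ->
  is_derive x v (fun y => f (y - a)) ('D_v f (x - a)).
Proof.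
move=> df; have E : (fun h : R => h^-1 *: (f (h *: v + x - a) - f (x - a)))
   = (fun h => h^-1 *: (f (h *: v + (x - a)) - f (x - a))).
  by apply/funext => h; rewrite addrA.
apply: DeriveDef; first by rewrite /derivable /= E.
by rewrite /derive /= E.
Qed.

Section SmoothFinite.
Variables (R : realType) (V : normedModType R) (m k : nat).
Variables (b : 'I_k -> V) (c : 'I_k -> V -> R).
Hypothesis bc : forall v, v = \sum_i c i v *: b i.
Hypothesis c_le : forall i v, `|c i v| <= `|v|.
Implicit Types (f : V -> 'rV[R]_m) (v z : V).

(** The vectors [b i] span the space, with coordinates [c i]. Only the directional
    derivatives of a smooth map are known to be continuous, so that bounds on
    the differential have to be derived from finitely many directions. *)
Lemma linear_le_basis (g : {linear V -> 'rV[R]_m}) v (C : R) :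
  (forall i, `|g (b i)| <= C) -> `|g v| <= k%:R * C * `|v|.
Proof.
move=> gC; rewrite [v in g v]bc linear_sum /=.
apply: le_trans (ler_norm_sum _ _ _) _.
apply: (@le_trans _ _ (\sum_(i < k) `|v| * C)).
  by apply: ler_sum => i _; rewrite linearZ /= normrZ ler_pM.
rewrite sumr_const card_ord -mulr_natr.
by rewrite le_eqVlt; apply/orP; left; apply/eqP; ring.
Qed.

Lemma derive_le_basis f z v (C : R) : differentiable f z ->
  (forall i, `|'D_(b i) f z| <= C) -> `|'D_v f z| <= k%:R * C * `|v|.
Proof.
move=> df C1; rewrite deriveE //; apply: linear_le_basis => i.
by rewrite -deriveE.
Qed.

Lemma C1_lipschitz f z0 :
  (\forall z \near z0, differentiable f z) ->
  (forall v, {for z0, continuous (fun z => 'D_v f z)}) ->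
  exists2 L : R, 0 <= L & \forall r \near 0^'+,
    forall z z', `|z - z0| < r -> `|z' - z0| < r -> `|f z' - f z| <= L * `|z' - z|.
Proof.
move=> df cf.
pose S := \sum_i `|'D_(b i) f z0|.
pose C := S + 1.
have S0 : 0 <= S by apply: sumr_ge0.
have nb : \forall z \near z0, forall i, `|'D_(b i) f z| <= C.
  apply: (@filter_forall _ _ (fun i z => `|'D_(b i) f z| <= C) (nbhs z0)) => i.
  have /cvgrPdist_le /(_ _ ltr01) := cf (b i).
  apply: filterS => z; rewrite distrC => h.
  rewrite -[X in `|X|](subrK ('D_(b i) f z0)).
  apply: le_trans (ler_normD _ _) _; rewrite addrC lerD //.
  by rewrite /S (bigD1 i) //= lerDl; apply: sumr_ge0.
have : \forall z \near z0, differentiable f z /\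
   (forall i, `|'D_(b i) f z| <= C).
  by apply: filterS2 df nb.
move=> /nbhs_normP[r /= r0 rP0].
have rP z : `|z - z0| < r -> differentiable f z /\
   (forall i, `|'D_(b i) f z| <= C).
  by rewrite distrC; exact: rP0.
exists (k%:R * C); first by rewrite !mulr_ge0 // /C !addr_ge0.
near=> r' => z z' zr' z'r'.
have r'r : r' <= r by near: r'; exact: nbhs_right_le.
have zr := lt_le_trans zr' r'r; have z'r := lt_le_trans z'r' r'r.
have zE : z' = z + (z' - z) by rewrite addrC subrK.
rewrite [X in f X]zE; apply: mean_value_le => t t01.
  apply/diff_derivable.
  by have [] := rP _ (segment_norm_lt zr z'r t01).
have [dft C1] := rP _ (segment_norm_lt zr z'r t01).
exact: derive_le_basis.
Unshelve. all: by end_near. Qed.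

(** The difference of [f] and its translate by [a] has the derivative
    'D_v f z - 'D_v f (z - a), which is controlled by the Lipschitz constant of
    the derivative; then the mean value inequality applies. *)
Lemma C2_second_difference f z0 :
  (\forall z \near z0, differentiable f z) ->
  (forall v, \forall z \near z0, differentiable (fun z => 'D_v f z) z) ->
  (forall v w, {for z0, continuous (fun z => 'D_w (fun z => 'D_v f z) z)}) ->
  exists2 C : R, 0 <= C & \forall r \near 0^'+,
    forall p v a : V, `|p - z0| < r -> `|p + v - z0| < r ->
      `|p - a - z0| < r -> `|p + v - a - z0| < r ->
      `|f (p + v) - f p - (f (p + v - a) - f (p - a))| <= C * `|a| * `|v|.
Proof.
move=> df ddf cddf.
have [L L0 LP] : exists2 L : R, 0 <= L &
    \forall r \near 0^'+, forall i z z',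
    `|z - z0| < r -> `|z' - z0| < r ->
    `|'D_(b i) f z' - 'D_(b i) f z| <= L * `|z' - z|.
  have /choice[L LP] i : exists L : R, 0 <= L /\ \forall r \near 0^'+,
      forall z z', `|z - z0| < r -> `|z' - z0| < r ->
      `|'D_(b i) f z' - 'D_(b i) f z| <= L * `|z' - z|.
    by have [L L0 LP] := C1_lipschitz (ddf (b i)) (cddf (b i)); exists L.
  exists (\sum_i L i); first by apply: sumr_ge0 => i _; case: (LP i).
  apply: filter_forall => i; have [_] := LP i.
  apply: filterS => r h z z' zr z'r; apply: le_trans (h _ _ zr z'r) _.
  rewrite ler_wpM2r // (bigD1 i) //= lerDl.
  by apply: sumr_ge0 => j _; case: (LP j).
exists (k%:R * L); first by rewrite mulr_ge0.
move: df => /nbhs_normP[r0 /= r00 rP0].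
near=> r => p v a h1 h2 h3 h4.
have LPr : forall i z z', `|z - z0| < r -> `|z' - z0| < r ->
    `|'D_(b i) f z' - 'D_(b i) f z| <= L * `|z' - z| by near: r.
have rr0 : r <= r0 by near: r; exact: nbhs_right_le.
have dfr z : `|z - z0| < r -> differentiable f z.
  by move=> zr; apply: rP0; rewrite /= distrC (lt_le_trans zr).
have q1 (t : R) : 0 <= t <= 1 -> `|p + t *: v - z0| < r.
  by move=> t01; have := segment_norm_lt h1 h2 t01; rewrite [p + v]addrC addrK.
have q2 (t : R) : 0 <= t <= 1 -> `|p + t *: v - a - z0| < r.
  move=> t01; have := segment_norm_lt h3 h4 t01.
  by rewrite [p + v]addrC -[v + p - a]addrA addrK [p - a + _]addrAC.
have dg (t : R) : 0 <= t <= 1 -> is_derive (p + t *: v) v (fun z => f z - f (z - a))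
   ('D_v f (p + t *: v) - 'D_v f (p + t *: v - a)).
  move=> t01; apply: is_deriveB.
    by apply/derivableP/diff_derivable/dfr/q1.
  by apply/is_derive_translate/diff_derivable/dfr/q2.
have -> : f (p + v) - f p - (f (p + v - a) - f (p - a))
    = (f (p + v) - f (p + v - a)) - (f p - f (p - a)).
  by rewrite !opprB addrACA [- f p + _]addrC -addrACA.
apply: (@mean_value_le R m _ (fun z => f z - f (z - a))) => t t01.
  by have [] := dg _ t01.
rewrite (@derive_val _ _ _ _ _ _ _ (dg _ t01)).
have D1 := dfr _ (q1 _ t01); have D2 := dfr _ (q2 _ t01).
rewrite !deriveE //.
pose g : {linear V -> 'rV[R]_m} :=
  'd f (p + t *: v) \- 'd f (p + t *: v - a).
rewrite -[X in `|X|]/(g v).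
apply: le_trans (@linear_le_basis g v (L * `|a|) _) _; last by rewrite mulrA.
move=> i; rewrite /g /= -!deriveE //.
have {2}-> : a = (p + t *: v) - (p + t *: v - a) by rewrite opprB addrC subrK.
by apply: LPr; [exact: q2|exact: q1].
Unshelve. all: by end_near. Qed.

End SmoothFinite.

(** * The product of a Lie group in a chart *)

Section PairBasis.
Variables (R : realType) (n : nat).

Definition pair_basis (i : 'I_(n + n)) : 'rV[R]_n * 'rV[R]_n :=
  match fintype.split i with
  | inl j => (delta_mx 0 j, 0)
  | inr j => (0, delta_mx 0 j)
  end.

Definition pair_coord (i : 'I_(n + n)) (z : 'rV[R]_n * 'rV[R]_n) : R :=
  match fintype.split i with inl j => z.1 0 j | inr j => z.2 0 j end.

Lemma pair_basisE z : z = \sum_i pair_coord i z *: pair_basis i.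
Proof.
have E1 (I : finType) (a : I -> R) (b : I -> 'rV[R]_n * 'rV[R]_n) :
    (\sum_i a i *: b i) = (\sum_i a i *: (b i).1, \sum_i a i *: (b i).2).
  by elim/big_ind3 : _ => // ? ? ? ? ? ? -> ->.
rewrite E1 !big_split_ord /= /pair_coord /pair_basis.
have sl j : fintype.split (lshift n j) = inl j :> 'I_n + 'I_n by exact: (unsplitK (inl j)).
have sr j : fintype.split (rshift n j) = inr j :> 'I_n + 'I_n by exact: (unsplitK (inr j)).
under eq_bigr do rewrite sl.
under [X in _ + X]eq_bigr do rewrite sr /= scaler0.
under [X in (_, X + _)]eq_bigr do rewrite sl /= scaler0.
under [X in (_, _ + X)]eq_bigr do rewrite sr.
by rewrite /= !big1_eq add0r addr0 -!row_sum_delta; case: z.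
Qed.

Lemma pair_coord_le i z : `|pair_coord i z| <= `|z|.
Proof.
rewrite /pair_coord [leRHS]prod_normE.
by case: fintype.split => j; rewrite le_max row_coord_le ?orbT.
Qed.

End PairBasis.

Section LocalProduct.
Variables (R : realType) (n : nat) (G : groupTopologicalType).
Variables (A : set (chart G 'rV[R]_n)) (e : chart G 'rV[R]_n).
Hypotheses (hG : lie_group A) (Ae : A e) (e1 : chart_dom e 1%g).

(** The chart is translated so that the identity has the coordinate 0. *)
Definition lchart (g : G) : 'rV[R]_n := e g - e 1%g.
Definition lparam (x : 'rV[R]_n) : G := chart_inv e (x + e 1%g).
Definition lmul (x y : 'rV[R]_n) := lchart (lparam x * lparam y)%g.

Lemma lie_chart : is_chart e.
Proof. by case: hG => _ _ [+ _ _] _ _; apply. Qed.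

Lemma lie_mul_continuous : continuous (fun p : G * G => (p.1 * p.2)%g).
Proof. by case: hG => _ _ _ []. Qed.

Lemma lie_inv_continuous : continuous (fun p : G => p^-1%g).
Proof. by case: hG => _ _ _ _ []. Qed.

Lemma lparam0 : lparam 0 = 1%g.
Proof. by have [_ _ h _ _] := lie_chart; rewrite /lparam add0r h. Qed.

Lemma lchart1 : lchart 1%g = 0. Proof. exact: subrr. Qed.

Lemma lchartK g : chart_dom e g -> lparam (lchart g) = g.
Proof. by have [_ _ h _ _] := lie_chart; rewrite /lparam /lchart subrK; exact: h. Qed.

Lemma near_chart_cod : \forall x \near (0 : 'rV[R]_n), chart_cod e (x + e 1%g).
Proof.
have [od oc K cf ci] := lie_chart.
apply/(nbhsDl (chart_cod e) 0 (e 1%g)); rewrite add0r.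
by apply: open_nbhs_nbhs; split => //; exists 1%g.
Qed.

Lemma chart_codE x : chart_cod e (x + e 1%g) ->
  [/\ chart_dom e (lparam x), lchart (lparam x) = x & {for x, continuous lparam}].
Proof.
have [od oc K cf ci] := lie_chart.
move=> /= cx; split.
- by case: cx => g dg eg; rewrite /lparam -eg K.
- by case: cx => g dg eg; rewrite /lparam /lchart -eg K // eg addrK.
- have : {for x, continuous (chart_inv e \o (fun x => x + e 1%g))}; last by [].
  apply: continuous_comp; last exact: ci.
  by apply: (@cvgD _ _ _ (nbhs x) _ id (cst (e 1%g))); [exact: cvg_id|exact: cvg_cst].
Qed.

Lemma lchart_continuous : {for 1%g, continuous lchart}.
Proof.
have [od oc K cf ci] := lie_chart.
by apply: (@cvgB _ _ _ (nbhs (1%g : G)) _ e (cst (e 1%g))); [exact: cf|exact: cvg_cst].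
Qed.

Lemma near_lchart : \forall g \near (1%g : G), chart_dom e g.
Proof. by have [od oc K cf ci] := lie_chart; apply: open_nbhs_nbhs. Qed.

Lemma near_lmul : \forall z \near (0 : 'rV[R]_n, 0 : 'rV[R]_n),
  chart_dom e (lparam z.1 * lparam z.2)%g.
Proof.
have [_ _ c0] := chart_codE (nbhs_singleton near_chart_cod).
have : {for (0 : 'rV[R]_n, 0 : 'rV[R]_n), continuous (fun z => lparam z.1 * lparam z.2)%g}.
  apply: (@continuous_comp _ _ _ (fun z : _ * _ => (lparam z.1, lparam z.2))
    (fun p : G * G => (p.1 * p.2)%g)); last exact: lie_mul_continuous.
  apply: cvg_pair => /=.
    by apply: (@cvg_comp _ _ _ fst lparam _ _ _ _ c0); exact: cvg_fst.
  by apply: (@cvg_comp _ _ _ snd lparam _ _ _ _ c0); exact: cvg_snd.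
move=> /(_ (chart_dom e)); apply => /=.
by rewrite lparam0 mulg1; exact: near_lchart.
Qed.

(** Taking a point of one axis and an increment along the other one turns this
    estimate into the bounds for m(x, y) - m(x, z) - (y - z) from which the
    exponential map is constructed. *)
Lemma lmul_second_difference : exists2 C : R, 0 <= C & \forall r \near 0^'+,
    forall p v a : 'rV[R]_n * 'rV[R]_n,
      `|p| < r -> `|p + v| < r -> `|p - a| < r -> `|p + v - a| < r ->
      `|lmul (p + v).1 (p + v).2 - lmul p.1 p.2
        - (lmul (p + v - a).1 (p + v - a).2 - lmul (p - a).1 (p - a).2)|
      <= C * `|a| * `|v|.
Proof.
pose z0 := (e 1%g, e 1%g).
pose M (z : 'rV[R]_n * 'rV[R]_n) := e (chart_inv e z.1 * chart_inv e z.2)%g.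
pose W := prod_chart e e @` (chart_dom (prod_chart e e) `&`
  (fun p : G * G => (p.1 * p.2)%g) @^-1` chart_dom e).
have [od oc K cf ci] := lie_chart.
have nW : \forall z \near z0, W z.
  have n1 : \forall z \near (0 : 'rV[R]_n, 0 : 'rV[R]_n),
      chart_cod e (z.1 + e 1%g) /\ chart_cod e (z.2 + e 1%g).
    exists ([set x | chart_cod e (x + e 1%g)], [set x | chart_cod e (x + e 1%g)]) => /=.
      by split; exact: near_chart_cod.
    by move=> [x y] [].
  have n2 : \forall z \near (0 : 'rV[R]_n * 'rV[R]_n), W (z + z0).
    apply: filterS2 n1 near_lmul => -[x y] /= [cx cy] xy.
    have [dx lx _] := chart_codE cx; have [dy ly _] := chart_codE cy.
    exists (lparam x, lparam y) => //=.
    rewrite /lchart in lx ly.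
    by congr (_, _); [rewrite -[in RHS]lx subrK|rewrite -[in RHS]ly subrK].
  by move: n2 => /(nbhsDl W 0 z0); rewrite add0r.
have sM : smooth_on W M.
  case: hG => _ _ _ [_ /(_ (prod_chart e e) e)] + _; apply => //.
  by exists e => //; exists e.
have [C C0 CP] := @C2_second_difference R _ n (n + n) (@pair_basis R n)
  (@pair_coord R n) (@pair_basisE R n) (@pair_coord_le R n) M z0
  (filterS (fun z Wz => (sM 1%N).1 z Wz) nW)
  (fun v => filterS (fun z Wz => ((sM 2%N).2 v).1 z Wz) nW)
  (fun v w => ((sM 2%N).2 v).2 w z0 (nbhs_singleton nW)).
exists C => //; apply: filterS CP => r rP p v a h1 h2 h3 h4.
have := rP (p + z0) v a.
rewrite [p + z0 + v]addrAC ![_ + z0 - a]addrAC !addrK => /(_ h1 h2 h3 h4).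
have lmulE z : lmul z.1 z.2 = M (z + z0) - e 1%g by [].
rewrite !lmulE.
by rewrite !opprB !addrA !subrK.
Qed.

End LocalProduct.

(** * The exponential map of a local group *)

Lemma cvg_norm_le (R : realType) (W : normedModType R) (u : nat -> W) (l : W)
    (c : R) : u @ \oo --> l -> (\forall k \near \oo, `|u k| <= c) -> `|l| <= c.
Proof.
move=> /cvgrPdist_le ul uc; apply/ler_addgt0Pr => eps eps0; near \oo => k.
rewrite -[l](subrK (u k)); apply: le_trans (ler_normD _ _) _.
rewrite addrC lerD //; first by near: k.
by near: k; exact: ul.
Unshelve. all: by end_near. Qed.

(** [psi] parametrizes a neighbourhood of the identity, and [phi] is its inverse.
    The last two fields say that left and right translations by a small element
    differ from the identity by a map whose Lipschitz constant is proportional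
    to the size of the element. This is all that is used of the
    smoothness of the product. *)
Record local_group (R : realType) (n : nat) (G : groupTopologicalType)
    (psi : 'rV[R]_n -> G) (phi : G -> 'rV[R]_n) (C rho : R) : Prop := LocalGroup {
  lg_C_ge0 : 0 <= C;
  lg_rho_gt0 : 0 < rho;
  lg_psi0 : psi 0 = 1%g;
  lg_psiK : forall x, `|x| < rho -> phi (psi x) = x;
  lg_psi_continuous : forall x : 'rV[R]_n, `|x| < rho -> {for x, continuous psi};
  lg_psiM : forall x y, `|x| < rho -> `|y| < rho ->
    psi (phi (psi x * psi y)%g) = (psi x * psi y)%g;
  lg_diff_right : forall x y z, `|x| < rho -> `|y| < rho -> `|z| < rho ->
    `|phi (psi x * psi y)%g - phi (psi x * psi z)%g - (y - z)|
      <= C * `|x| * `|y - z|;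
  lg_diff_left : forall x y z, `|x| < rho -> `|y| < rho -> `|z| < rho ->
    `|phi (psi y * psi x)%g - phi (psi z * psi x)%g - (y - z)|
      <= C * `|x| * `|y - z|
}.

Section LocalGroup.
Variables (R : realType) (n : nat) (G : groupTopologicalType).
Let E := 'rV[R]_n.
Variables (psi : E -> G) (phi : G -> E) (C rho : R).
Hypothesis H : local_group psi phi C rho.
Let m (x y : E) : E := phi (psi x * psi y)%g.
Let C0 := lg_C_ge0 H.
Let rho0 := lg_rho_gt0 H.
Let psi1 := lg_psi0 H.
Let psiK := lg_psiK H.
Let psi_cont := lg_psi_continuous H.
Let psiM x y : `|x| < rho -> `|y| < rho ->
  psi (m x y) = (psi x * psi y)%g.
Proof. exact: lg_psiM H _ _. Qed.
Let mR x y z : `|x| < rho -> `|y| < rho -> `|z| < rho ->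
  `|m x y - m x z - (y - z)| <= C * `|x| * `|y - z|.
Proof. exact: lg_diff_right H _ _ _. Qed.
Let mL x y z : `|x| < rho -> `|y| < rho -> `|z| < rho ->
  `|m y x - m z x - (y - z)| <= C * `|x| * `|y - z|.
Proof. exact: lg_diff_left H _ _ _. Qed.

(** The factor 1/16 keeps the powers, which may be twice as large as expected, in
    the domain of the chart, and makes the error terms, of relative size [C s],
    small enough to be absorbed. *)
Definition lg_radius : R := Num.min rho (C + 1)^-1 / 16.
Let s := lg_radius.

Lemma lg_radius_gt0 : 0 < s.
Proof. by rewrite divr_gt0 // lt_min rho0 invr_gt0 ltr_wpDl. Qed.

Lemma lg_radius_rho : 16 * s <= rho.
Proof. by rewrite mulrC divfK // ge_min lexx. Qed.

Lemma lg_radius_C : C * s <= 16^-1.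
Proof.
rewrite mulrA ler_piMl ?invr_ge0 //.
have C1 : 0 < C + 1 by rewrite ltr_wpDl.
apply: (@le_trans _ _ (C * (C + 1)^-1)).
  by rewrite ler_wpM2l // ge_min lexx orbT.
by rewrite ler_pdivrMr // mul1r lerDl.
Qed.

Lemma local_mulr0 x : `|x| < rho -> m x 0 = x.
Proof. by move=> xr; rewrite /m psi1 mulg1 psiK. Qed.

Lemma local_mul_le x y : `|x| < rho -> `|y| < rho -> `|m x y - x - y| <= C * `|x| * `|y|.
Proof.
move=> xr yr; have := @mR x y 0 xr yr _; rewrite normr0 subr0 local_mulr0 //.
exact.
Qed.

Lemma local_mul_strict a b a' b' : `|a| < rho -> `|b| < rho -> `|a'| < rho -> `|b'| < rho ->
  `|(m a b - a - b) - (m a' b' - a' - b')|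
    <= C * `|b| * `|a - a'| + C * `|a'| * `|b - b'|.
Proof.
move=> ar br a'r b'r.
have -> : (m a b - a - b) - (m a' b' - a' - b')
   = (m a b - m a' b - (a - a')) + (m a' b - m a' b' - (b - b')).
  apply/rowP => j; rewrite !mxE; ring.
apply: le_trans (ler_normD _ _) _; apply: lerD; first exact: mL.
exact: mR.
Qed.

Fixpoint local_power (x : E) (k : nat) : E := if k is k'.+1 then m (local_power x k') x else 0.

Lemma natrS_norm (x : E) k : k.+1%:R * `|x| = k%:R * `|x| + `|x|.
Proof. by rewrite -natr1 mulrDl mul1r. Qed.

(** One more multiplication by [x] adds an error of at most [C |a| |x|], where
    [a] is the current power; these errors sum up to a quadratic one. *)
Lemma local_power_le x k : k%:R * `|x| <= s ->
  `|local_power x k - k%:R *: x| <= C * (k%:R * `|x|) ^+ 2 /\ `|local_power x k| <= 2 * (k%:R * `|x|).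
Proof.
have s0 := lg_radius_gt0; have sr := lg_radius_rho; have sC := lg_radius_C.
elim: k => [|k IH] /= kx.
  by rewrite scale0r subr0 normr0 mul0r expr0n /= !mulr0 lexx.
have x0 := normr_ge0 x.
have k0 : 0 <= k%:R * `|x| by rewrite mulr_ge0.
have kx' : k%:R * `|x| + `|x| <= s by rewrite -natrS_norm.
have [IH1 IH2] := IH ltac:(lra).
have ar : `|local_power x k| < rho by lra.
have xr : `|x| < rho by lra.
have := local_mul_le ar xr.
set a := local_power x k in IH1 IH2 ar *; set u := k%:R * `|x| in IH1 IH2 k0 kx' *.
move=> h.
have h1 : `|m a x - k.+1%:R *: x| <= C * (k.+1%:R * `|x|) ^+ 2.
  have -> : m a x - k.+1%:R *: x = (m a x - a - x) + (a - k%:R *: x).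
    rewrite -natr1 scalerDl scale1r.
    by apply/rowP => j; rewrite !mxE; ring.
  apply: le_trans (ler_normD _ _) _; rewrite natrS_norm -/u.
  apply: le_trans (lerD h IH1) _.
  have : C * `|a| * `|x| <= C * (2 * u) * `|x| by rewrite ler_wpM2r // ler_wpM2l.
  have : 0 <= C * `|x| ^+ 2 by rewrite mulr_ge0 // exprn_ge0.
  by nra.
split => //.
rewrite -[m a x](subrK (k.+1%:R *: x)).
apply: le_trans (ler_normD _ _) _.
rewrite normrZ ger0_norm //.
have : C * (k.+1%:R * `|x|) ^+ 2 <= k.+1%:R * `|x|.
  rewrite natrS_norm -/u expr2 mulrA ler_piMl //; first by lra.
  have : C * (u + `|x|) <= C * s by rewrite ler_wpM2l.
  by lra.
by lra.
Qed.

Lemma local_power_lt x k : k%:R * `|x| <= s -> `|local_power x k| < rho.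
Proof.
have s0 := lg_radius_gt0; have sr := lg_radius_rho.
by move=> kx; have [_] := local_power_le kx; lra.
Qed.

Lemma psi_local_power x k : k%:R * `|x| <= s -> psi (local_power x k) = (psi x ^+ k)%g.
Proof.
have s0 := lg_radius_gt0; have sr := lg_radius_rho.
elim: k => [|k IH] /= kx; first by rewrite expg0 psi1.
have x0 := normr_ge0 x.
have k0 : 0 <= k%:R * `|x| by rewrite mulr_ge0.
have kx' : k%:R * `|x| + `|x| <= s by rewrite -natrS_norm.
rewrite psiM; last by lra.
  by rewrite IH ?expgSr //; lra.
by apply: local_power_lt; lra.
Qed.

(** The same summation for two sequences of powers at once. Passing to the limit,
    it yields strict differentiability of the exponential. *)
Lemma local_power_strict x y k : k%:R * `|x| <= s -> k%:R * `|y| <= s ->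
  `|local_power x k - local_power y k - k%:R *: (x - y)|
    <= C * k%:R * (k%:R * `|x| + k%:R * `|y|) * `|x - y| /\
  `|local_power x k - local_power y k| <= 2 * (k%:R * `|x - y|).
Proof.
have s0 := lg_radius_gt0; have sr := lg_radius_rho; have sC := lg_radius_C.
elim: k => [|k IH] /= kx ky.
  by rewrite subr0 scale0r subr0 normr0 !mul0r !mulr0 mul0r.
have x0 := normr_ge0 x; have y0 := normr_ge0 y; have xy0 := normr_ge0 (x - y).
have k0 : 0 <= k%:R * `|x| by rewrite mulr_ge0.
have k1 : 0 <= k%:R * `|y| by rewrite mulr_ge0.
have k2 : 0 <= k%:R * `|x - y| by rewrite mulr_ge0.
have kx' : k%:R * `|x| + `|x| <= s by rewrite -natrS_norm.
have ky' : k%:R * `|y| + `|y| <= s by rewrite -natrS_norm.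
have [IH1 IH2] := IH ltac:(lra) ltac:(lra).
have kxs : k%:R * `|x| <= s by lra.
have kys : k%:R * `|y| <= s by lra.
have ax := local_power_lt kxs; have ay := local_power_lt kys.
have [_ ay2] := local_power_le kys.
have xr : `|x| < rho by lra.
have yr : `|y| < rho by lra.
have := local_mul_strict ax xr ay yr.
set a := local_power x k in IH1 IH2 ax *; set a' := local_power y k in IH1 IH2 ay ay2 *.
move=> h.
have h1 : `|m a x - m a' y - k.+1%:R *: (x - y)|
    <= C * k.+1%:R * (k.+1%:R * `|x| + k.+1%:R * `|y|) * `|x - y|.
  have -> : m a x - m a' y - k.+1%:R *: (x - y) =
     (m a x - a - x - (m a' y - a' - y)) + (a - a' - k%:R *: (x - y)).
    rewrite -natr1 scalerDl scale1r.
    by apply/rowP => j; rewrite !mxE; ring.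
  apply: le_trans (ler_normD _ _) _.
  apply: le_trans (lerD h IH1) _.
  have e1 : C * `|x| * `|a - a'| <= C * `|x| * (2 * (k%:R * `|x - y|)).
    by rewrite ler_wpM2l // mulr_ge0.
  have e2 : C * `|a'| * `|x - y| <= C * (2 * (k%:R * `|y|)) * `|x - y|.
    by rewrite ler_wpM2r // ler_wpM2l.
  apply: le_trans (lerD (lerD e1 e2) (lexx _)) _.
  rewrite -!natr1.
  have e3 : 0 <= C * (`|x| + `|y|) * `|x - y| by rewrite !mulr_ge0 // addr_ge0.
  by lra.
split => //.
rewrite -[m a x - m a' y](subrK (k.+1%:R *: (x - y))).
apply: le_trans (ler_normD _ _) _.
rewrite normrZ [`|k.+1%:R|]ger0_norm //.
suff : C * k.+1%:R * (k.+1%:R * `|x| + k.+1%:R * `|y|) * `|x - y|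
    <= k.+1%:R * `|x - y| by lra.
have h4 : C * (k%:R * `|x| + `|x| + (k%:R * `|y| + `|y|)) <= C * (s + s).
  by rewrite ler_wpM2l // lerD.
have h5 : C * (k.+1%:R * `|x| + k.+1%:R * `|y|) * (k.+1%:R * `|x - y|)
    <= 1 * (k.+1%:R * `|x - y|).
  by rewrite ler_wpM2r // ?mulr_ge0 // !natrS_norm; lra.
by lra.
Qed.

Lemma local_powerM x j k : 2 * (j%:R * k%:R * `|x|) <= s ->
  local_power x (j * k) = local_power (local_power x j) k.
Proof.
have s0 := lg_radius_gt0.
move=> h; have x0 := normr_ge0 x.
have jk0 : 0 <= j%:R * k%:R * `|x| by rewrite !mulr_ge0.
have [->|k0] := posnP k; first by rewrite muln0.
have jx : j%:R * `|x| <= s.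
  apply: (@le_trans _ _ (j%:R * k%:R * `|x|)); last by lra.
  rewrite ler_wpM2r // ler_peMr //.
  by rewrite ler1n.
have [_ pj] := local_power_le jx.
have h2 : k%:R * `|local_power x j| <= s.
  apply: le_trans h.
  have : k%:R * `|local_power x j| <= k%:R * (2 * (j%:R * `|x|)) by rewrite ler_wpM2l.
  by lra.
have h3 : (j * k)%:R * `|x| <= s by rewrite natrM; lra.
rewrite -(psiK (local_power_lt h3)) -(psiK (local_power_lt h2)).
by rewrite !psi_local_power // expgnA.
Qed.

Definition exp_approx (Z : E) (k : nat) : E := local_power (k.+1%:R^-1 *: Z) k.+1.

Definition local_exp (Z : E) : E := lim (exp_approx Z @ \oo).

Lemma scale_invn (Z : E) k : k.+1%:R * `|k.+1%:R^-1 *: Z| = `|Z|.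
Proof. by rewrite normrZ ger0_norm ?invr_ge0 // mulVKf. Qed.

(** Both terms are [k.+1]-th powers, one of the [j.+1]-th power of
    Z / ((j+1)(k+1)) and the other of Z / (k+1); these bases differ by a
    quadratic error, of order 1 / (k+1)^2. *)
Lemma exp_approx_refine Z j k : 2 * `|Z| <= s ->
  `|local_power ((j.+1 * k.+1)%:R^-1 *: Z) (j.+1 * k.+1) - exp_approx Z k| <= `|Z| * k.+1%:R^-1.
Proof.
have s0 := lg_radius_gt0; have sC := lg_radius_C.
move=> Zs; have Z0 := normr_ge0 Z.
set x := _ *: Z.
have jk0 : (j.+1 * k.+1)%:R != 0 :> R by rewrite pnatr_eq0.
have kx : k.+1%:R *: (j.+1%:R *: x) = Z.
  by rewrite scalerA -natrM mulnC scalerA divff // scale1r.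
have jx : j.+1%:R *: x = k.+1%:R^-1 *: Z.
  by rewrite -[in RHS]kx [RHS]scalerA mulVf ?pnatr_eq0 // scale1r.
have nx : j.+1%:R * k.+1%:R * `|x| = `|Z|.
  by rewrite -natrM normrZ ger0_norm ?invr_ge0 // mulVKf.
have jx' : j.+1%:R * `|x| = k.+1%:R^-1 * `|Z|.
  by rewrite -[X in X * `|x|]ger0_norm // -normrZ jx normrZ ger0_norm ?invr_ge0.
have k1 : k.+1%:R^-1 <= 1 :> R by rewrite invf_le1 // ler1n.
have ki0 : 0 <= k.+1%:R^-1 :> R by rewrite invr_ge0.
have jxs : j.+1%:R * `|x| <= s.
  rewrite jx'; apply: (@le_trans _ _ `|Z|); last by lra.
  by rewrite ler_piMl.
rewrite local_powerM ?nx // /exp_approx -jx.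
have [h1 h2] := local_power_le jxs.
have nx2 : k.+1%:R * `|j.+1%:R *: x| = `|Z| by rewrite jx scale_invn.
have nx3 : k.+1%:R * `|local_power x j.+1| <= 2 * `|Z|.
  rewrite -nx; have : k.+1%:R * `|local_power x j.+1| <= k.+1%:R * (2 * (j.+1%:R * `|x|)).
    by rewrite ler_wpM2l.
  by lra.
have [|_ h3] := @local_power_strict (local_power x j.+1) (j.+1%:R *: x) k.+1 (le_trans nx3 Zs).
  by rewrite nx2; lra.
apply: le_trans h3 _.
have : k.+1%:R * `|local_power x j.+1 - j.+1%:R *: x| <= k.+1%:R * (C * (j.+1%:R * `|x|) ^+ 2).
  by rewrite ler_wpM2l.
have -> : k.+1%:R * (C * (j.+1%:R * `|x|) ^+ 2)
    = (k.+1%:R * k.+1%:R^-1) * (C * `|Z|) * (`|Z| * k.+1%:R^-1).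
  by rewrite jx'; ring.
rewrite divff ?pnatr_eq0 // mul1r => h4.
have : C * `|Z| * (`|Z| * k.+1%:R^-1) <= 16^-1 * (`|Z| * k.+1%:R^-1).
  rewrite ler_wpM2r ?mulr_ge0 //; apply: le_trans sC.
  by rewrite ler_wpM2l //; lra.
have := mulr_ge0 Z0 ki0.
move: h4; set t := `|Z| * k.+1%:R^-1; set v := k.+1%:R * `|_|.
by move=> ? ? ?; lra.
Qed.

Lemma exp_approx_dist Z j k : 2 * `|Z| <= s ->
  `|exp_approx Z j - exp_approx Z k| <= `|Z| * j.+1%:R^-1 + `|Z| * k.+1%:R^-1.
Proof.
move=> Zs; have h1 := exp_approx_refine j k Zs; have h2 := exp_approx_refine k j Zs.
rewrite mulnC in h2; rewrite distrC in h2.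
apply: le_trans (ler_distD (local_power ((j.+1 * k.+1)%:R^-1 *: Z) (j.+1 * k.+1)) _ _) _.
exact: lerD.
Qed.

Lemma near_harmonic (K eps : R) : 0 < eps -> \forall k \near \oo, K * k.+1%:R^-1 <= eps.
Proof.
move=> e0; have : (fun k => K * harmonic k) @ \oo --> K * 0.
  by apply: cvgMl_tmp; exact: cvg_harmonic.
rewrite mulr0 => /cvgrPdist_le /(_ _ e0); apply: filterS => k.
by rewrite sub0r normrN => h; apply: le_trans (ler_norm _) h.
Qed.

Lemma exp_approx_cvg Z : 2 * `|Z| <= s -> exp_approx Z @ \oo --> local_exp Z.
Proof.
move=> Zs; apply: cauchy_cvg; apply: cauchy_exP => eps eps0.
have e4 : 0 < eps / 4 by rewrite divr_gt0.
near \oo => k; exists (exp_approx Z k).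
have h1 : `|Z| * k.+1%:R^-1 <= eps / 4 by near: k; exact: near_harmonic.
suff : \forall j \near \oo, ball (exp_approx Z k) eps (exp_approx Z j) by [].
apply: filterS (near_harmonic `|Z| e4) => j h2.
rewrite -ball_normE /ball_ /=.
apply: (le_lt_trans (@exp_approx_dist Z k j Zs)).
by apply: le_lt_trans (lerD h1 h2) _; lra.
Unshelve. all: by end_near. Qed.

Lemma local_exp_strict Z Z' : 2 * `|Z| <= s -> 2 * `|Z'| <= s ->
  `|local_exp Z - local_exp Z' - (Z - Z')| <= C * (`|Z| + `|Z'|) * `|Z - Z'|.
Proof.
have s0 := lg_radius_gt0; have Z0 := normr_ge0 Z; have Z'0 := normr_ge0 Z'.
move=> Zs Z's; apply: (@cvg_norm_le _ _ (fun k => exp_approx Z k - exp_approx Z' k - (Z - Z'))).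
  by apply: cvgB; [apply: cvgB; exact: exp_approx_cvg|exact: cvg_cst].
apply: nearW => k.
have [||+ _] := @local_power_strict (k.+1%:R^-1 *: Z) (k.+1%:R^-1 *: Z') k.+1.
- by rewrite scale_invn; lra.
- by rewrite scale_invn; lra.
rewrite !scale_invn -!scalerBr scalerA divff ?pnatr_eq0 // scale1r => h.
apply: le_trans h _; rewrite normrZ ger0_norm ?invr_ge0 // mulrA.
rewrite [X in X * `|Z - Z'|](_ : _ = C * (`|Z| + `|Z'|)) //.
by rewrite mulrAC -[C * _ * _]mulrA divff ?pnatr_eq0 // mulr1.
Qed.

Lemma local_exp0 : local_exp 0 = 0.
Proof.
suff pw0 k : local_power 0 k = 0.
  rewrite /local_exp (_ : exp_approx 0 = cst 0) ?lim_cst //.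
  by apply/funext => k; rewrite /exp_approx scaler0 pw0.
elim: k => //= k ->; rewrite local_mulr0 ?normr0 //.
Qed.

Lemma local_exp_le Z : 2 * `|Z| <= s -> `|local_exp Z| <= 2 * `|Z|.
Proof.
have s0 := lg_radius_gt0; have sC := lg_radius_C; have Z0 := normr_ge0 Z.
move=> Zs; have := @local_exp_strict Z 0 Zs; rewrite local_exp0 normr0 addr0 !subr0 mulr0.
move=> /(_ (ltW s0)) h.
have : C * `|Z| * `|Z| <= 1 * `|Z|.
  rewrite ler_wpM2r //; have : C * `|Z| <= C * s by rewrite ler_wpM2l //; lra.
  by lra.
have : `|local_exp Z| <= `|local_exp Z - Z| + `|Z| by rewrite -{1}[local_exp Z](subrK Z) ler_normD.
by lra.
Qed.

Lemma local_exp_lt Z : 2 * `|Z| <= s -> `|local_exp Z| < rho.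
Proof.
have s0 := lg_radius_gt0; have sr := lg_radius_rho.
by move=> Zs; have := local_exp_le Zs; lra.
Qed.

(** A homomorphism maps the powers of [u k] = Z / (k+1) to powers of [D (u k)],
    which is W / (k+1) up to a smaller error; pass to the limit. Here [W] is the
    derivative of [D] at 0 in the direction [Z]. *)
Lemma local_exp_morphism (f : G -> G) (D : E -> E) (Z W : 'rV[R]_n) :
  hausdorff_space G ->
  (forall g h, f (g * h)%g = (f g * f h)%g) -> continuous f ->
  (\forall x \near (0 : 'rV[R]_n), psi (D x) = f (psi x)) ->
  (fun k => k.+1%:R *: D (k.+1%:R^-1 *: Z)) @ \oo --> W ->
  2 * `|Z| <= s -> 4 * `|W| <= s ->
  f (psi (local_exp Z)) = psi (local_exp W).
Proof.
have s0 := lg_radius_gt0; have Z0 := normr_ge0 Z; have W0 := normr_ge0 W.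
move=> hG fM fc fD DW Zs Ws.
have f1 : f 1%g = 1%g by apply: (mulgI (f 1%g)); rewrite -fM !mulg1.
have fX g k : f (g ^+ k)%g = (f g ^+ k)%g.
  by elim: k => [|k IH]; rewrite ?expg0 // !expgS fM IH.
pose u k := k.+1%:R^-1 *: Z.
have u0 : u @ \oo --> (0 : 'rV[R]_n).
  rewrite -[X in _ --> X](scale0r Z); apply: cvgZr_tmp; exact: cvg_harmonic.
have c1 : (fun k => f (psi (exp_approx Z k))) @ \oo --> f (psi (local_exp Z)).
  apply: (@cvg_comp _ _ _ (fun k => psi (exp_approx Z k)) f _ (nbhs (psi (local_exp Z)))); last exact: fc.
  apply: (@cvg_comp _ _ _ (exp_approx Z) psi _ (nbhs (local_exp Z))); first exact: exp_approx_cvg.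
  by apply: psi_cont; exact: local_exp_lt.
have Wd : \forall k \near \oo, k.+1%:R * `|D (u k)| <= s.
  have s4 : 0 < s / 4 by rewrite divr_gt0.
  move/cvgrPdist_le : DW => /(_ _ s4); apply: filterS => k h.
  rewrite -[X in X * _]ger0_norm // -normrZ -[X in `|X|](subrK W).
  by apply: le_trans (ler_normD _ _) _; rewrite distrC; lra.
have c2 : (fun k => psi (local_power (D (u k)) k.+1)) @ \oo --> psi (local_exp W).
  apply: (@cvg_comp _ _ _ (fun k => local_power (D (u k)) k.+1) psi _ (nbhs (local_exp W))); last first.
    by apply: psi_cont; apply: local_exp_lt; lra.
  have c3 : (fun k => local_power (D (u k)) k.+1 - exp_approx W k) @ \oo --> (0 : 'rV[R]_n).
    apply/cvgrPdist_le => eps eps0.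
    have e2 : 0 < eps / 2 by rewrite divr_gt0.
    move/cvgrPdist_le : DW => /(_ _ e2); apply: filterS2 Wd => k h1 h2.
    rewrite sub0r normrN.
    have [|_ h3] := @local_power_strict (D (u k)) (k.+1%:R^-1 *: W) k.+1 h1.
      by rewrite scale_invn; lra.
    apply: le_trans h3 _; rewrite -[X in X * `|_|]ger0_norm // -normrZ scalerBr.
    rewrite scalerA divff ?pnatr_eq0 // scale1r distrC.
    by rewrite -/(u k) in h2; lra.
  have pW : exp_approx W @ \oo --> local_exp W by apply: exp_approx_cvg; lra.
  have h := cvgD c3 pW; rewrite add0r in h.
  have E0 : (fun k => local_power (D (u k)) k.+1) = (fun k => local_power (D (u k)) k.+1 - exp_approx W k) + exp_approx W.
    by apply/funext => k; rewrite fctE subrK.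
  by rewrite E0; exact: h.
have e12 : \forall k \near \oo, f (psi (exp_approx Z k)) = psi (local_power (D (u k)) k.+1).
  have : \forall k \near \oo, psi (D (u k)) = f (psi (u k)) by exact: (u0 _ fD).
  apply: filterS2 Wd => k h1 h2.
  by rewrite psi_local_power // h2 -fX -psi_local_power // scale_invn; lra.
apply: (@cvg_unique _ hG _ _ _ _ c1).
apply: cvg_trans c2; apply: near_eq_cvg.
by apply: (@filterS _ \oo _ _ _ _ e12) => k ->.
Qed.

End LocalGroup.

(** * Products of exponentials *)

(** The fixed point theorem asks for the matrices as a complete normed space. *)
HB.instance Definition _ (R : realType) (n m : nat) := Complete.on 'M[R]_(n, m).

Lemma near0_norm_le (R : realType) (W : normedModType R) (c : R) : 0 < c ->
  \forall x \near (0 : W), `|x| <= c.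
Proof.
move=> c0; apply/nbhs_ballP; exists c => //= y.
by rewrite -ball_normE /= sub0r normrN => /ltW.
Qed.

Section StrictDifferential.
Variables (R : realType) (n : nat).

(** Strict differentiability at 0: the error [f - L] is Lipschitz with an
    arbitrarily small constant near 0. Unlike differentiability at a point, it
    yields local surjectivity, by a fixed point argument. *)
Definition strict_diff0 (f L : 'rV[R]_n -> 'rV[R]_n) : Prop :=
  forall eps : R, 0 < eps -> \forall r \near 0^'+, forall Z Z' : 'rV[R]_n,
    `|Z| < r -> `|Z'| < r ->
    `|f Z - f Z' - (L Z - L Z')| <= eps * `|Z - Z'|.

Lemma strict_diff0_lip f L K : strict_diff0 f L ->
  (forall Z Z', `|L Z - L Z'| <= K * `|Z - Z'|) ->
  \forall r \near 0^'+, forall Z Z' : 'rV[R]_n, `|Z| < r -> `|Z'| < r ->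
    `|f Z - f Z'| <= (1 + K) * `|Z - Z'|.
Proof.
move=> fL LK; apply: filterS (fL _ ltr01) => r h Z Z' Zr Z'r.
rewrite -[f Z - f Z'](subrK (L Z - L Z')) mulrDl.
by apply: le_trans (ler_normD _ _) _; apply: lerD; [exact: h|exact: LK].
Qed.

(** A solution of f(Z) = x is a fixed point of the contraction
    Z |-> x + Z - f(Z). *)
Lemma strict_diff0_onto (f : 'rV[R]_n -> 'rV[R]_n) (r : R) :
  strict_diff0 f id -> f 0 = 0 -> 0 < r ->
  \forall x \near (0 : 'rV[R]_n), exists2 Z, `|Z| < r & f Z = x.
Proof.
move=> fid f0 r0; near (0:R)^'+ => q.
have q0 : 0 < q by near: q; exact: nbhs_right_gt.
have qr : q <= r by near: q; exact: nbhs_right_le.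
have fq (Z Z' : 'rV[R]_n) : `|Z| < q -> `|Z'| < q ->
   `|f Z - f Z' - (Z - Z')| <= 2^-1 * `|Z - Z'|.
  by move: Z Z'; near: q; apply: fid; rewrite invr_gt0.
near=> x.
have xq : `|x| <= q / 4.
  by near: x; apply: (@near0_norm_le R 'rV[R]_n); rewrite divr_gt0.
pose U := [set Z : 'rV[R]_n | `|Z| <= q / 2].
have UP Z : U Z -> `|Z| < q by rewrite /U /= => ?; lra.
pose T Z := x + Z - f Z.
have TU : set_fun U U T.
  move=> Z UZ; have := fq Z 0 (UP _ UZ); rewrite normr0 f0 !subr0 distrC => /(_ q0) h.
  move: (UZ); rewrite /U /T /= -addrA => UZ'.
  by apply: le_trans (ler_normD _ _) _; lra.
have [|||Z UZ ZT] := @banach_fixed_point R 'rV[R]_n U (mkfun TU).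
- exists (2^-1)%:nng; split => /=; first by rewrite invf_lt1 // ltr1n.
  move=> [Z Z'] [/= UZ UZ'].
  rewrite /T distrC.
  have -> : x + Z' - f Z' - (x + Z - f Z) = f Z - f Z' - (Z - Z').
    by apply/rowP => j; rewrite !mxE; ring.
  by apply: fq; apply: UP.
- have -> : U = (fun Z : 'rV[R]_n => `|Z|) @^-1` [set y | y <= q / 2] by [].
  apply: closed_comp => [Z _|]; first exact: norm_continuous.
  exact: closed_le.
- by exists 0; rewrite /U /= normr0 divr_ge0 // ltW.
exists Z; first by apply: lt_le_trans qr; exact: UP.
move: ZT => /=; rewrite /T => ZT.
by apply: (addIr Z); rewrite [X in _ + X = _]ZT addrC subrK.
Unshelve. all: by end_near. Qed.

End StrictDifferential.

Lemma near0_mul_le (R : realType) (a b : R) : 0 < b ->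
  \forall r \near (0 : R)^'+, a * r <= b.
Proof.
move=> b0; near=> r.
have r0 : 0 < r by near: r; exact: nbhs_right_gt.
have a1 : 0 < `|a| + 1 by rewrite ltr_wpDl.
apply: (@le_trans _ _ ((`|a| + 1) * r)).
  by rewrite ler_wpM2r ?ltW // (le_lt_trans (ler_norm a)) // ltrDl.
rewrite -ler_pdivlMl //; near: r; apply: nbhs_right_le.
by rewrite mulr_gt0 ?invr_gt0.
Unshelve. all: by end_near. Qed.

Section ProductOfExponentials.
Variables (R : realType) (n : nat) (G : groupTopologicalType).
Variables (psi : 'rV[R]_n -> G) (phi : G -> 'rV[R]_n) (C rho : R).
Hypothesis H : local_group psi phi C rho.
Variable N : G -> R.
Hypotheses (N1 : N 1%g = 0) (NM : forall g h, N (g * h)%g <= N g + N h).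
Let m (x y : 'rV[R]_n) := phi (psi x * psi y)%g.

Lemma strict_diff0_local_mul (a b La Lb : 'rV[R]_n -> 'rV[R]_n) K :
  strict_diff0 a La -> strict_diff0 b Lb -> a 0 = 0 -> b 0 = 0 ->
  (forall Z Z', `|La Z - La Z'| <= K * `|Z - Z'|) ->
  (forall Z Z', `|Lb Z - Lb Z'| <= K * `|Z - Z'|) -> 0 <= K ->
  strict_diff0 (fun Z => m (a Z) (b Z)) (fun Z => La Z + Lb Z).
Proof.
move=> da db a0 b0 La_lip Lb_lip K0 eps eps0.
have C0 := lg_C_ge0 H; have rho0 := lg_rho_gt0 H.
have la := strict_diff0_lip da La_lip; have lb := strict_diff0_lip db Lb_lip.
have eps4 : 0 < eps / 4 by rewrite divr_gt0.
have da' := da _ eps4; have db' := db _ eps4.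
have K1 : 0 < 1 + K by rewrite ltr_wpDr.
near=> r => Z Z' Zr Z'r.
have r0 : 0 < r by near: r; exact: nbhs_right_gt.
have laZ (Y Y' : 'rV[R]_n) : `|Y| < r -> `|Y'| < r -> `|a Y - a Y'| <= (1 + K) * `|Y - Y'|.
  by move: Y Y'; near: r.
have lbZ (Y Y' : 'rV[R]_n) : `|Y| < r -> `|Y'| < r -> `|b Y - b Y'| <= (1 + K) * `|Y - Y'|.
  by move: Y Y'; near: r.
have daY (Y Y' : 'rV[R]_n) : `|Y| < r -> `|Y'| < r ->
    `|a Y - a Y' - (La Y - La Y')| <= eps / 4 * `|Y - Y'|.
  by move: Y Y'; near: r.
have dbY (Y Y' : 'rV[R]_n) : `|Y| < r -> `|Y'| < r ->
    `|b Y - b Y' - (Lb Y - Lb Y')| <= eps / 4 * `|Y - Y'|.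
  by move: Y Y'; near: r.
have daZ := daY _ _ Zr Z'r; have dbZ := dbY _ _ Zr Z'r.
have r1 : (1 + K) * r < rho.
  apply: (@le_lt_trans _ _ (rho / 2)); last by rewrite ltr_pdivrMr // ltr_pMr // ltr1n.
  by near: r; apply: near0_mul_le; rewrite divr_gt0.
have r2 : 4 * C * (1 + K) ^+ 2 * r <= eps by near: r; exact: near0_mul_le.
have n0 : `|0 : 'rV[R]_n| < r by rewrite normr0.
have aY Y : `|Y| < r -> `|a Y| <= (1 + K) * r.
  move=> Yr; have := laZ _ _ Yr n0; rewrite a0 !subr0 => h; apply: le_trans h _.
  by rewrite ler_wpM2l // ltW.
have bY Y : `|Y| < r -> `|b Y| <= (1 + K) * r.
  move=> Yr; have := lbZ _ _ Yr n0; rewrite b0 !subr0 => h; apply: le_trans h _.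
  by rewrite ler_wpM2l // ltW.
have aZ := aY _ Zr; have aZ' := aY _ Z'r; have bZ := bY _ Zr; have bZ' := bY _ Z'r.
have := local_mul_strict H (le_lt_trans aZ r1) (le_lt_trans bZ r1)
  (le_lt_trans aZ' r1) (le_lt_trans bZ' r1).
rewrite -/(m _ _) -/(m _ _) => h.
have -> : m (a Z) (b Z) - m (a Z') (b Z') - (La Z + Lb Z - (La Z' + Lb Z')) =
  (m (a Z) (b Z) - a Z - b Z - (m (a Z') (b Z') - a Z' - b Z'))
  + ((a Z - a Z' - (La Z - La Z')) + (b Z - b Z' - (Lb Z - Lb Z'))).
  by apply/rowP => j; rewrite !mxE; ring.
apply: le_trans (ler_normD _ _) _.
apply: le_trans (lerD h (ler_normD _ _)) _.
apply: le_trans (lerD (lexx _) (lerD daZ dbZ)) _.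
have z0 := normr_ge0 (Z - Z').
have h1 : C * `|b Z| * `|a Z - a Z'| <= C * ((1 + K) * r) * ((1 + K) * `|Z - Z'|).
  by apply: ler_pM => //; [rewrite mulr_ge0|rewrite ler_wpM2l|exact: laZ].
have h2 : C * `|a Z'| * `|b Z - b Z'| <= C * ((1 + K) * r) * ((1 + K) * `|Z - Z'|).
  by apply: ler_pM => //; [rewrite mulr_ge0|rewrite ler_wpM2l|exact: lbZ].
have h3 : C * ((1 + K) * r) * ((1 + K) * `|Z - Z'|) <= eps / 4 * `|Z - Z'|.
  rewrite [leLHS](_ : _ = C * (1 + K) ^+ 2 * r * `|Z - Z'|); last by ring.
  by rewrite ler_wpM2r //; lra.
by lra.
Unshelve. all: by end_near. Qed.

Variables (k : nat) (c : 'I_k -> 'rV[R]_n -> R) (X : 'I_k -> 'rV[R]_n) (Kc B : R).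
Hypotheses (Kc0 : 0 <= Kc) (B0 : 0 <= B).
Hypothesis c0 : forall i, c i 0 = 0.
Hypothesis c_lip : forall i Z Z', `|c i Z - c i Z'| <= Kc * `|Z - Z'|.
Hypothesis X_le : forall i, `|X i| <= B.
Hypothesis N_ray : forall i (eps : R), 0 < eps ->
  \forall t \near (0 : R), N (psi (local_exp psi phi (t *: X i))) <= eps.

(** The coordinates of exp(c_1(Z) X_1) ... exp(c_k(Z) X_k). As a function of [Z]
    it is strictly differentiable at 0, and its derivative is the identity when
    the [c i] are the coordinates of [Z] with respect to the [X i]. *)
Definition exp_prod (l : seq 'I_k) (Z : 'rV[R]_n) : 'rV[R]_n :=
  foldr (fun i acc => m (local_exp psi phi (c i Z *: X i)) acc) 0 l.

Let K := Kc * B.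
Let K0 : 0 <= K. Proof. exact: mulr_ge0. Qed.

Lemma ray_lip i Z Z' : `|c i Z *: X i - c i Z' *: X i| <= K * `|Z - Z'|.
Proof. by rewrite -scalerBl normrZ /K mulrAC ler_pM. Qed.

Lemma ray_strict_diff0 i :
  strict_diff0 (fun Z => local_exp psi phi (c i Z *: X i)) (fun Z => c i Z *: X i).
Proof.
move=> eps eps0; have C0 := lg_C_ge0 H; have s0 := lg_radius_gt0 H.
near=> r => Z Z' Zr Z'r.
have r0 : 0 < r by near: r; exact: nbhs_right_gt.
have r1 : 2 * (K * r) <= lg_radius C rho.
  by rewrite mulrA; near: r; exact: near0_mul_le.
have r2 : C * (K * r + K * r) * K <= eps.
  rewrite [leLHS](_ : _ = 2 * C * K ^+ 2 * r); last by ring.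
  by near: r; exact: near0_mul_le.
have aux Y : `|Y| < r -> `|c i Y *: X i| <= K * r.
  move=> Yr; have := ray_lip i Y 0; rewrite c0 scale0r !subr0 => h.
  by apply: le_trans h _; rewrite ler_wpM2l // ltW.
have a1 := aux _ Zr; have a2 := aux _ Z'r.
apply: le_trans (local_exp_strict H _ _) _; [by lra|by lra|].
apply: (@le_trans _ _ (C * (K * r + K * r) * (K * `|Z - Z'|))).
  apply: ler_pM => //; last exact: ray_lip.
    by rewrite mulr_ge0 // addr_ge0.
  by rewrite ler_wpM2l // lerD.
by rewrite mulrA ler_wpM2r.
Unshelve. all: by end_near. Qed.

(** Strict differentiability and smallness of [N] are proved together: the bound
    for the product in the group requires the factors to stay in the domain of
    the chart. *)
Lemma exp_prod_spec l : [/\ exp_prod l 0 = 0,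
  strict_diff0 (exp_prod l) (fun Z => \sum_(i <- l) c i Z *: X i) &
  forall eps : R, 0 < eps -> \forall r \near (0 : R)^'+, forall Z : 'rV[R]_n, `|Z| < r ->
    N (psi (exp_prod l Z)) <= eps].
Proof.
have rho0 := lg_rho_gt0 H.
elim: l => [|i l [IH1 IH2 IH3]].
  split => //= [eps eps0|eps eps0].
    by near=> r => Z Z' _ _; rewrite !big_nil !subr0 normr0 mulr_ge0 // ltW.
  by near=> r => Z _; rewrite (lg_psi0 H) N1 ltW.
have L_lip l' Z Z' : `|\sum_(i <- l') c i Z *: X i - \sum_(i <- l') c i Z' *: X i|
    <= (size l')%:R * K * `|Z - Z'|.
  elim: l' => [|j l' IH]; first by rewrite !big_nil subr0 normr0 !mul0r.
  rewrite !big_cons opprD addrACA; apply: le_trans (ler_normD _ _) _.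
  apply: le_trans (lerD (ray_lip j Z Z') IH) _.
  by rewrite /= -natr1; lra.
have ray0 : local_exp psi phi (c i 0 *: X i) = 0 by rewrite c0 scale0r (local_exp0 H).
have str : strict_diff0 (exp_prod (i :: l)) (fun Z => \sum_(j <- i :: l) c j Z *: X j).
  rewrite (_ : (fun Z => \sum_(j <- i :: l) c j Z *: X j) =
    (fun Z => c i Z *: X i + \sum_(j <- l) c j Z *: X j)); last first.
    by apply/funext => Z; rewrite big_cons.
  apply: (@strict_diff0_local_mul _ _ _ _ (K + (size l)%:R * K)) => //.
  - exact: ray_strict_diff0.
  - move=> Z Z'; apply: le_trans (ray_lip i Z Z') _.
    by rewrite ler_wpM2r // lerDl mulr_ge0.
  - move=> Z Z'; apply: le_trans (L_lip l Z Z') _.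
    by rewrite ler_wpM2r // lerDr.
  - by rewrite addr_ge0 // mulr_ge0.
have e0 : exp_prod (i :: l) 0 = 0.
  by rewrite /= IH1 ray0 /m (lg_psi0 H) mulg1 -(lg_psi0 H) (lg_psiK H) // normr0.
split => // eps eps0.
have eps2 : 0 < eps / 2 by rewrite divr_gt0.
have lsmall f L : strict_diff0 f L -> f 0 = 0 ->
   (forall Z Z', `|L Z - L Z'| <= ((size (i :: l))%:R * K) * `|Z - Z'|) ->
   \forall r \near (0:R)^'+, forall Z : 'rV[R]_n, `|Z| < r -> `|f Z| < rho.
  move=> fL f0 LL; have rho2 : 0 < rho / 2 by rewrite divr_gt0.
  have nr := near0_mul_le (1 + (size (i :: l))%:R * K) rho2.
  near=> r => Z Zr.
  have r0 : 0 < r by near: r; exact: nbhs_right_gt.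
  have h (Y Y' : 'rV[R]_n) : `|Y| < r -> `|Y'| < r ->
      `|f Y - f Y'| <= (1 + (size (i :: l))%:R * K) * `|Y - Y'|.
    by move: Y Y'; near: r; exact: (strict_diff0_lip fL LL).
  have := h Z 0 Zr; rewrite normr0 f0 !subr0 => /(_ r0) h1.
  apply: le_lt_trans h1 _.
  apply: (@le_lt_trans _ _ (rho / 2)); last by rewrite ltr_pdivrMr // ltr_pMr // ltr1n.
  apply: (@le_trans _ _ ((1 + (size (i :: l))%:R * K) * r)); last by near: r.
  by rewrite ler_wpM2l ?addr_ge0 ?mulr_ge0 // ltW.
have s1 : \forall r \near (0:R)^'+, forall Z : 'rV[R]_n, `|Z| < r ->
    `|local_exp psi phi (c i Z *: X i)| < rho.
  apply: (lsmall _ _ (ray_strict_diff0 i) ray0) => Z Z'.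
  apply: le_trans (ray_lip i Z Z') _; rewrite ler_wpM2r // ler_peMl //.
  by rewrite ler1n.
have s2 : \forall r \near (0:R)^'+, forall Z : 'rV[R]_n, `|Z| < r -> `|exp_prod l Z| < rho.
  apply: (lsmall _ _ IH2 IH1) => Z Z'.
  apply: le_trans (L_lip l Z Z') _; rewrite ler_wpM2r // ler_wpM2r //.
  by rewrite ler_nat.
have s3 : \forall r \near (0:R)^'+, forall Z : 'rV[R]_n, `|Z| < r ->
    N (psi (local_exp psi phi (c i Z *: X i))) <= eps / 2.
  have [q /= q0 qP] := (nbhs_ballP _ _).1 (N_ray i eps2).
  have q2 : 0 < q / 2 by rewrite divr_gt0.
  apply: filterS (near0_mul_le Kc q2) => r Kr Z Zr; apply: qP.
  rewrite -ball_normE /= sub0r normrN -[c i Z]subr0 -(c0 i).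
  apply: le_lt_trans (c_lip _ _ _) _; rewrite subr0.
  apply: (@le_lt_trans _ _ (Kc * r)); first by rewrite ler_wpM2l // ltW.
  by apply: le_lt_trans Kr _; rewrite ltr_pdivrMr // ltr_pMr // ltr1n.
apply: filterS3 (filterI s1 s2) s3 (IH3 _ eps2) => r [h1 h2] h3 h4 Z Zr.
rewrite /= /m (lg_psiM H); [|exact: h1|exact: h2].
by apply: le_trans (NM _ _) _; rewrite [eps]splitr; apply: lerD; [exact: h3|exact: h4].
Unshelve. all: by end_near. Qed.

Hypothesis cX : forall Z, Z = \sum_i c i Z *: X i.

(** Every point near the identity is a product of exponentials of small
    multiples of the [X i], and [N] is subadditive. *)
Lemma subadditive_small (eps : R) : 0 < eps -> \forall x \near (0 : 'rV[R]_n), N (psi x) <= eps.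
Proof.
move=> eps0; have [f0 fs fN] := exp_prod_spec (index_enum 'I_k).
rewrite (_ : (fun Z => _) = id) in fs; last by apply/funext => Z; rewrite -cX.
near (0 : R)^'+ => r.
have r0 : 0 < r by near: r; exact: nbhs_right_gt.
have h : forall Z : 'rV[R]_n, `|Z| < r -> N (psi (exp_prod (index_enum 'I_k) Z)) <= eps.
  by near: r; exact: fN.
by apply: filterS (strict_diff0_onto fs f0 r0) => x [Z Zr <-]; exact: h.
Unshelve. all: by end_near. Qed.

End ProductOfExponentials.

(** * Lie groups are local groups *)

Section LieDilations.
Variables (R : realType) (n : nat) (G : groupTopologicalType).
Variables (A : set (chart G 'rV[R]_n)) (e : chart G 'rV[R]_n).
Hypotheses (hG : lie_group A) (Ae : A e) (e1 : chart_dom e 1%g).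

Lemma pair_lt (x y : 'rV[R]_n) r : `|x| < r -> `|y| < r -> `|(x, y)| < r.
Proof. by move=> xr yr; rewrite prod_normE gt_max /= xr yr. Qed.

Lemma near_pairP (P : 'rV[R]_n * 'rV[R]_n -> Prop) :
  (\forall z \near (0 : 'rV[R]_n, 0 : 'rV[R]_n), P z) ->
  \forall r \near (0 : R)^'+, forall x y, `|x| < r -> `|y| < r -> P (x, y).
Proof.
move=> /nbhs_ballP[q /= q0 qP]; near=> r => x y xr yr.
have rq : r <= q by near: r; exact: nbhs_right_le.
apply: qP; split => /=; rewrite -ball_normE /= sub0r normrN; exact: lt_le_trans rq.
Unshelve. all: by end_near. Qed.

Lemma near0_right (P : 'rV[R]_n -> Prop) :
  (\forall Z \near (0 : 'rV[R]_n), P Z) ->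
  \forall r \near (0 : R)^'+, forall Z : 'rV[R]_n, `|Z| < r -> P Z.
Proof.
move=> /nbhs_ballP[q /= q0 qP]; near=> r => Z Zr.
apply: qP; rewrite -ball_normE /= sub0r normrN.
by apply: lt_le_trans Zr _; near: r; exact: nbhs_right_le.
Unshelve. all: by end_near. Qed.

(** The bounds are second differences of the product between the points (x, y),
    (x, z), (0, y), (0, z), respectively (y, x), (z, x), (y, 0), (z, 0). *)
Lemma lie_local_group : exists C rho : R, local_group (lparam e) (lchart e) C rho.
Proof.
have [C C0 CP] := lmul_second_difference hG Ae e1.
have ncod := near0_right (near_chart_cod hG Ae e1).
have ndom := near_pairP (near_lmul hG Ae e1).
exists C; near (0 : R)^'+ => r; exists r.
have r0 : 0 < r by near: r; exact: nbhs_right_gt.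
have cod x : `|x| < r -> chart_cod e (x + e 1%g).
  by move: x; near: r; exact: ncod.
have dom x y : `|x| < r -> `|y| < r -> chart_dom e (lparam e x * lparam e y)%g.
  by move: x y; near: r; exact: ndom.
have est : forall p v a : 'rV[R]_n * 'rV[R]_n,
      `|p| < r -> `|p + v| < r -> `|p - a| < r -> `|p + v - a| < r ->
      `|lmul e (p + v).1 (p + v).2 - lmul e p.1 p.2
        - (lmul e (p + v - a).1 (p + v - a).2 - lmul e (p - a).1 (p - a).2)|
      <= C * `|a| * `|v| by near: r.
have n0 : `|0 : 'rV[R]_n| < r by rewrite normr0.
have lm0 y : `|y| < r -> lmul e 0 y = y.
  move=> yr; rewrite /lmul (lparam0 hG Ae e1) mul1g.
  by have [] := chart_codE hG Ae (cod _ yr).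
have l0m y : `|y| < r -> lmul e y 0 = y.
  move=> yr; rewrite /lmul (lparam0 hG Ae e1) mulg1.
  by have [] := chart_codE hG Ae (cod _ yr).
have nl (x : 'rV[R]_n) : `|(x, 0 : 'rV[R]_n)| = `|x|.
  by rewrite prod_normE /= normr0 max_l.
have nr (x : 'rV[R]_n) : `|(0 : 'rV[R]_n, x)| = `|x|.
  by rewrite prod_normE /= normr0 max_r.
split => //.
- exact: lparam0 hG Ae e1.
- by move=> x xr; have [] := chart_codE hG Ae (cod _ xr).
- by move=> x xr; have [] := chart_codE hG Ae (cod _ xr).
- by move=> x y xr yr; apply: (lchartK hG Ae); exact: dom.
- move=> x y z xr yr zr.
  have := est (x, z) (0, y - z) (x, 0).
  rewrite -![(_, _) + _]/(_, _) /= !addr0 subr0 ![_ + (y - z)]addrC subrK !subrr subr0.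
  rewrite nl nr !lm0 //; apply; exact: pair_lt.
- move=> x y z xr yr zr.
  have := est (z, x) (y - z, 0) (0, x).
  rewrite -![(_, _) + _]/(_, _) /= !addr0 subr0 ![_ + (y - z)]addrC subrK !subrr subr0.
  rewrite nl nr !l0m //; apply; exact: pair_lt.
Unshelve. all: by end_near. Qed.

End LieDilations.

(** * Dilations and homogeneous directions *)

(** A basis adapted to the grading, in the form in which it enters the estimates. *)
Record homogeneous_frame (R : realType) (n : nat) (V : R -> {vspace 'rV[R]_n})
    (k : nat) (c : 'I_k -> 'rV[R]_n -> R) (X : 'I_k -> 'rV[R]_n)
    (wt : 'I_k -> R) (K B : R) : Prop := HomogeneousFrame {
  hf_K_ge0 : 0 <= K;
  hf_B_ge0 : 0 <= B;
  hf_wt_gt0 : forall i, 0 < wt i;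
  hf_homogeneous : forall i, X i \in V (wt i);
  hf_coord_lip : forall i Z Z', `|c i Z - c i Z'| <= K * `|Z - Z'|;
  hf_coord0 : forall i, c i 0 = 0;
  hf_vector_le : forall i, `|X i| <= B;
  hf_decomposition : forall Z, Z = \sum_i c i Z *: X i
}.

Lemma grading_frame (R : realType) (n : nat)
    (br : 'rV[R]_n -> 'rV[R]_n -> 'rV[R]_n) (V : R -> {vspace 'rV[R]_n}) :
  positive_grading br V ->
  exists k (c : 'I_k -> 'rV[R]_n -> R) X wt K B, homogeneous_frame V c X wt K B.
Proof.
move=> [[s [[_ s0] _ sV _]] _].
pose L : seq (R * 'rV[R]_n) :=
  flatten [seq [seq (t, b) | b <- vbasis (V t)] | t <- s].
have LP p : p \in L -> 0 < p.1 /\ p.2 \in V p.1.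
  move=> /flatten_mapP[t ts /mapP[b bV ->]] /=.
  by split; [exact: s0|exact: vbasis_mem].
pose S : seq 'rV[R]_n := map snd L.
have spanS : <<in_tuple S>>%VS = fullv.
  apply/eqP; rewrite eqEsubv subvf /= -sV big_seq.
  apply: (@big_ind _ (fun U => U <= <<in_tuple S>>)%VS) => [|U W|t ts].
  - exact: sub0v.
  - by rewrite subv_add => -> ->.
  rewrite -(span_basis (vbasisP (V t))); apply/span_subvP => b bV.
  apply: memv_span; apply/mapP; exists (t, b) => //.
  by apply/flatten_mapP; exists t => //; apply/mapP; exists b.
pose X (i : 'I_(size S)) := S`_i.
pose wt (i : 'I_(size S)) := (nth (1, 0) L i).1.
pose c (i : 'I_(size S)) (Z : 'rV[R]_n) : R := coord (in_tuple S) i Z.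
pose K := \sum_(i < size S) \sum_(j < n) `|c i (delta_mx 0 j)|.
have sLS : size S = size L by rewrite size_map.
have iL (i : 'I_(size S)) : nth (1, 0) L i \in L by rewrite mem_nth // -sLS.
exists (size S), c, X, wt, K, (\sum_i `|X i|); split.
- by apply: sumr_ge0 => i _; apply: sumr_ge0.
- exact: sumr_ge0.
- by move=> i; have [] := LP _ (iL i).
- move=> i; have [_] := LP _ (iL i).
  by rewrite /X /wt /S (nth_map (1, 0)) // -sLS.
- move=> i Z Z'; rewrite /c -linearB /= -/(c i _).
  rewrite [Z - Z' in leLHS]row_sum_delta /c linear_sum /=.
  apply: le_trans (ler_norm_sum _ _ _) _.
  apply: (@le_trans _ _ (\sum_(j < n) `|c i (delta_mx 0 j)| * `|Z - Z'|)).
    apply: ler_sum => j _; rewrite linearZ /= normrM mulrC ler_wpM2l //.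
    exact: row_coord_le.
  rewrite -mulr_suml ler_wpM2r // /K (bigD1 i) //= lerDl.
  by apply: sumr_ge0 => j _; apply: sumr_ge0.
- by move=> i; rewrite /c linear0.
- by move=> i; rewrite (bigD1 i) //= lerDl; apply: sumr_ge0.
- by move=> Z; apply: coord_span; rewrite spanS memvf.
Qed.

Lemma harmonic_dnbhs (R : realType) : (@harmonic R) @ \oo --> (0 : R)^'.
Proof.
move=> P P0.
have h : \forall k \near \oo, @harmonic R k != 0 -> P (harmonic k) := cvg_harmonic P0.
suff : \forall k \near \oo, P (harmonic k) by [].
by apply: (@filterS _ \oo _ _ _ _ h) => k; apply; rewrite gt_eqF // harmonic_gt0.
Qed.

Section Dilations.
Variables (R : realType) (n : nat) (G : groupTopologicalType).
Variables (A : set (chart G 'rV[R]_n)) (e : chart G 'rV[R]_n).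
Variables (V : R -> {vspace 'rV[R]_n}) (delta : R -> G -> G) (d : G -> G -> R).
Hypotheses (hG : lie_group A) (Ae : A e) (e1 : chart_dom e 1%g).
Hypotheses (hdelta : dilations A e V delta) (hd : homogeneous_distance delta d).
Variables (C rho : R).
Hypothesis H : local_group (lparam e) (lchart e) C rho.
Let s := lg_radius C rho.

Definition hnorm (g : G) : R := d g 1%g.

Lemma deltaM l g h : 0 < l -> delta l (g * h)%g = (delta l g * delta l h)%g.
Proof. by move=> l0; have [[+ _ _] _] := hdelta l0; apply. Qed.

Lemma delta1 l : 0 < l -> delta l 1%g = 1%g.
Proof. by move=> l0; apply: (mulgI (delta l 1%g)); rewrite -deltaM // !mulg1. Qed.

Lemma delta_cont l : 0 < l -> continuous (delta l).
Proof. by move=> l0; have [[_ [+ _] _] _] := hdelta l0; apply. Qed.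

Lemma hnorm_ge0 g : 0 <= hnorm g.
Proof. by have [[h _ _ _] _ _] := hd; exact: h. Qed.

Lemma hnorm1 : hnorm 1%g = 0.
Proof. by have [[_ h _ _] _ _] := hd; apply/h. Qed.

Lemma hnorm_eq0 g : hnorm g = 0 -> g = 1%g.
Proof. by have [[_ h _ _] _ _] := hd; move/h. Qed.

Lemma hnormM g h : hnorm (g * h)%g <= hnorm g + hnorm h.
Proof.
have [[_ _ _ tri] inv _] := hd.
have := tri (g * h)%g g 1%g.
have -> : d (g * h)%g g = d h 1%g by rewrite -[X in d _ X]mulg1 inv.
by rewrite addrC.
Qed.

Lemma hnorm_delta l g : 0 < l -> hnorm (delta l g) = l * hnorm g.
Proof. by have [_ _ h] := hd; move=> l0; rewrite /hnorm -{1}(delta1 l0) h. Qed.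

Definition delta_chart (l : R) (x : 'rV[R]_n) : 'rV[R]_n :=
  lchart e (delta l (lparam e x)).

Lemma delta_chart_diff l : 0 < l -> differentiable (e \o delta l \o chart_inv e) (e 1%g).
Proof.
move=> l0; have [[_ [_ sm] _] _] := hdelta l0.
apply: (sm e e Ae Ae 1%N).1; exists 1%g => //; split => //=.
by rewrite delta1.
Qed.

Lemma near_delta_chart l : 0 < l ->
  \forall x \near (0 : 'rV[R]_n), lparam e (delta_chart l x) = delta l (lparam e x).
Proof.
move=> l0.
have [_ _ c0] := chart_codE hG Ae (nbhs_singleton (near_chart_cod hG Ae e1)).
have : {for (0 : 'rV[R]_n), continuous (delta l \o lparam e)}.
  by apply: continuous_comp => //; exact: delta_cont.
move=> /(_ (chart_dom e)) h.
have : \forall x \near (0 : 'rV[R]_n), chart_dom e (delta l (lparam e x)).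
  apply: h; rewrite /= (lparam0 hG Ae e1) delta1 //.
  exact: near_lchart hG Ae e1.
by apply: filterS => x; exact: (lchartK hG Ae).
Qed.

Lemma delta_chart_deriv (l : R) (Z : 'rV[R]_n) : 0 < l ->
  (fun k => k.+1%:R *: delta_chart l (k.+1%:R^-1 *: Z)) @ \oo
    --> lie_differential e (delta l) Z.
Proof.
move=> l0; have df := delta_chart_diff l0.
have dv : derivable (e \o delta l \o chart_inv e) (e 1%g) Z by exact: diff_derivable.
rewrite /lie_differential -deriveE //.
pose F := e \o delta l \o chart_inv e.
have := @cvg_comp _ _ _ (@harmonic R)
  (fun h => h^-1 *: (F (h *: Z + e 1%g) - F (e 1%g))) \oo _ _ (@harmonic_dnbhs R) dv.
suff -> : (fun h => h^-1 *: (F (h *: Z + e 1%g) - F (e 1%g))) \o @harmonic R =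
  (fun k => k.+1%:R *: delta_chart l (k.+1%:R^-1 *: Z)) by [].
apply/funext => k /=; rewrite invrK /F /delta_chart /lchart /lparam /=.
have [_ _ Ke _ _] := lie_chart hG Ae.
by rewrite [chart_inv e (e 1%g)]Ke // delta1.
Qed.

Lemma local_exp_delta (l t : R) (X : 'rV[R]_n) : 0 < l -> 0 < t -> X \in V t ->
  2 * `|X| <= s -> 4 * `|(l `^ t) *: X| <= s ->
  delta l (lparam e (local_exp (lparam e) (lchart e) X)) =
  lparam e (local_exp (lparam e) (lchart e) ((l `^ t) *: X)).
Proof.
move=> l0 t0 XV Xs Xls.
apply: (local_exp_morphism H (D := delta_chart l)) => //.
- by case: hG.
- by move=> g h; exact: deltaM.
- exact: delta_cont.
- exact: near_delta_chart.
- have [_ /(_ t X t0 XV) <-] := hdelta l0; exact: delta_chart_deriv.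
Qed.

(** The vector c X is the image of kap X or - kap X under the derivative of the
    dilation of ratio (|c| / kap)^(1/t), and dilations multiply the norm by
    their ratio. *)
Lemma hnorm_ray (t : R) (X : 'rV[R]_n) (eps : R) : 0 < t -> X \in V t -> 0 < eps ->
  \forall c \near (0 : R), hnorm (lparam e (local_exp (lparam e) (lchart e) (c *: X))) <= eps.
Proof.
move=> t0 XV eps0; have s0 : 0 < s := lg_radius_gt0 H.
(* The factor [kap] brings [X] into the domain of the exponential map. *)
pose kap : R := s / 4 / (`|X| + 1).
have X1 : 0 < `|X| + 1 by rewrite ltr_wpDl.
have kap0 : 0 < kap by apply: divr_gt0 => //; exact: divr_gt0.
have kapX : 4 * (kap * `|X|) <= s.
  have : kap * `|X| <= kap * (`|X| + 1) by apply: ler_wpM2l; [exact: ltW|rewrite lerDl].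
  have -> : kap * (`|X| + 1) = s / 4 by rewrite /kap divfK // gt_eqF.
  by lra.
pose N' (sg : R) := hnorm (lparam e (local_exp (lparam e) (lchart e) ((sg * kap) *: X))).
pose M := N' 1 + N' (-1) + 1.
have N'0 sg : 0 <= N' sg by exact: hnorm_ge0.
have M0 : 0 < M by rewrite ltr_wpDl // addr_ge0.
pose q := (eps / M) `^ t.
have q0 : 0 < q by rewrite powR_gt0 // divr_gt0.
have near1 : \forall c \near (0 : R), `|c| <= kap * Num.min 1 q.
  by apply: (@near0_norm_le R R); rewrite mulr_gt0 // lt_min ltr01.
apply: filterS near1 => c cq.
have [->|c0] := eqVneq c 0.
  by rewrite scale0r (local_exp0 H) (lg_psi0 H) hnorm1 ltW.
pose a := `|c| / kap.
have a0 : 0 < a by rewrite divr_gt0 // normr_gt0.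
have aq : a <= Num.min 1 q by rewrite ler_pdivrMr // mulrC.
have a1 : a <= 1 by move: aq; rewrite le_min => /andP[].
have aq' : a <= q by move: aq; rewrite le_min => /andP[].
pose l := a `^ t^-1.
have l0 : 0 < l by rewrite powR_gt0.
have lt' : l `^ t = a by rewrite /l -powRrM mulVf ?gt_eqF // powRr1 // ltW.
have cX : c *: X = (l `^ t) *: ((Num.sg c * kap) *: X).
  rewrite lt' scalerA; congr (_ *: _).
  rewrite /a mulrCA divfK ?gt_eqF //.
  by rewrite -numEsg.
have nY : `|(Num.sg c * kap) *: X| = kap * `|X|.
  by rewrite normrZ normrM normr_sg c0 mul1r ger0_norm // ltW.
rewrite cX -local_exp_delta //; last first.
- rewrite normrZ nY lt' [`|a|]ger0_norm; last exact: ltW.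
  have : a * (kap * `|X|) <= kap * `|X| by rewrite ler_piMl // mulr_ge0 // ltW.
  by lra.
- by rewrite nY; have := mulr_ge0 (ltW kap0) (normr_ge0 X); lra.
- exact: memvZ.
rewrite hnorm_delta //.
have lM : l <= eps / M.
  have -> : eps / M = q `^ t^-1.
    by rewrite /q -powRrM divff ?gt_eqF // powRr1 // ltW // divr_gt0.
  by apply: ge0_ler_powR => //; rewrite ?nnegrE ?invr_ge0 ltW.
apply: (@le_trans _ _ (l * M)); last by rewrite -ler_pdivlMr.
apply: ler_wpM2l; first exact: ltW.
rewrite /M.
rewrite -/(N' (Num.sg c)).
have n1 := N'0 1; have n2 := N'0 (-1).
have [cp|cn|/eqP] := ltrgt0P c; last by rewrite (negPf c0).
  by rewrite gtr0_sg // -addrA lerDl addr_ge0.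
by rewrite ltr0_sg // addrAC lerDr addr_ge0.
Qed.

End Dilations.

(** * Compactness of the balls of a homogeneous distance *)

Section Topology.
Variables (R : realType) (n : nat) (G : groupTopologicalType).
Variables (A : set (chart G 'rV[R]_n)) (e : chart G 'rV[R]_n).
Variables (V : R -> {vspace 'rV[R]_n}) (delta : R -> G -> G) (d : G -> G -> R).
Hypothesis hG : homogeneous_group A e V.
Hypotheses (hdelta : dilations A e V delta) (hd : homogeneous_distance delta d).

Let lieG : lie_group A. Proof. by case: hG => -[]. Qed.
Let Ae : A e. Proof. by case: hG => -[_ _ _ []]. Qed.
Let e1 : chart_dom e 1%g. Proof. by case: hG => -[_ _ _ []]. Qed.
Local Notation hnorm := (hnorm d).
Local Notation lparam := (lparam e).
Local Notation lchart := (lchart e).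

(** The function [hnorm] is subadditive and small on the rays spanned by
    homogeneous vectors; these span the tangent space. *)
Lemma hnorm_near1 (eps : R) : 0 < eps -> \forall g \near (1%g : G), hnorm g <= eps.
Proof.
move=> eps0; have [C [rho H]] := lie_local_group lieG Ae e1.
have [[_ _ _ _ gr] _] := hG.
have [k [c [X [wt [K [B hf]]]]]] := grading_frame gr.
have small : \forall x \near (0 : 'rV[R]_n), hnorm (lparam x) <= eps.
  apply: (subadditive_small H (hnorm1 hd) (hnormM hd) (hf_K_ge0 hf) (hf_B_ge0 hf) (hf_coord0 hf) (hf_coord_lip hf)
    (hf_vector_le hf) _ (hf_decomposition hf) eps0).
  move=> i eps' eps'0.
  exact (hnorm_ray lieG Ae e1 hdelta hd H (hf_wt_gt0 hf i) (hf_homogeneous hf i) eps'0).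
have := lchart_continuous lieG Ae e1; rewrite /prop_for /continuous_at lchart1.
move=> /(_ _ small) small'.
apply: (@filterS2 _ (nbhs (1%g : G)) _ _ _ _ _ small' (near_lchart lieG Ae e1)) => g.
by move=> /= + dg; rewrite (lchartK lieG Ae dg).
Qed.

Lemma dist_continuous p : continuous (fun q => d q p : R).
Proof.
have [[d0 d00 dC dT] dinv _] := hd.
move=> q0; apply/cvgrPdist_le => eps eps0.
have c1 : {for q0, continuous (fun q => q0^-1 * q)%g}.
  apply: (@continuous_comp _ _ _ (fun q => (q0^-1%g, q)) (fun p : G * G => (p.1 * p.2)%g)).
    by apply: cvg_pair => /=; [exact: cvg_cst|exact: cvg_id].
  exact: (lie_mul_continuous lieG).
have nb : \forall g \near (q0^-1 * q0)%g, hnorm g <= eps.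
  by rewrite mulVg; exact: hnorm_near1.
apply: (@filterS _ (nbhs q0) _ _ _ _ (c1 _ nb)) => q /=; rewrite /hnorm.
rewrite -(dinv q0) mulgA mulgV mul1g mulg1 => h.
apply: le_trans h; rewrite ler_norml.
have h1 := dT q0 q p; have h2 := dT q q0 p; rewrite [d q0 q]dC in h1.
by apply/andP; split; lra.
Qed.

Lemma cball_closed p r : closed (cball d p r).
Proof.
have -> : cball d p r = (fun q => d q p) @^-1` [set y | y <= r] by [].
apply: closed_comp => [q _|]; first exact: dist_continuous.
exact: closed_le.
Qed.

Lemma delta_bij l : 0 < l -> exists D' : G -> G,
  [/\ cancel (delta l) D', cancel D' (delta l) & continuous D'].
Proof.
move=> l0; have [[_ _ [D' [h1 h2 [h3 _]]]] _] := hdelta l0.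
by exists D'.
Qed.

(** As all weights are at least 1, the differential of the dilation of ratio
    l < 1 is bounded by a multiple of l. For small [l] it is a contraction, and
    then so is the dilation itself near the identity. *)
Lemma contracted_nbhs : exists l : R, 0 < l < 1 /\ exists rho : R, 0 < rho /\
  [/\ forall x : 'rV[R]_n, `|x| < 2 * rho ->
        [/\ chart_dom e (lparam x), lchart (lparam x) = x & {for x, continuous lparam}],
      forall x : 'rV[R]_n, `|x| < 2 * rho -> `|delta_chart e delta l x| <= `|x| / 2 &
      forall x : 'rV[R]_n, `|x| < 2 * rho ->
        lparam (delta_chart e delta l x) = delta l (lparam x)].
Proof.
have [[_ _ _ _ gr] V1] := hG.
have [k [c [X [wt [K [B hf]]]]]] := grading_frame gr.
have K0 := hf_K_ge0 hf; have B0 := hf_B_ge0 hf.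
pose M := k%:R * (K * B) + 1.
have M0 : 0 < M by rewrite ltr_wpDl // !mulr_ge0.
pose l := (4 * M)^-1.
have l0 : 0 < l by rewrite invr_gt0 mulr_gt0.
have l1 : l < 1.
  rewrite invf_lt1 ?mulr_gt0 //.
  have : 0 <= k%:R * (K * B) by rewrite !mulr_ge0.
  by rewrite /M; lra.
exists l; split; first by rewrite l0.
have df := delta_chart_diff Ae e1 hdelta l0.
have Lam (Z : 'rV[R]_n) : `|lie_differential e (delta l) Z| <= `|Z| / 4.
  rewrite [Z in lie_differential _ _ Z](hf_decomposition hf) /lie_differential linear_sum /=.
  apply: le_trans (ler_norm_sum _ _ _) _.
  apply: (@le_trans _ _ (\sum_(i < k) l * (K * B) * `|Z|)).
    apply: ler_sum => i _; rewrite linearZ /= normrZ.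
    have cZ : `|c i Z| <= K * `|Z|.
      by have := hf_coord_lip hf i Z 0; rewrite (hf_coord0 hf) !subr0.
    have [_ /(_ _ _ (hf_wt_gt0 hf i) (hf_homogeneous hf i))] := hdelta l0.
    rewrite /lie_differential => ->.
    have lX : `|(l `^ wt i) *: X i| <= l * B.
      have [w1|w1] := ltP (wt i) 1.
        have := hf_homogeneous hf i; rewrite V1 ?(hf_wt_gt0 hf) // memv0 => /eqP ->.
        by rewrite scaler0 normr0 mulr_ge0 // ltW.
      rewrite normrZ ger0_norm ?powR_ge0 //; apply: ler_pM => //.
      - exact: powR_ge0.
      - by apply: ge1r_powR => //; rewrite l0 ltW.
      - exact: hf_vector_le hf i.
    apply: le_trans (ler_pM _ _ cZ lX) _ => //.
    by rewrite le_eqVlt; apply/orP; left; apply/eqP; ring.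
  rewrite sumr_const card_ord.
  rewrite [leLHS](_ : _ = (l * (k%:R * (K * B))) * `|Z|); last by ring.
  rewrite mulrC ler_wpM2l // /l invfM -mulrA ler_piMr ?invr_ge0 //.
  by rewrite ler_pdivrMl // mulr1 /M lerDl.
have fst_order : \forall x \near (0 : 'rV[R]_n), `|delta_chart e delta l x| <= `|x| / 2.
  pose F := e \o delta l \o chart_inv e.
  have E := diff_locally df; set k' := 'o _ in E.
  have e4 : (0 : R) < 4^-1 by rewrite invr_gt0.
  have := littleoP [littleo of k'] e4.
  apply: filterS => x kx.
  have Ex : F (x + e 1%g) = F (e 1%g) + 'd F (e 1%g) x + k' x.
    exact: (congr1 (fun f => f x) E).
  have -> : delta_chart e delta l x = 'd F (e 1%g) x + k' x.
    rewrite /delta_chart /lchart /lparam -[e (delta l _)]/(F (x + e 1%g)) Ex.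
    have -> : F (e 1%g) = e 1%g.
      have [_ _ Ke _ _] := lie_chart lieG Ae.
      by rewrite /F /= Ke // (delta1 hdelta).
    by rewrite -[X in X - _]addrA [X in X - _]addrC addrK.
  apply: le_trans (ler_normD _ _) _.
  by have := lerD (Lam x) kx; rewrite /lie_differential -/F; lra.
have ncod := near_chart_cod lieG Ae e1.
have ndc := near_delta_chart lieG Ae e1 hdelta l0.
have /near0_right : \forall x \near (0 : 'rV[R]_n), [/\ chart_cod e (x + e 1%g),
    `|delta_chart e delta l x| <= `|x| / 2 &
    lparam (delta_chart e delta l x) = delta l (lparam x)].
  by apply: filterS3 ncod fst_order ndc.
move=> nr; near (0 : R)^'+ => r.
have r0 : 0 < r by near: r; exact: nbhs_right_gt.
have rP : forall Z : 'rV[R]_n, `|Z| < r -> [/\ chart_cod e (Z + e 1%g),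
    `|delta_chart e delta l Z| <= `|Z| / 2 &
    lparam (delta_chart e delta l Z) = delta l (lparam Z)] by near: r.
exists (r / 2); split; first by rewrite divr_gt0.
rewrite mulrC divfK //; split => x xr; have [h1 h2 h3] := rP _ xr => //.
exact: (chart_codE lieG Ae h1).
Unshelve. all: by end_near. Qed.

(** The points that are eventually sent into [U] form an open set, stable under
    products since the iterates of two such points become so small that their
    product lies in [U]. The set is also closed, as a point of its closure
    differs from a point of the set by an element of [U]. As the group is
    connected, the set is everything. *)
Lemma connected_contraction (l : R) (U : set G) (phi : G -> 'rV[R]_n) : 0 < l ->
  open U -> U 1%g ->
  (forall P : set G, (\forall g \near (1%g : G), P g) ->
     exists2 r : R, 0 < r & forall g, U g -> `|phi g| < r -> P g) ->
  (forall g, U g -> U (delta l g) /\ `|phi (delta l g)| <= `|phi g| / 2) ->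
  forall p, exists k, U (iter k (delta l) p).
Proof.
move=> l0 oU U1 Uphi Uc.
pose D k := iter k (delta l).
have D1 k : D k 1%g = 1%g.
  by elim: k => //= k IH; rewrite /D /= -/(D k) IH (delta1 hdelta).
have DM k g h : D k (g * h)%g = (D k g * D k h)%g.
  by elim: k => //= k IH; rewrite /D /= -!/(D k _) IH (deltaM hdelta).
have Dc k : continuous (D k).
  elim: k => [|k IH]; first by move=> x; exact: cvg_id.
  move=> x; apply: (@continuous_comp _ _ _ (D k) (delta l)); first exact: IH.
  exact: (delta_cont hdelta).
have Dadd j k g : D (j + k)%N g = D j (D k g) by rewrite /D iterD.
have Dlim g k (r : R) : 0 < r -> U (D k g) ->
    exists j0, forall j, (j0 <= j)%N -> U (D j g) /\ `|phi (D j g)| < r.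
  move=> r0 Ug.
  have step j : U (D (j + k)%N g) /\ `|phi (D (j + k)%N g)| <= `|phi (D k g)| * (2^-1) ^+ j.
    elim: j => [|j [IH1 IH2]]; first by rewrite expr0 mulr1.
    rewrite addSn /D /= -/(D _ _); have [h1 h2] := Uc _ IH1; split => //.
    apply: le_trans h2 _; rewrite exprSr mulrA.
    by rewrite ler_wpM2r // invr_ge0.
  have : (fun j => `|phi (D k g)| * (2^-1) ^+ j) @ \oo --> `|phi (D k g)| * 0.
    apply: cvgMl_tmp; apply: cvg_expr; rewrite ger0_norm ?invr_ge0 //.
    by rewrite invf_lt1 // ltr1n.
  rewrite mulr0 => /cvgrPdist_lt /(_ _ r0) [j0 _ j0P].
  exists (j0 + k)%N => j jj.
  have [h1 h2] := step (j - k)%N.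
  have jk : (j - k + k = j)%N by rewrite subnK // (leq_trans _ jj) // leq_addl.
  rewrite jk in h1 h2; split => //; apply: le_lt_trans h2 _.
  have := j0P (j - k)%N; rewrite /= sub0r normrN => /(_ _) h.
  apply: le_lt_trans (ler_norm _) _; apply: h.
  by rewrite leq_subRL ?(leq_trans _ jj) ?leq_addl // addnC.
pose Hs := [set p | exists k, U (D k p)].
have HM p q : Hs p -> Hs q -> Hs (p * q)%g.
  move=> [k1 h1] [k2 h2].
  have : \forall z \near (1%g : G, 1%g : G), U (z.1 * z.2)%g.
    apply: (@lie_mul_continuous _ _ _ _ lieG (1%g, 1%g) U); rewrite /= mulg1.
    exact: open_nbhs_nbhs.
  move=> [[P1 P2] /= [n1 n2] PP].
  have [r1 r10 r1P] := Uphi _ n1; have [r2 r20 r2P] := Uphi _ n2.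
  have [j1 j1P] := Dlim _ _ _ r10 h1; have [j2 j2P] := Dlim _ _ _ r20 h2.
  exists (j1 + j2)%N; rewrite DM.
  have [u1 v1] := j1P (j1 + j2)%N (leq_addr _ _).
  have [u2 v2] := j2P (j1 + j2)%N (leq_addl _ _).
  by apply: (PP (D _ p, D _ q)); split => /=; [exact: r1P|exact: r2P].
have oH : open Hs.
  rewrite openE => p [k Ukp].
  have : nbhs (D k p) U by apply: open_nbhs_nbhs.
  by move=> /(Dc k p) h; apply: (@filterS _ (nbhs p) _ _ _ _ h) => q Uq; exists k.
have cH : closed Hs.
  rewrite closedE => p; apply: contra_notP => Hp.
  have c1 : {for p, continuous (fun q : G => q^-1 * p)%g}.
    apply: (@continuous_comp _ _ _ (fun q : G => (q^-1%g, p)) (fun p : G * G => (p.1 * p.2)%g)).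
      by apply: cvg_pair => /=; [exact: (lie_inv_continuous lieG)|exact: cvg_cst].
    exact: (lie_mul_continuous lieG).
  have nb : \forall g \near (p^-1 * p)%g, U g.
    by rewrite mulVg; exact: open_nbhs_nbhs.
  apply: (@filterS _ (nbhs p) _ _ _ _ (c1 _ nb)) => q /= Uq Hq.
  apply: Hp; rewrite -[p](mulVKg q); apply: HM => //.
  by exists 0%N.
have conn : connected [set: G] by case: hG => -[].
have HT : Hs = [set: G].
  apply: conn; first by exists 1%g, 0%N.
    by exists Hs => //; rewrite setTI.
  by exists Hs => //; rewrite setTI.
by move=> p; have : [set: G] p by []; rewrite -HT.
Qed.

(** If p is outside [U], some iterate of p is outside [U] while the next one is
    in [U]. The latter lies in the compact set [K0] of points of [Q] whose
    preimage is not in [U], on which the norm has a positive minimum; dilations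
    of ratio less than 1 do not increase the norm. *)
Lemma small_hnorm_compact : exists2 c : R, 0 < c &
  exists2 Q : set G, compact Q & forall p, hnorm p < c -> Q p.
Proof.
have [l [/andP[l0 l1] [rho [rho0 [lp lD lpD]]]]] := contracted_nbhs.
have rho2 (x : 'rV[R]_n) : `|x| <= rho -> `|x| < 2 * rho.
  by move=> xr; apply: le_lt_trans xr _; rewrite ltr_pMl // ltr1n.
have [odom _ Ke ce _] := lie_chart lieG Ae.
pose U := [set g | chart_dom e g /\ `|lchart g| < rho].
have phi_c g : chart_dom e g -> {for g, continuous lchart}.
  by move=> dg; apply: (@cvgB _ _ _ (nbhs g) _ e (cst (e 1%g))); [exact: ce|exact: cvg_cst].
have oU : open U.
  rewrite openE => g [dg gr].
  have n1 : nbhs g (chart_dom e) by apply: open_nbhs_nbhs.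
  have n2 : \forall h \near g, `|lchart h| < rho.
    have gr' : 0 < rho - `|lchart g| by rewrite subr_gt0.
    have /cvgrPdist_lt /(_ _ gr') n3 := phi_c _ dg.
    apply: (@filterS _ (nbhs g) _ _ _ _ n3) => h /= hr.
    have := ler_distD (lchart g) (lchart h) 0; rewrite !subr0 [`|lchart h - _|]distrC.
    by lra.
  by apply: (@filterS2 _ (nbhs g) _ _ _ _ _ n1 n2) => h.
have lc1 : lchart 1%g = 0 by exact: lchart1.
have U1 : U 1%g by split => //; rewrite lc1 normr0.
have UK g : U g -> lparam (lchart g) = g by move=> [dg _]; exact: (lchartK lieG Ae dg).
have UD g : U g -> U (delta l g) /\ `|lchart (delta l g)| <= `|lchart g| / 2.
  move=> Ug; have [dg gr] := Ug.
  have h1 := lD _ (rho2 _ (ltW gr)); have h2 := lpD _ (rho2 _ (ltW gr)).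
  rewrite UK // in h2.
  have small : `|delta_chart e delta l (lchart g)| < rho.
    by apply: le_lt_trans h1 _; have := normr_ge0 (lchart g); lra.
  have [h3 h4 _] := lp _ (rho2 _ (ltW small)); rewrite h2 in h3 h4.
  by split; [split; rewrite // h4|rewrite h4].
have flow := @connected_contraction l U lchart l0 oU U1.
have {}flow p : exists k, U (iter k (delta l) p).
  apply: flow => //.
  move=> P nP.
    have [_ _ c0] : [/\ chart_dom e (lparam 0), lchart (lparam 0) = 0 &
      {for (0 : 'rV[R]_n), continuous lparam}] by apply: lp; rewrite normr0 mulr_gt0.
    move: c0; rewrite /prop_for /continuous_at (lparam0 lieG Ae e1) => /(_ _ nP).
    move=> /nbhs_ballP[r /= r0 rP]; exists r => // g Ug gr.
    rewrite -(UK _ Ug); apply: rP.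
    by rewrite -ball_normE /= sub0r normrN.
pose Q := lparam @` [set x : 'rV[R]_n | `|x| <= rho].
have cQ : compact Q.
  apply: continuous_compact.
    apply: continuous_in_subspaceT => x; rewrite inE /= => /rho2 xr.
    by have [] := lp _ xr.
  apply: bounded_closed_compact.
    exists rho; split => [|M rM x /= xr]; first exact: num_real.
    exact: le_trans xr (ltW rM).
  have -> : [set x : 'rV[R]_n | `|x| <= rho] =
      (fun Z : 'rV[R]_n => `|Z|) @^-1` [set y | y <= rho] by [].
  apply: closed_comp => [Z _|]; first exact: norm_continuous.
  exact: closed_le.
have UQ : U `<=` Q.
  by move=> g Ug; exists (lchart g); [case: Ug => _ /ltW|exact: UK].
have [D' [DK D'K D'c]] := delta_bij l0.
pose K0 := Q `&` ~` (D' @^-1` U).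
have cK0 : compact K0.
  apply: compact_closedI => //; apply: open_closedC.
  by apply: open_comp => // x _; exact: D'c.
have [c c0 cP] : exists2 c : R, 0 < c & forall g, K0 g -> c <= hnorm g.
  have [K00|K0n] := pselect (K0 !=set0); last first.
    by exists 1 => // g K0g; case: K0n; exists g.
  have [|g gK gmin] := compact_EVT_min K00 cK0 (f := fun q => d q 1%g).
    by apply: continuous_subspaceT; exact: dist_continuous.
  exists (hnorm g); last by move=> h K0h; apply: gmin; rewrite inE.
  rewrite lt_neqAle (hnorm_ge0 hd) andbT eq_sym; apply/negP => /eqP /(hnorm_eq0 hd) g1.
  move: gK; rewrite inE g1 => -[_ /=]; apply.
  by rewrite -(delta1 hdelta l0) DK.
exists c => //; exists Q => // p pc; suff Up : U p by exact: (UQ p Up).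
apply: contrapT => nUp.
have [j nUj Uj] : exists2 j, ~ U (iter j (delta l) p) & U (iter j.+1 (delta l) p).
  have [k] := flow p; elim: k => // k IH Uk1.
  by have [Uk|nUk] := pselect (U (iter k (delta l) p)); [exact: IH|exists k].
have hle k : hnorm (iter k (delta l) p) <= hnorm p.
  elim: k => //= k IH; rewrite (hnorm_delta hdelta hd) //.
  by apply: le_trans IH; rewrite ler_piMl ?(hnorm_ge0 hd) // ltW.
have : K0 (iter j.+1 (delta l) p).
  by split; [exact: (UQ _ Uj)|rewrite /= DK].
by move=> /cP; rewrite leNgt (le_lt_trans (hle _) pc).
Qed.

Lemma cball_compact p r : compact (cball d p r).
Proof.
have [[d0 _ _ _] dinv dl] := hd.
have [c c0 [Q cQ QP]] := small_hnorm_compact.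
have c2 : 0 < c / 2 by rewrite divr_gt0.
have c1 : compact (cball d 1%g (c / 2)).
  apply: (subclosed_compact (@cball_closed _ _) cQ) => q qc; apply: QP.
  by apply: le_lt_trans qc _; rewrite ltr_pdivrMr // ltr_pMr // ltr1n.
pose r' := Num.max r 1.
have r'0 : 0 < r' by rewrite lt_max ltr01 orbT.
pose l := r' / (c / 2).
have l0 : 0 < l by rewrite divr_gt0.
have [D' [DK D'K _]] := delta_bij l0.
have cm : continuous (fun g : G => p * delta l g)%g.
  move=> g; apply: (@continuous_comp _ _ _ (fun g => (p, delta l g))
    (fun p : G * G => (p.1 * p.2)%g)).
    by apply: cvg_pair => /=; [exact: cvg_cst|exact: (delta_cont hdelta)].
  exact: (lie_mul_continuous lieG).
have cI : compact ((fun g : G => p * delta l g)%g @` cball d 1%g (c / 2)).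
  by apply: continuous_compact => //; exact: continuous_subspaceT.
apply: (subclosed_compact (@cball_closed _ _) cI) => q qp.
exists (D' (p^-1 * q)%g); last by rewrite D'K mulVKg.
rewrite /cball /= -(ler_pM2l l0) -dl // D'K (delta1 hdelta) //.
rewrite -(dinv p) mulVKg mulg1 /l divfK ?gt_eqF //.
by apply: le_trans qp _; rewrite le_max lexx.
Qed.

(** By compactness the centers have a cluster point. *)
Lemma nested_cballs (p : nat -> G) (r : nat -> R) :
  (forall k, cball d (p k.+1) (r k.+1) `<=` cball d (p k) (r k)) ->
  (forall k, 0 <= r k) ->
  exists x, forall k, cball d (p k) (r k) x.
Proof.
move=> nest r0; have [[_ d00 _ _] _ _] := hd.
have nest' j k : (j <= k)%N -> cball d (p k) (r k) `<=` cball d (p j) (r j).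
  elim: k => [|k IH]; first by rewrite leqn0 => /eqP ->.
  rewrite leq_eqVlt => /orP[/eqP -> //|]; rewrite ltnS => jk.
  exact: subset_trans (nest k) (IH jk).
have pp k : cball d (p k) (r k) (p k) by rewrite /cball /= (d00 _ _).2.
have [|x [_ xc]] := @cball_compact (p 0%N) (r 0%N) (p @ \oo) _.
  by exists 0%N => // k _; apply: (nest' 0%N k _ _ (pp k)).
exists x => k; apply: cball_closed => B nB.
have [] := xc (cball d (p k) (r k)) B _ nB; last by move=> y [h1 h2]; exists y.
by exists k => // j kj; apply: (nest' k j kj _ (pp j)).
Qed.

Lemma cball_finite_net (r eps : R) : 0 < eps ->
  exists s : seq G, forall q, d q 1%g <= r -> exists2 x, x \in s & d q x < eps.
Proof.
move=> eps0; have [[_ d00 _ _] _ _] := hd.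
have := @cball_compact 1%g r; rewrite compact_cover.
move=> /(_ G [set: G] (fun x => [set q | d q x < eps])) [||D _ DP].
- move=> x _; have -> : [set q | d q x < eps] = (fun q => d q x) @^-1` [set y | y < eps] by [].
  apply: open_comp => [q _|]; first exact: dist_continuous.
  exact: open_lt.
- by move=> q _; exists q => //=; rewrite (d00 _ _).2.
- exists (finmap.enum_fset D) => q qr; have [x xD xq] := DP q qr.
  by exists x.
Qed.

End Topology.

(** * Differentiation and covering on homogeneous groups *)

Theorem theorem1p5 (R : realType) (n : nat) (G : groupTopologicalType)
    (A : set (chart G 'rV[R]_n)) (e : chart G 'rV[R]_n)
    (V : R -> {vspace 'rV[R]_n}) (delta : R -> G -> G) (d : G -> G -> R)
    (hG : homogeneous_group A e V)
    (hdelta : dilations A e V delta)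
    (hd : homogeneous_distance delta d) :
  (forall mu : {measure set (borel d) -> \bar R},
     locally_finite mu -> differentiation_theorem mu) <-> BCP d.
Proof.
have [dD _ _] := hd.
split=> [diff|bcp mu]; last exact: (BCP_differentiation dD bcp).
apply: contrapT => nbcp.
have large Q : exists (t : seq G) (r : G -> R) (p : G),
    besicovitch_family d t r p /\ (Q <= size t)%N.
  apply: contrapT => none; apply: nbcp.
  apply: (BCP_of_bounded_besicovitch hd (delta1 hdelta)
    (cball_finite_net hG hdelta hd) (Q := Q)) => t r p fam.
  rewrite leqNgt; apply/negP => Qt; apply: none; exists t, r, p; split=> //.
  exact: ltnW.
have /choice[w stars] k : exists w : (nat -> G) * (nat -> R) * R,
    star d (branching k) w.1.1 w.1.2 w.2.
  have [t [r [p [fam size_t]]]] := large (branching k).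
  have [|x [rho [eta xP]]] := besicovitch_star hd (delta1 hdelta) fam size_t.
    by rewrite (@leq_trans (2 ^ 1)) // leq_exp2l.
  by exists (x, rho, eta).
have [mu lf] := stars_not_differentiable hd (delta1 hdelta)
  (fun p r => nested_cballs hG hdelta hd (p := p) (r := r)) stars.
by apply; exact: diff.
Qed.
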